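(* Let $\mathcal D=\mathcal D(H,Q,k,\{h^{p,q}\})$ be the period domain of polarized Hodge structures of weight $k\ge1$ with Hodge numbers $h^{p,q}$ ($p+q=k$), where $\mathcal R=(h^{k,0},h^{k-1,1},\dots,h^{0,k})$ is a composition of $\sum_{p=0}^k h^{p,k-p}$. Then the $G$-invariant Hermitian metric $h$ on $\mathcal D$ has holomorphic sectional curvature in every nonzero direction $\xi\in T^h\mathcal D$ satisfying $$K(\xi)\le -C_{\mathcal R^t},$$ where $\mathcal R^t$ is the conjugate partition of $\mathcal R$. Moreover, the equality is achieved in some direction $\xi\in T^h\mathcal D$.
   Context: Period domain. $H_{\mathbb Z}$ is a lattice, $H_{\mathbb R}=H_{\mathbb Z}\otimes\mathbb R$, $H=H_{\mathbb Z}\otimes\mathbb C$, and $Q$ is a nondegenerate bilinear form on $H_{\mathbb Z}$, symmetric for $k$ even and skew-symmetric for $k$ odd. $\mathcal D=\mathcal D(H,Q,k,\{h^{p,q}\})$ is the space of all Hodge decompositions $H=\bigoplus_{p+q=k}H^{p,q}$, $\overline{H^{p,q}}=H^{q,p}$, $\dim H^{p,q}=h^{p,q}$, polarized by $Q$: $Q(H^{p,q},H^{p',q'})=0$ unless $p'=k-p$, and $b(u,v)=Q(i^{p-q}u,\bar v)$ is a Hermitian inner product on each $H^{p,q}$. It is a homogeneous space $\mathcal D=G/V$ with $G=Aut(H_{\mathbb R},Q)\cap SL(H_{\mathbb R})$ and $V$ the (compact) stabilizer of a reference Hodge structure. Let $\mathfrak g_{\mathbb C}=\{X\in\mathfrak{sl}(H):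 Q(Xu,v)+Q(u,Xv)=0\ \forall u,v\in H\}$, $\mathfrak g=\mathfrak g_{\mathbb C}\cap\mathfrak{gl}(H_{\mathbb R})$, and $\mathfrak g^{p,-p}=\{X\in\mathfrak g_{\mathbb C}: XH^{r,s}\subset H^{r+p,s-p}\}$, so $\mathfrak g_{\mathbb C}=\bigoplus_p\mathfrak g^{p,-p}$. With $\mathfrak m^-=\bigoplus_{p<0}\mathfrak g^{p,-p}$, the holomorphic tangent bundle is $T^{hol}\mathcal D=G\times_V\mathfrak m^-$, and the horizontal distribution is $T^h\mathcal D=G\times_V\mathfrak g^{-1,1}$. Metric. The Cartan involution is $\theta(X)=(-1)^p\bar X$ for $X\in\mathfrak g^{-p,p}$ (conjugation with respect to $\mathfrak g$). For $\xi=[g,X],\eta=[g,Y]\in T^{hol}_{gV}\mathcal D$, $h(\xi,\eta)=-B_0(X,\theta(Y))$ with $B_0(X,Y)=tr(XY)$. The holomorphic sectional curvature in the direction $\xi$ is $K(\xi)=\frac{h(R(\xi,\bar\xi)\xi,\xi)}{h(\xi,\xi)^2}$, $R$ being the curvature of $h$. Combinatorics. A composition of $N$ is an array $(r_1,\dots,r_m)$ of positive integers with sum $N$ (not necessarily monotone). Its conjugate partition $\mathcal R^t$ is the following partition of $N$: for each $i\ge1$ put $T_i=\{j: r_j\ge i\}$ and let $S_i$ be the multiset of lengths of the maximal runs of consecutive integers in $T_i$ (e.g. $T_i=\{2,3,4,5,7\}$ gives $\{4,1\}$); $\mathcal R^t$ is the disjoint union of all $S_i$ arranged in non-increasing order.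 For a partition $\lambda=(\lambda_1,\dots,\lambda_l)$ not equal to $(1,\dots,1)$, $C_\lambda=\frac{12}{\sum_{p}\lambda_p(\lambda_p^2-1)}$. *)

(* Defs.v *)
From HB Require Import structures.
From mathcomp Require Import all_boot all_order all_algebra.
From mathcomp Require Import boolp classical_sets reals topology normedtype derive.
From mathcomp Require Import complex.

Set Implicit Arguments.
Unset Strict Implicit.
Unset Printing Implicit Defensive.

Import Order.TTheory GRing.Theory Num.Theory.
Import numFieldNormedType.Exports.

Local Open Scope ring_scope.
Local Open Scope complex_scope.

(* Positions in an array of length N run over 0, ..., N - 1.                  *)
Definition max_run (T : pred nat) (a b : nat) : bool :=
  [&& (a < b)%N, all T (index_iota a b),
      (a == 0%N) || ~~ T a.-1 & ~~ T b].

Definition run_lengths (N : nat) (T : pred nat) : seq nat :=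
  [seq (ab.2 - ab.1)%N | ab <- allpairs pair (iota 0 N) (iota 0 N.+1)
                       & max_run T ab.1 ab.2].

(* T_i is empty when i > sumn r; nth returns 0 outside r, so that T_i (i > 0) *)
(* contains only positions of r.                                              *)
Definition conj_partition (r : seq nat) : seq nat :=
  sort geq (flatten [seq run_lengths (size r) (fun j => (i <= nth 0 r j)%N)
                    | i <- iota 1 (sumn r)]).

Definition partition_const (R : realType) (l : seq nat) : R :=
  12 / \sum_(x <- l) x%:R * (x%:R ^+ 2 - 1).

(* The Chern connection of a Hermitian metric, in holomorphic coordinates.     *)
Section HermitianGeometry.
Variable R : realType.
Local Notation C := R[i].

Definition conj_mx (m n : nat) (A : 'M[C]_(m, n)) : 'M[C]_(m, n) :=
  map_mx (@conjc R) A.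

Section Wirtinger.
Variables (V : lmodType C) (p q : nat).
Implicit Types (f : V -> 'M[C]_(p, q)) (x v : V).

(* Derivative at x along v, for the real structure underlying V.              *)
Definition real_deriv f x v : 'M[C]_(p, q) :=
  \matrix_(i, j)
    ((fun t : R^o => complex.Re (f (x + t%:C *: v) i j) : R^o)^`()%classic 0
     +i* (fun t : R^o => complex.Im (f (x + t%:C *: v) i j) : R^o)^`()%classic 0).

Definition d_z f x v : 'M[C]_(p, q) :=
  2^-1 *: (real_deriv f x v - 'i%C *: real_deriv f x ('i%C *: v)).

Definition d_zbar f x v : 'M[C]_(p, q) :=
  2^-1 *: (real_deriv f x v + 'i%C *: real_deriv f x ('i%C *: v)).

End Wirtinger.

Section ChernCurvature.
Variable N : nat.

(* H z is the Gram matrix h_z(d/dz_i, d/dz_j) of a Hermitian metric on an open *)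
(* subset of C^N, so h_z(u, v) = u H(z) v^* for row vectors u, v.              *)
Variable H : 'rV[C]_N -> 'M[C]_N.

Definition herm_form (z u v : 'rV[C]_N) : C := (u *m H z *m (conj_mx v)^T) 0 0.

(* The Chern connection is s |-> ds + s A with A = (d' H) H^-1.               *)
Definition chern_form (v z : 'rV[C]_N) : 'M[C]_N := d_z H z v *m invmx (H z).

(* R(v, conj w) u = - u (d''_w A(v)); the sign comes from d'' A, a 2-form in   *)
(* dzbar /\ dz.                                                               *)
Definition chern_curv (z v w u : 'rV[C]_N) : 'rV[C]_N :=
  - (u *m d_zbar (chern_form v) z w).

Definition hol_sect_curv (z v : 'rV[C]_N) : C :=
  herm_form z (chern_curv z v v v) v / herm_form z v v ^+ 2.

End ChernCurvature.
End HermitianGeometry.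

(* Conventions: H_Z = Z^n and H = C^n, as row vectors.  A matrix denotes the   *)
(* subspace of H spanned by its rows, and X in gl(H) acts by u |-> u *m X, so  *)
(* that composition of endomorphisms is the matrix product in reverse order.  *)
(* F p stands for H^{p, k - p}.                                               *)
Section PeriodDomain.
Variables (R : realType) (n k : nat).
Local Notation C := R[i].
Variable Q : 'M[int]_n.
Implicit Types (F : 'I_k.+1 -> 'M[C]_n) (X Y Z : 'M[C]_n) (u v : 'rV[C]_n).

Definition polC : 'M[C]_n := map_mx (fun a : int => a%:~R) Q.

Definition pol (u v : 'rV[C]_n) : C := (u *m polC *m v^T) 0 0.

Definition hodge_decomposition F : Prop :=
  [/\ (\sum_p F p :=: 1%:M)%MS, mxdirect (\sum_p F p)%MS
    & forall p, (conj_mx (F p) :=: F (rev_ord p))%MS].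

(* The form b of the polarization is Hermitian on H^{p,q} as soon as Q is     *)
(* (-1)^k-symmetric; hence only positivity is required.                       *)
Definition polarized F : Prop :=
  (forall (p p' : 'I_k.+1) (u v : 'rV[C]_n), p' != rev_ord p ->
     (u <= F p)%MS -> (v <= F p')%MS -> pol u v = 0)
  /\ (forall (p : 'I_k.+1) (u : 'rV[C]_n), (u <= F p)%MS -> u != 0 ->
        0 < pol ('i%C ^ (p%:Z - (rev_ord p)%:Z) *: u) (conj_mx u)).

Definition period_domain (h : 'I_k.+1 -> nat) F : Prop :=
  [/\ hodge_decomposition F, forall p, \rank (F p) = h p & polarized F].

Definition inf_isom X : 'M[C]_n := X *m polC + polC *m X^T.

(* X *m polC + polC *m X^T = 0 says that pol (X u) v + pol u (X v) = 0.       *)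
Definition lie_gC : {vspace 'M[C]_n} :=
  (lker (linfun inf_isom) :&: lker (linfun (fun X : 'M[C]_n => \tr X : C^o)))%VS.

Definition hodge_ext F (p : int) : 'M[C]_n :=
  (\sum_(r < k.+1 | r%:Z == p) F r)%MS.

(* X maps F r into F (r + p); recall (A <= B)%MS iff A *m cokermx B = 0.      *)
Definition lie_graded F (p : int) : {vspace 'M[C]_n} :=
  (lie_gC :&: \bigcap_(r < k.+1)
     lker (linfun (fun X => F r *m X *m cokermx (hodge_ext F (r%:Z + p)))))%VS.

Definition lie_mminus F : {vspace 'M[C]_n} :=
  (\sum_(j < k) lie_graded F (- (j.+1)%:Z))%VS.

Definition hodge_proj F (p : 'I_k.+1) : 'M[C]_n :=
  proj_mx (F p) (\sum_(q | q != p) F q)%MS.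

(* The component of X that maps H^{r, k - r} to H^{s, k - s}.                 *)
Definition hodge_block F X (r s : 'I_k.+1) : 'M[C]_n :=
  hodge_proj F r *m X *m hodge_proj F s.

Definition mminus_part F X : 'M[C]_n :=
  \sum_(r < k.+1) \sum_(s < k.+1 | (s < r)%N) hodge_block F X r s.

Definition cartan_inv F X : 'M[C]_n :=
  \sum_(r < k.+1) \sum_(s < k.+1) (-1) ^+ (r + s)%N *: conj_mx (hodge_block F X r s).

(* The tangent space of the compact dual at F is gC / F^0 gC, which m^-       *)
(* represents; X and Y are arbitrary representatives of tangent vectors.      *)
Definition hodge_metric F X Y : C :=
  - \tr (mminus_part F X *m cartan_inv F (mminus_part F Y)).

(* For X nilpotent, X ^+ n = 0 and this is the whole exponential series.      *)
Definition exp_nilp X : 'M[C]_n := \sum_(j < n) (j`!%:R)^-1 *: X ^+ j.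

Definition hodge_filt F (p : nat) : 'M[C]_n :=
  (\sum_(r < k.+1 | (p <= r)%N) F r)%MS.

(* The holomorphic chart X |-> exp(X) F of the compact dual, X in m^-_F, which *)
(* takes its values in the open subset D for X close to 0.  The Hodge         *)
(* decomposition is recovered from the filtration E = exp(X) F by             *)
(* H^{p,q} = E^p /\ conj(E^q).                                                *)
Definition chart F X (p : 'I_k.+1) : 'M[C]_n :=
  (hodge_filt F p *m exp_nilp X
     :&: conj_mx (hodge_filt F (rev_ord p) *m exp_nilp X))%MS.

(* The differential of the chart at X maps Y to the class at chart F X of the *)
(* endomorphism (d exp)_X(Y) o exp(X)^-1.                                     *)
Definition chart_diff X Y : 'M[C]_n := exp_nilp (- X) *m d_z exp_nilp X Y.

Definition chart_point F (z : 'rV[C]_(\dim (lie_mminus F))) : 'M[C]_n :=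
  \sum_i z 0 i *: (vbasis (lie_mminus F))`_i.

Definition chart_gram F (z : 'rV[C]_(\dim (lie_mminus F))) :
    'M[C]_(\dim (lie_mminus F)) :=
  \matrix_(i, j)
    hodge_metric (chart F (chart_point z))
      (chart_diff (chart_point z) (vbasis (lie_mminus F))`_i)
      (chart_diff (chart_point z) (vbasis (lie_mminus F))`_j).

(* Holomorphic sectional curvature of h at F in the direction X in m^-_F; the  *)
(* curvature is a tensor, so computing it in this chart loses no generality.  *)
Definition hodge_curv F X : C :=
  hol_sect_curv (@chart_gram F) 0 (\row_i coord (vbasis (lie_mminus F)) i X).

Lemma mem_lie_graded F (p : int) X :
  reflect [/\ inf_isom X = 0, \tr X = 0
             & forall r : 'I_k.+1, (F r *m X <= hodge_ext F (r%:Z + p))%MS]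
          (X \in lie_graded F p).
Proof.
have trE (Y : 'M[C]_n) : linfun (fun Z : 'M[C]_n => \tr Z : C^o) Y = \tr Y.
  have lin : linear (fun Z : 'M[C]_n => \tr Z : C^o).
    by move=> a A B; rewrite linearD linearZ.
  by rewrite -[LHS]/(linfun (HB.pack_for {linear 'M[C]_n -> C^o}
       (fun Z : 'M[C]_n => \tr Z : C^o)
       (GRing.isLinear.Build _ _ _ _ _ lin)) Y) lfunE.
have isoE (Y : 'M[C]_n) : linfun inf_isom Y = inf_isom Y.
  have lin : linear inf_isom.
    move=> a A B; rewrite /inf_isom linearD linearZ /= mulmxDl mulmxDr.
    by rewrite -!scalemxAl -!scalemxAr scalerDr addrACA.
  by rewrite -[LHS]/(linfun (HB.pack_for {linear 'M[C]_n -> 'M[C]_n} inf_isom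
       (GRing.isLinear.Build _ _ _ _ _ lin)) Y) lfunE.
have mulE (A B Y : 'M[C]_n) :
    linfun (fun Z => A *m Z *m B) Y = A *m Y *m B.
  have lin : linear (fun Z => A *m Z *m B).
    by move=> a U V; rewrite mulmxDr mulmxDl -scalemxAr -scalemxAl.
  by rewrite -[LHS]/(linfun (HB.pack_for {linear 'M[C]_n -> 'M[C]_n}
       (fun Z => A *m Z *m B) (GRing.isLinear.Build _ _ _ _ _ lin)) Y) lfunE.
rewrite /lie_graded memv_cap /lie_gC memv_cap.
rewrite [X in X && _ && _]memv_ker [X in _ && X && _]memv_ker isoE trE.
apply: (iffP idP).
  move=> /andP[/andP[/eqP -> /eqP ->]] /subv_bigcapP XF; split=> // r.
  by have := XF r isT; rewrite -memvE memv_ker mulE submxE.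
move=> [-> -> XF]; rewrite !eqxx /=; apply/subv_bigcapP => r _.
by rewrite -memvE memv_ker mulE -submxE.
Qed.

Definition group_G : set 'M[C]_n :=
  [set g | [/\ conj_mx g = g, g *m polC *m g^T = polC & \det g = 1]].

Lemma proj_mx_uniq (A B M : 'M[C]_n) :
  (1%:M <= A + B)%MS -> (A :&: B = 0)%MS -> A *m M = A -> B *m M = 0 ->
  proj_mx A B = M.
Proof.
move=> AB1 AB0 AM BM.
have E : proj_mx A B + proj_mx B A = 1%:M.
  by rewrite -[X in X + _]mul1mx -[X in _ + X]mul1mx add_proj_mx.
have /submxP[D DA] : (proj_mx A B <= A)%MS.
  by rewrite -[X in (X <= _)%MS]mul1mx proj_mx_sub.
have /submxP[D' DB] : (proj_mx B A <= B)%MS.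
  by rewrite -[X in (X <= _)%MS]mul1mx proj_mx_sub.
by rewrite -[RHS]mul1mx -E mulmxDl DB -(mulmxA D') BM mulmx0 addr0 DA -mulmxA AM.
Qed.

Lemma hodge_proj_act F (g : 'M[C]_n) p :
    (\sum_p F p :=: 1%:M)%MS -> mxdirect (\sum_p F p)%MS -> g \in unitmx ->
  hodge_proj (fun q => F q *m g) p = invmx g *m hodge_proj F p *m g.
Proof.
move=> F1 /mxdirect_sumsP Fd ug.
pose S := (\sum_(q | q != p) F q)%MS.
have SF : (F p :&: S = 0)%MS by exact: Fd.
have Sg : (\sum_(q | q != p) F q *m g <= S *m g)%MS.
  by rewrite sumsmxMr.
have full : (1%:M <= F p + S)%MS.
  have : (1%:M <= \sum_q F q)%MS by rewrite F1.
  by rewrite (bigD1 p).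
apply: proj_mx_uniq.
- have -> : 1%:M = invmx g *m g by rewrite mulVmx.
  apply: (@submx_trans _ _ _ _ _ _ ((F p + S)%MS *m g)).
    by apply: submxMr; apply: submx_trans full; exact: submx1.
  by rewrite addsmxMr addsmxS // sumsmxMr.
- apply/eqP; rewrite -submx0; set I := (_ :&: _)%MS.
  have IF : (I *m invmx g <= F p)%MS.
    have := submxMr (invmx g) (capmxSl (F p *m g) (\sum_(q | q != p) F q *m g)%MS).
    by rewrite mulmxK.
  have IS : (I *m invmx g <= S)%MS.
    have := submxMr (invmx g)
      (submx_trans (capmxSr (F p *m g) (\sum_(q | q != p) F q *m g)%MS) Sg).
    by rewrite mulmxK.
  have : (I *m invmx g <= F p :&: S)%MS by rewrite sub_capmx IF.
  rewrite SF submx0 => /eqP I0.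
  by rewrite -[I](mulmxKV ug) I0 mul0mx.
- have P1 : F p *m hodge_proj F p = F p by exact: (proj_mx_id SF (submx_refl _)).
  by move: (hodge_proj F p) P1 => P P1; rewrite !mulmxA mulmxK // P1.
- have /submxP[D ->] := Sg.
  have S0 : S *m hodge_proj F p = 0 by exact: (proj_mx_0 SF (submx_refl _)).
  move: (hodge_proj F p) S0 => P S0.
  by rewrite !mulmxA mulmxK // -(mulmxA D) S0 mulmx0 mul0mx.
Qed.

(* With X, Y in m^-_F this is h([g, X], [g, Y]) = - B_0(X, theta(Y)), where   *)
(* [g, X] is the vector Ad(g) X at g F.                                       *)
Lemma hodge_metric_invariant F (g X Y : 'M[C]_n) :
    hodge_decomposition F -> group_G g ->
  hodge_metric (fun p => F p *m g) (invmx g *m X *m g) (invmx g *m Y *m g)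
  = hodge_metric F X Y.
Proof.
move=> [F1 Fd _] [gR _ detg].
have ug : g \in unitmx by rewrite unitmxE detg unitr1.
have blk Z r s : hodge_block (fun p => F p *m g) (invmx g *m Z *m g) r s
    = invmx g *m hodge_block F Z r s *m g.
  rewrite /hodge_block !hodge_proj_act //.
  move: (hodge_proj F r) (hodge_proj F s) => P P'.
  by rewrite !mulmxA !(mulmxK ug).
have mm Z : mminus_part (fun p => F p *m g) (invmx g *m Z *m g)
    = invmx g *m mminus_part F Z *m g.
  rewrite /mminus_part mulmx_sumr mulmx_suml; apply: eq_bigr => r _.
  rewrite mulmx_sumr mulmx_suml; apply: eq_bigr => s _; exact: blk.
have ci Z : cartan_inv (fun p => F p *m g) (invmx g *m Z *m g)
    = invmx g *m cartan_inv F Z *m g.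
  rewrite /cartan_inv mulmx_sumr mulmx_suml; apply: eq_bigr => r _.
  rewrite mulmx_sumr mulmx_suml; apply: eq_bigr => s _.
  rewrite blk -scalemxAr -scalemxAl; congr (_ *: _).
  by rewrite /conj_mx !map_mxM map_invmx -/(conj_mx g) gR.
rewrite /hodge_metric !mm ci !mulmxA (mulmxK ug) -!mulmxA mxtrace_mulC.
by rewrite -!mulmxA mulmxV // mulmx1.
Qed.

End PeriodDomain.

(* Main.v *)
(* Let X have degree -1 at F and let Xb be its complex conjugate, which is also
   its adjoint for the Hodge inner product.  Along s |-> exp(sX) F each step of
   the filtration and its conjugate complement are moved by an explicit matrix;
   expanding the metric to second order in s, the first-order term vanishes in
   the direction X, and K(X) = - tr([X, Xb]^2) / tr(X Xb)^2.

   Upper bound.  An sl2-triple through a nilpotent X assigns weights to a Jordan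
   basis; Gram-Schmidt in the order of the weights yields a unitary frame and a
   real diagonal D in it with tr([X, X*] D) >= 2 |X|^2 and
   |D|^2 <= 2 sum_d d rk(X^d).  Cauchy-Schwarz then gives
   2 |X|^4 <= tr([X, X*]^2) sum_d d rk(X^d).  On H^{p,q} the rank of X^d is at
   most each of the Hodge numbers that it passes through, so the last sum is at
   most W, the sum of y - x over all i and all x < y with [x, y] inside T_i.
   Summing y - x over the pairs of a run of length l gives l (l^2 - 1) / 6,
   whence C_{R^t} = 2 / W.

   Equality.  Choose unitary frames of the H^{p,q}, exchanged by conjugation,
   and let X shift the i-th vectors down along each run of T_i, the square of
   the coefficient across a gap being the number of segments of T_i that cross
   it.  On each run X generates an sl2-triple, tr(X Xb) = W and
   tr([X, Xb]^2) = 2 W.                                                       *)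
Require Import Defs.
From mathcomp Require Import all_boot all_order perm all_algebra.
From mathcomp Require Import boolp classical_sets functions reals topology normedtype derive.
From mathcomp Require Import complex ring zify.

Set Implicit Arguments.
Unset Strict Implicit.
Unset Printing Implicit Defensive.
Import Order.TTheory GRing.Theory Num.Theory.
Import numFieldNormedType.Exports.
Local Open Scope ring_scope.
Local Open Scope complex_scope.

(** * Wirtinger calculus *)

Section Calculus.
Variable R : realType.
Local Notation C := R[i].

(** The metric is defined through intersections of subspaces, which offer nothing to differentiate.
    Replacing them by projections turns the Gram matrix along a complex line into an expression
    built from [exp_nilp (s *: X)] and its conjugate by products, traces and inverses, to which the
    usual rules apply. At the origin the derivatives of the projections are commutators with [X] and
    Xb, so that the second variation can be integrated by parts inside the trace.

    In the upper bound the semisimple element of an sl2-triple through [X] need not be self-adjoint,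
    so its eigenvectors need not be orthogonal. Orthogonalizing them in the order of the weights
    turns the exact drop of each weight by 2 into a drop by at least 2, which is the direction the
    estimate needs. The 2 in tr([X, X*] D) >= 2 |X|^2 is this drop. Equality in Cauchy-Schwarz asks
    for a diagonal of [X, X*] proportional to D; this is why the sharp example takes its
    coefficients from unitary representations of sl2. *)

Definition is_cderive (f : R -> C) (t : R) (df : C) : Prop :=
  is_derive (t : R^o) (1 : R^o) (fun s : R^o => complex.Re (f s) : R^o) (complex.Re df)
  /\ is_derive (t : R^o) (1 : R^o) (fun s : R^o => complex.Im (f s) : R^o) (complex.Im df).

Lemma cderive_eq f t a b : is_cderive f t a -> a = b -> is_cderive f t b.
Proof. by move=> ? <-. Qed.

Lemma cderive_ext f g t a : f =1 g -> is_cderive f t a -> is_cderive g t a.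
Proof. by move=> /funext ->. Qed.

Lemma cderive_cst (c : C) t : is_cderive (fun=> c) t 0.
Proof. by split; apply: is_derive_cst. Qed.

Lemma cderive_id t : is_cderive (fun s => s%:C) t 1.
Proof. by split; [apply: is_derive_id|apply: is_derive_cst]. Qed.

Lemma cderiveD f g t a b : is_cderive f t a -> is_cderive g t b ->
  is_cderive (fun s => f s + g s) t (a + b).
Proof.
move=> [fr fi] [gr gi]; split.
  have -> : (fun s : R^o => complex.Re (f s + g s) : R^o)
     = (fun s : R^o => complex.Re (f s) : R^o) \+ (fun s : R^o => complex.Re (g s) : R^o).
    by apply/funext => s /=; case: (f s) => ? ?; case: (g s).
  have -> : complex.Re (a + b) = complex.Re a + complex.Re b by case: a {fr fi}; case: b {gr gi}.
  exact: is_deriveD.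
have -> : (fun s : R^o => complex.Im (f s + g s) : R^o)
     = (fun s : R^o => complex.Im (f s) : R^o) \+ (fun s : R^o => complex.Im (g s) : R^o).
  by apply/funext => s /=; case: (f s) => ? ?; case: (g s).
have -> : complex.Im (a + b) = complex.Im a + complex.Im b by case: a {fr fi}; case: b {gr gi}.
exact: is_deriveD.
Qed.

Lemma cderiveJ f t a : is_cderive f t a ->
  is_cderive (fun s => (f s)^*) t (a^*).
Proof.
move=> [fr fi]; split.
  have -> : (fun s : R^o => complex.Re ((f s)^*) : R^o) = (fun s : R^o => complex.Re (f s) : R^o).
    by apply/funext => s /=; case: (f s).
  by case: a fr {fi}.
pose g : R^o -> R^o := fun s => complex.Im (f s).
have -> : (fun s : R^o => complex.Im ((f s)^*) : R^o) = - g.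
  by apply/funext => s /=; rewrite fctE /g; case: (f s).
have -> : complex.Im (a^*) = - complex.Im a by case: a {fr fi}.
exact: is_deriveN.
Qed.

Lemma cderiveM f g t a b : is_cderive f t a -> is_cderive g t b ->
  is_cderive (fun s => f s * g s) t (a * g t + f t * b).
Proof.
pose rf : R^o -> R^o := fun s => complex.Re (f s).
pose mf : R^o -> R^o := fun s => complex.Im (f s).
pose rg : R^o -> R^o := fun s => complex.Re (g s).
pose mg : R^o -> R^o := fun s => complex.Im (g s).
move=> [fr fi] [gr gi]; split.
  have -> : (fun s : R^o => complex.Re (f s * g s) : R^o) = rf * rg - mf * mg.
    by apply/funext => s /=; rewrite !fctE /rf /rg /mf /mg; case: (f s) => ? ?; case: (g s).
  apply: is_derive_eq.
  rewrite /= /GRing.scale /= /rf /rg /mf /mg; case: (f t) => x y; case: (g t) => x' y'.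
  case: a {fr fi} => u v; case: b {gr gi} => u' v' /=; ring.
have -> : (fun s : R^o => complex.Im (f s * g s) : R^o) = rf * mg + mf * rg.
  by apply/funext => s /=; rewrite !fctE /rf /rg /mf /mg; case: (f s) => ? ?; case: (g s).
apply: is_derive_eq.
rewrite /= /GRing.scale /= /rf /rg /mf /mg; case: (f t) => x y; case: (g t) => x' y'.
case: a {fr fi} => u v; case: b {gr gi} => u' v' /=; ring.
Qed.

Lemma cderive_sum (I : Type) (r : seq I) (P : pred I) (f : I -> R -> C) t (df : I -> C) :
  (forall i, P i -> is_cderive (f i) t (df i)) ->
  is_cderive (fun s => \sum_(i <- r | P i) f i s) t (\sum_(i <- r | P i) df i).
Proof.
move=> fd; elim: r => [|i r IH].
  rewrite big_nil; apply: cderive_ext (cderive_cst 0 t) => s; by rewrite big_nil.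
rewrite big_cons; case: ifPn => Pi.
  by apply: cderive_ext (cderiveD (fd i Pi) IH) => s; rewrite big_cons Pi.
by apply: cderive_ext IH => s; rewrite big_cons (negPf Pi).
Qed.

Lemma cderive_prod (I : Type) (r : seq I) (P : pred I) (f : I -> R -> C) t :
  (forall i, P i -> exists d, is_cderive (f i) t d) ->
  exists d, is_cderive (fun s => \prod_(i <- r | P i) f i s) t d.
Proof.
move=> fd; elim: r => [|i r [d IH]].
  exists 0; apply: cderive_ext (cderive_cst 1 t) => s; by rewrite big_nil.
case: (boolP (P i)) => Pi.
  have [d' fi] := fd i Pi; eexists.
  by apply: cderive_ext (cderiveM fi IH) => s; rewrite big_cons Pi.
by exists d; apply: cderive_ext IH => s; rewrite big_cons (negPf Pi).
Qed.

Lemma cderive_uniq f t a b : is_cderive f t a -> is_cderive f t b -> a = b.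
Proof.
move=> [[_ ar] [_ ai]] [[_ br] [_ bi]]; apply/eqP; rewrite eq_complex.
by rewrite -ar br -ai bi !eqxx.
Qed.

Lemma cderive_near f g t a : (\forall s \near (t : R^o), f s = g s) ->
  is_cderive f t a -> is_cderive g t a.
Proof.
move=> fg [fr fi]; split.
  by apply: near_eq_is_derive fr; apply: filterS fg => s ->.
by apply: near_eq_is_derive fi; apply: filterS fg => s ->.
Qed.

Lemma cderive_near_neq0 f t a : is_cderive f t a -> f t != 0 ->
  \forall s \near (t : R^o), f s != 0.
Proof.
have key (g : R^o -> R^o) d : is_derive (t : R^o) (1 : R^o) g d -> g t != 0 ->
    \forall s \near (t : R^o), g s != 0.
  move=> [gd _] gt.
  have /differentiable_continuous gc : differentiable g t by apply/derivable1_diffP.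
  exact: (cvgr_neq0 _ gc gt).
move=> [fr fi]; rewrite eq_complex negb_and => /orP[] f0.
  by apply: filterS (key _ _ fr f0) => s s0; rewrite eq_complex negb_and s0.
by apply: filterS (key _ _ fi f0) => s s0; rewrite eq_complex negb_and s0 orbT.
Qed.

(** The inverse is the conjugate divided by |f|^2, so only a real function has to be inverted. The
    value of the derivative is left open, because for matrices it is recovered from f f^-1 = 1. *)
Lemma cderive_inv f t a : is_cderive f t a -> f t != 0 ->
  exists d, is_cderive (fun s => (f s)^-1) t d.
Proof.
move=> fd f0.
have nd := cderiveM fd (cderiveJ fd).
pose g s : R := complex.Re (f s * (f s)^*).
have gE s : (g s)%:C = f s * (f s)^*.
  by rewrite /g RRe_real // ger0_real // mulcJ_ge0.
have g0 : g t != 0.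
  by rewrite -(inj_eq (@complexI R)) gE mulf_neq0 // conjc_eq0.
have [d gd] : exists d, is_derive (t : R^o) (1 : R^o) (fun s : R^o => (g s)^-1 : R^o) d.
  have [gd _] := nd.1.
  have := derivableV (f := fun s : R^o => g s : R^o) g0 gd.
  by move=> /derivableP H; eexists; exact: H.
have gi : is_cderive (fun s => ((g s)^-1)%:C) t d%:C by split => //; apply: is_derive_cst.
eexists; apply: cderive_ext (cderiveM (cderiveJ fd) gi) => s.
(* With 0^-1 = 0 the formula also holds at zeros of [f], so no neighbourhood has to be chosen. *)
case: (eqVneq (f s) 0) => [->|fs0]; first by rewrite conjc0 invr0 mul0r.
by rewrite [((g s)^-1)%:C]fmorphV /= gE invfM mulrCA mulfV ?mulr1 ?conjc_eq0.
Qed.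

Definition is_mderive p q (f : R -> 'M[C]_(p, q)) (t : R) (df : 'M[C]_(p, q)) : Prop :=
  forall i j, is_cderive (fun s => f s i j) t (df i j).

Section Matrices.
Variables (p q r : nat).
Implicit Types (f : R -> 'M[C]_(p, q)).

Lemma mderive_eq f t a b : is_mderive f t a -> a = b -> is_mderive f t b.
Proof. by move=> ? <-. Qed.

Lemma mderive_ext f g t a : f =1 g -> is_mderive f t a -> is_mderive g t a.
Proof. by move=> /funext ->. Qed.

Lemma mderive_near f g t a : (\forall s \near (t : R^o), f s = g s) ->
  is_mderive f t a -> is_mderive g t a.
Proof.
by move=> fg fd i j; apply: cderive_near (fd i j); apply: filterS fg => s ->.
Qed.

Lemma mderive_uniq f t a b : is_mderive f t a -> is_mderive f t b -> a = b.
Proof. by move=> fa fb; apply/matrixP => i j; apply: cderive_uniq (fa i j) (fb i j). Qed.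

Lemma mderive_cst (c : 'M[C]_(p, q)) t : is_mderive (fun=> c) t 0.
Proof. by move=> i j; rewrite mxE; apply: cderive_cst. Qed.

Lemma mderiveD f g t a b : is_mderive f t a -> is_mderive g t b ->
  is_mderive (fun s => f s + g s) t (a + b).
Proof.
move=> fa gb i j; rewrite mxE; apply: cderive_ext (cderiveD (fa i j) (gb i j)).
by move=> s; rewrite mxE.
Qed.

Lemma mderiveJ f t a : is_mderive f t a ->
  is_mderive (fun s => conj_mx (f s)) t (conj_mx a).
Proof.
move=> fa i j; rewrite mxE; apply: cderive_ext (cderiveJ (fa i j)).
by move=> s; rewrite mxE.
Qed.

Lemma mderiveM f (g : R -> 'M[C]_(q, r)) t a b : is_mderive f t a -> is_mderive g t b ->
  is_mderive (fun s => f s *m g s) t (a *m g t + f t *m b).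
Proof.
move=> fa gb i j.
apply: (cderive_ext (f := fun s => \sum_k f s i k * g s k j)) => [s|].
  by rewrite mxE.
rewrite !mxE -big_split; apply: cderive_sum => k _.
exact: cderiveM (fa i k) (gb k j).
Qed.

Lemma mderiveZ (u : R -> C) f t du df : is_cderive u t du -> is_mderive f t df ->
  is_mderive (fun s => u s *: f s) t (du *: f t + u t *: df).
Proof.
move=> ud fd i j; rewrite !mxE; apply: cderive_ext (cderiveM ud (fd i j)) => s.
by rewrite mxE.
Qed.

Lemma mderive_sum (I : Type) (s : seq I) (P : pred I) (f : I -> R -> 'M[C]_(p, q)) t df :
  (forall i, P i -> is_mderive (f i) t (df i)) ->
  is_mderive (fun u => \sum_(i <- s | P i) f i u) t (\sum_(i <- s | P i) df i).
Proof.
move=> fd i j; rewrite summxE.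
apply: (cderive_ext (f := fun u => \sum_(k <- s | P k) f k u i j)) => [u|].
  by rewrite summxE.
by apply: cderive_sum => k Pk; apply: fd.
Qed.

End Matrices.

Lemma cderive_trace n (f : R -> 'M[C]_n) t a : is_mderive f t a ->
  is_cderive (fun s => \tr (f s)) t (\tr a).
Proof. by move=> fa; apply: cderive_sum => i _; apply: fa. Qed.

Lemma cderive_det n (f : R -> 'M[C]_n) t a : is_mderive f t a ->
  exists d, is_cderive (fun s => \det (f s)) t d.
Proof.
move=> fa.
have step (s : {perm 'I_n}) :
    exists d, is_cderive (fun u => (-1) ^+ s * \prod_i f u i (s i)) t d.
  have [d dP] := cderive_prod (index_enum 'I_n) (P := predT) (t := t)
    (f := fun i u => f u i (s i)) (fun i _ => ex_intro _ _ (fa i (s i))).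
  by eexists; apply: cderiveM dP; apply: cderive_cst.
have [d dP] := boolp.choice step.
by exists (\sum_s d s); apply: cderive_sum => s _; apply: dP.
Qed.

Lemma mderive_near_unit n (f : R -> 'M[C]_n) t a : is_mderive f t a -> f t \in unitmx ->
  \forall s \near (t : R^o), f s \in unitmx.
Proof.
move=> fa; rewrite unitmxE unitfE => f0; have [d dd] := cderive_det fa.
by apply: filterS (cderive_near_neq0 dd f0) => s s0; rewrite unitmxE unitfE.
Qed.

(** Cramer's formula shows that the inverse is differentiable; differentiating f f^-1 = 1, valid
    near [t], then gives the value. *)
Lemma mderive_inv n (f : R -> 'M[C]_n) t a : is_mderive f t a -> f t \in unitmx ->
  is_mderive (fun s => invmx (f s)) t (- (invmx (f t) *m a *m invmx (f t))).
Proof.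
move=> fa fu.
have nu := mderive_near_unit fa fu.
have [d dd] := cderive_det fa.
have f0 : \det (f t) != 0 by rewrite -unitfE -unitmxE.
have [d' dd'] := cderive_inv dd f0.
have [b fb] : exists b, is_mderive (fun s => invmx (f s)) t b.
  suff [b fb] : exists b, is_mderive (fun s => \adj (f s)) t b.
    exists (d' *: \adj (f t) + (\det (f t))^-1 *: b).
    apply: mderive_near (mderiveZ dd' fb); apply: filterS nu => s su.
    by rewrite /invmx su.
  have step (ij : 'I_n * 'I_n) : exists b, is_cderive (fun s => \adj (f s) ij.1 ij.2) t b.
    case: ij => i j /=.
    have [e eP] : exists e, is_cderive (fun s => \det (row' j (col' i (f s)))) t e.
      apply: (cderive_det (a := row' j (col' i a))) => k l; rewrite !mxE.
      by apply: cderive_ext (fa _ _) => s; rewrite !mxE.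
    eexists; apply: cderive_ext (cderiveM (cderive_cst ((-1) ^+ (j + i)) t) eP) => s.
    by rewrite !mxE /cofactor.
  have [b bP] := boolp.choice step.
  by exists (\matrix_(i, j) b (i, j)) => i j; rewrite mxE; exact: (bP (i, j)).
have one : is_mderive (fun s => f s *m invmx (f s)) t 0.
  by apply: mderive_near (mderive_cst 1%:M t); apply: filterS nu => s su; rewrite mulmxV.
have /eqP := mderive_uniq (mderiveM fa fb) one.
rewrite addrC addr_eq0 => /eqP E.
apply: mderive_eq fb _.
by rewrite -[LHS](mulKmx fu) E mulmxN mulmxA.
Qed.

End Calculus.

Section Wirtinger.
Variable R : realType.
Local Notation C := R[i].

Lemma real_deriv_mderive (V : lmodType C) p q (f : V -> 'M[C]_(p, q)) x v d :
  is_mderive (fun t => f (x + t%:C *: v)) 0 d -> real_deriv f x v = d.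
Proof.
move=> fd; apply/matrixP => i j; rewrite mxE !derive1E.
have [[_ ->] [_ ->]] := fd i j.
by case: (d i j).
Qed.

(* A and B are the d/dz and d/dzbar derivatives of f at s; differentiability is *)
(* only asked along real lines, as in the definition of d_z.                    *)
Definition is_cdiff p q (f : C -> 'M[C]_(p, q)) (s : C) (A B : 'M[C]_(p, q)) : Prop :=
  forall c, is_mderive (fun t => f (s + t%:C * c)) 0 (c *: A + c^* *: B).

Lemma sqr_i_mul : 'i%C * 'i%C = -1 :> C.
Proof. by rewrite -expr2 sqr_i. Qed.

Lemma conjc_i : ('i%C)^* = - 'i%C :> C.
Proof. by apply/eqP; rewrite eq_complex /= oppr0 !eqxx. Qed.

(** Here [x], [y], [z] stand for i, its conjugate and the conjugate of 1: the derivatives along 1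
    and i determine both Wirtinger derivatives. *)
Lemma wirtinger_solve p q (A B : 'M[C]_(p, q)) (x y z : C) :
  x * x = -1 -> y = - x -> z = 1 ->
  2^-1 *: ((1 *: A + z *: B) - x *: (x *: A + y *: B)) = A /\
  2^-1 *: ((1 *: A + z *: B) + x *: (x *: A + y *: B)) = B.
Proof.
move=> i2 -> ->; have two : (2 : C) != 0 by rewrite pnatr_eq0.
have c (u v : C) : x * (x * u + - x * v) = v - u.
  by rewrite mulrDr !mulrA mulrN i2 mulN1r opprK mul1r addrC.
split; apply/matrixP => i j; rewrite !mxE !mul1r c.
  have -> : A i j + B i j - (B i j - A i j) = 2 * A i j by ring.
  by rewrite mulKf.
have -> : A i j + B i j + (B i j - A i j) = 2 * B i j by ring.
by rewrite mulKf.
Qed.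

Lemma cdiff_wirtinger p q (A B : 'M[C]_(p, q)) :
  2^-1 *: ((1 *: A + 1^* *: B) - 'i%C *: ('i%C *: A + 'i%C^* *: B)) = A.
Proof. exact: (wirtinger_solve A B sqr_i_mul conjc_i (conjc1 R)).1. Qed.

Lemma cdiff_wirtinger_bar p q (A B : 'M[C]_(p, q)) :
  2^-1 *: ((1 *: A + 1^* *: B) + 'i%C *: ('i%C *: A + 'i%C^* *: B)) = B.
Proof. exact: (wirtinger_solve A B sqr_i_mul conjc_i (conjc1 R)).2. Qed.

Lemma cdiff_d_z (V : lmodType C) p q (f : V -> 'M[C]_(p, q)) x v A B :
  is_cdiff (fun s => f (x + s *: v)) 0 A B -> d_z f x v = A.
Proof.
move=> fd; rewrite /d_z -[RHS](cdiff_wirtinger A B).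
congr (_ *: (_ - _ *: _)); apply: real_deriv_mderive.
  by apply: mderive_ext (fd 1) => t; rewrite add0r mulr1.
by apply: mderive_ext (fd 'i%C) => t; rewrite add0r scalerA.
Qed.

Lemma cdiff_d_zbar (V : lmodType C) p q (f : V -> 'M[C]_(p, q)) x v A B :
  is_cdiff (fun s => f (x + s *: v)) 0 A B -> d_zbar f x v = B.
Proof.
move=> fd; rewrite /d_zbar -[RHS](cdiff_wirtinger_bar A B).
congr (_ *: (_ + _ *: _)); apply: real_deriv_mderive.
  by apply: mderive_ext (fd 1) => t; rewrite add0r mulr1.
by apply: mderive_ext (fd 'i%C) => t; rewrite add0r scalerA.
Qed.

Section Rules.
Variables (p q r : nat).
Implicit Types (f g : C -> 'M[C]_(p, q)).

Lemma cdiff_eq f s A B A' B' : is_cdiff f s A B -> A = A' -> B = B' -> is_cdiff f s A' B'.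
Proof. by move=> ? <- <-. Qed.

Lemma cdiff_ext f g s A B : f =1 g -> is_cdiff f s A B -> is_cdiff g s A B.
Proof. by move=> /funext ->. Qed.

Lemma cdiff_near f g s A B :
  (forall c, \forall t \near (0 : R^o), f (s + t%:C * c) = g (s + t%:C * c)) ->
  is_cdiff f s A B -> is_cdiff g s A B.
Proof. by move=> fg fd c; apply: mderive_near (fg c) (fd c). Qed.

Lemma cdiff_uniq f s A B A' B' :
  is_cdiff f s A B -> is_cdiff f s A' B' -> A = A' /\ B = B'.
Proof.
move=> fd fd'.
have e1 := mderive_uniq (fd 1) (fd' 1).
have e2 := mderive_uniq (fd 'i%C) (fd' 'i%C).
split; first by rewrite -(cdiff_wirtinger A B) e1 e2 cdiff_wirtinger.
by rewrite -(cdiff_wirtinger_bar A B) e1 e2 cdiff_wirtinger_bar.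
Qed.

Lemma cdiff_cst (c : 'M[C]_(p, q)) s : is_cdiff (fun=> c) s 0 0.
Proof.
by move=> d; apply: mderive_eq (mderive_cst _ _) _; rewrite !scaler0 addr0.
Qed.

Lemma cdiffD f g s A B A' B' : is_cdiff f s A B -> is_cdiff g s A' B' ->
  is_cdiff (fun s => f s + g s) s (A + A') (B + B').
Proof.
move=> fd gd c; apply: mderive_eq (mderiveD (fd c) (gd c)) _.
by rewrite !scalerDr addrACA.
Qed.

Lemma cdiffJ f s A B : is_cdiff f s A B ->
  is_cdiff (fun s => conj_mx (f s)) s (conj_mx B) (conj_mx A).
Proof.
move=> fd c; apply: mderive_eq (mderiveJ (fd c)) _.
by rewrite /conj_mx map_mxD !map_mxZ /= conjcK addrC.
Qed.

Lemma cdiffM f (g : C -> 'M[C]_(q, r)) s A B A' B' :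
  is_cdiff f s A B -> is_cdiff g s A' B' ->
  is_cdiff (fun s => f s *m g s) s (A *m g s + f s *m A') (B *m g s + f s *m B').
Proof.
move=> fd gd c; apply: mderive_eq (mderiveM (fd c) (gd c)) _.
rewrite /= mul0r addr0 mulmxDl mulmxDr -!scalemxAl -!scalemxAr.
by rewrite !scalerDr addrACA.
Qed.

Lemma cdiffZ f s A B (a : C) : is_cdiff f s A B ->
  is_cdiff (fun s => a *: f s) s (a *: A) (a *: B).
Proof.
move=> fd c; apply: mderive_eq (mderiveZ (cderive_cst a 0) (fd c)) _.
by rewrite scale0r add0r scalerDr !scalerA [a * c]mulrC [a * _]mulrC.
Qed.

Lemma cdiffN f s A B : is_cdiff f s A B ->
  is_cdiff (fun s => - f s) s (- A) (- B).
Proof.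
move=> fd; have := cdiffZ (-1) fd; rewrite !scaleN1r; apply: cdiff_ext => t.
by rewrite scaleN1r.
Qed.

Lemma cdiff_sum (I : Type) (l : seq I) (P : pred I) (f : I -> C -> 'M[C]_(p, q)) s A B :
  (forall i, P i -> is_cdiff (f i) s (A i) (B i)) ->
  is_cdiff (fun u => \sum_(i <- l | P i) f i u) s
    (\sum_(i <- l | P i) A i) (\sum_(i <- l | P i) B i).
Proof.
move=> fd c; apply: mderive_eq (mderive_sum _ (fun i Pi => fd i Pi c)) _.
by rewrite !scaler_sumr big_split.
Qed.

Lemma cdiff_scale (X : 'M[C]_(p, q)) s : is_cdiff (fun u => u *: X) s X 0.
Proof.
move=> c.
have h : is_cderive (fun t => s + t%:C * c) 0 c.
  apply: cderive_eq (cderiveD (cderive_cst s 0) (cderiveM (cderive_id 0) (cderive_cst c 0))) _.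
  by rewrite mul1r mulr0 addr0 add0r.
apply: mderive_eq (mderiveZ h (mderive_cst X 0)) _.
by rewrite !scaler0.
Qed.

End Rules.

(** Scalar functions are handled as 1 x 1 matrices, so that one calculus serves for both. *)
Lemma cdiff_trace n (f : C -> 'M[C]_n) s A B : is_cdiff f s A B ->
  is_cdiff (fun u => (\tr (f u))%:M : 'M_1) s (\tr A)%:M (\tr B)%:M.
Proof.
move=> fd c i j; rewrite !ord1 !mxE !mulr1n.
apply: (cderive_ext (f := fun t => \tr (f (s + t%:C * c)))) => [t|].
  by rewrite mxE mulr1n.
apply: cderive_eq (cderive_trace (fd c)) _.
by rewrite mxtraceD !mxtraceZ.
Qed.

Lemma cdiff_matrix p q (f : 'I_p -> 'I_q -> C -> 'M[C]_1) s A B :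
  (forall i j, is_cdiff (f i j) s (A i j) (B i j)) ->
  is_cdiff (fun u => \matrix_(i, j) f i j u 0 0) s
    (\matrix_(i, j) A i j 0 0) (\matrix_(i, j) B i j 0 0).
Proof.
move=> fd c i j; rewrite !mxE.
apply: (cderive_ext (f := fun t => f i j (s + t%:C * c) 0 0)) => [t|].
  by rewrite mxE.
by apply: cderive_eq (fd i j c 0 0) _; rewrite !mxE.
Qed.

Lemma cdiff_near_unit n (f : C -> 'M[C]_n) s A B : is_cdiff f s A B -> f s \in unitmx ->
  forall c, \forall t \near (0 : R^o), f (s + t%:C * c) \in unitmx.
Proof.
move=> fd fu c; apply: (mderive_near_unit (fd c)).
by rewrite mul0r addr0.
Qed.

Lemma cdiff_inv n (f : C -> 'M[C]_n) s A B : is_cdiff f s A B -> f s \in unitmx ->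
  is_cdiff (fun u => invmx (f u)) s
    (- (invmx (f s) *m A *m invmx (f s))) (- (invmx (f s) *m B *m invmx (f s))).
Proof.
move=> fd fu c; have e : f (s + 0%:C * c) = f s by rewrite mul0r addr0.
apply: mderive_eq (mderive_inv (fd c) _) _; first by rewrite e.
rewrite e mulmxDr mulmxDl -!scalemxAr -!scalemxAl opprD !scalerN //.
Qed.

(* Open along every real line, which is all that real_deriv depends on.         *)
Definition line_open (U : C -> Prop) : Prop :=
  forall s, U s -> forall c, \forall t \near (0 : R^o), U (s + t%:C * c).

(* fzw is the derivative d/dzbar d/dz of f at 0 only.                           *)
Definition is_jet p q (U : C -> Prop) (f fz fw : C -> 'M[C]_(p, q)) (fzw : 'M[C]_(p, q)) :=
  (forall s, U s -> is_cdiff f s (fz s) (fw s)) /\ exists A, is_cdiff fz 0 A fzw.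

(* Only the complex line spanned by v matters for the curvature in the        *)
(* direction v, and a vanishing first derivative kills the second fundamental  *)
(* term of the Chern curvature.                                               *)
Lemma hol_sect_curv_jet N (H : 'rV[C]_N -> 'M[C]_N) (v : 'rV[C]_N) U Gz Gw Gzw :
  line_open U -> U 0 ->
  is_jet U (fun s => H (s *: v)) Gz Gw Gzw ->
  (forall s, U s -> H (s *: v) \in unitmx) ->
  v *m Gz 0 = 0 ->
  hol_sect_curv H 0 v = - (v *m Gzw *m (conj_mx v)^T) 0 0 /
                         ((v *m H 0 *m (conj_mx v)^T) 0 0) ^+ 2.
Proof.
move=> Uo U0 [Gd [A GzD]] Gu vGz.
set G := fun s => H (s *: v).
have dz s : U s -> d_z H (s *: v) v = Gz s.
  move=> Us; apply: (cdiff_d_z (B := Gw s)) => c.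
  apply: mderive_ext (Gd s Us c) => t.
  by rewrite add0r scalerDl.
have chE s : U s -> chern_form H v (s *: v) = Gz s *m invmx (G s).
  by move=> Us; rewrite /chern_form dz.
have K := cdiffM GzD (cdiff_inv (Gd 0 U0) (Gu 0 U0)).
have zbar : d_zbar (chern_form H v) 0 v =
    Gzw *m invmx (G 0) - Gz 0 *m (invmx (G 0) *m Gw 0 *m invmx (G 0)).
  rewrite -mulmxN; apply: cdiff_d_zbar; apply: cdiff_near K => c.
  near=> t; rewrite add0r -chE //; first by rewrite add0r.
  by rewrite -[X in U X]add0r; near: t; apply: Uo.
rewrite /hol_sect_curv /herm_form /chern_curv zbar.
congr (_ / _).
have -> : H 0 = G 0 by rewrite /G scale0r.
rewrite mulmxBr [v *m (Gz 0 *m _)]mulmxA vGz mul0mx subr0 mulNmx [v *m (_ *m _)]mulmxA.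
by rewrite mulmxKV ?mulNmx ?mxE //; apply: Gu.
Unshelve. all: by end_near. Qed.

End Wirtinger.

(** * Gradings and their variation *)

Section Projections.
Variables (R : realType) (n k : nat).
Local Notation C := R[i].
Implicit Types (P : 'I_k.+1 -> 'M[C]_n) (F : 'I_k.+1 -> 'M[C]_n).

Lemma conj_mxK p q (A : 'M[C]_(p, q)) : conj_mx (conj_mx A) = A.
Proof. by apply/matrixP => i j; rewrite !mxE conjcK. Qed.

Lemma conj_mxM p q r (A : 'M[C]_(p, q)) (B : 'M[C]_(q, r)) :
  conj_mx (A *m B) = conj_mx A *m conj_mx B.
Proof. exact: map_mxM. Qed.

Lemma conj_mxB p q (A B : 'M[C]_(p, q)) : conj_mx (A - B) = conj_mx A - conj_mx B.
Proof. exact: map_mxB. Qed.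

Lemma conj_mxD p q (A B : 'M[C]_(p, q)) : conj_mx (A + B) = conj_mx A + conj_mx B.
Proof. exact: map_mxD. Qed.

Lemma conj_mx1 p : conj_mx (1%:M : 'M[C]_p) = 1%:M.
Proof. exact: map_mx1. Qed.

Lemma conj_mxZ p q (a : C) (A : 'M[C]_(p, q)) : conj_mx (a *: A) = a^* *: conj_mx A.
Proof. exact: map_mxZ. Qed.

Lemma conj_mx_sum p q (I : Type) (r : seq I) (S : pred I) (A : I -> 'M[C]_(p, q)) :
  conj_mx (\sum_(i <- r | S i) A i) = \sum_(i <- r | S i) conj_mx (A i).
Proof. exact: (raddf_sum (@map_mx _ _ (@conjc R) p q)). Qed.

(** A Hodge decomposition encoded by idempotents instead of subspaces: unlike a matrix spanning a
    subspace, the idempotent is unique and can be differentiated. *)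
Definition hodge_projs P : Prop :=
  [/\ forall p q, P p *m P q = if p == q then P p else 0, \sum_p P p = 1%:M
    & forall p, conj_mx (P p) = P (rev_ord p)].

Definition filt_proj P (p : nat) : 'M[C]_n := \sum_(r < k.+1 | (p <= r)%N) P r.

Lemma filt_proj0 P : filt_proj P 0 = \sum_p P p.
Proof. by apply: eq_bigl. Qed.

Lemma filt_proj_max P : filt_proj P k.+1 = 0.
Proof. by apply: big1 => r; rewrite leqNgt ltn_ord. Qed.

Lemma filt_projS P (p : 'I_k.+1) : filt_proj P p = P p + filt_proj P p.+1.
Proof.
rewrite /filt_proj (bigD1 p) //=; congr (_ + _); apply: eq_bigl => r.
by rewrite ltn_neqAle eq_sym -(inj_eq val_inj) andbC.
Qed.

Lemma mul_proj_filt P r q : hodge_projs P ->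
  P r *m filt_proj P q = if (q <= r)%N then P r else 0.
Proof.
move=> [PP _ _]; rewrite mulmx_sumr; case: ifP => qr.
  rewrite (bigD1 r) //= PP eqxx big1 ?addr0 // => i /andP[_ ir].
  by rewrite PP eq_sym (negPf ir).
apply: big1 => i qi; rewrite PP; case: eqP => // ri.
by rewrite ri qi in qr.
Qed.

Lemma filt_projM P p q : hodge_projs P ->
  filt_proj P p *m filt_proj P q = filt_proj P (maxn p q).
Proof.
move=> HP; rewrite {1}/filt_proj mulmx_suml /filt_proj [RHS]big_mkcond /= big_mkcond.
apply: eq_bigr => r _; rewrite geq_max; case: ifP => //= pr.
exact: mul_proj_filt.
Qed.

(** Conjugation reverses the indices, so it carries F^p to the sum of the pieces of index at most k
    - p, the complement of F^(k+1-p) in the grading. *)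
Lemma conj_filt_proj P p : hodge_projs P -> (p <= k.+1)%N ->
  conj_mx (filt_proj P p) = 1%:M - filt_proj P (k.+1 - p).
Proof.
move=> [_ P1 PJ] pk; rewrite conj_mx_sum -P1.
rewrite [X in _ = X - _](bigID (fun r : 'I_k.+1 => (k.+1 - p <= r)%N)) /=.
rewrite addrC addrK (reindex_inj rev_ord_inj) /=.
under eq_bigr do rewrite PJ rev_ordK.
apply: eq_bigl => r; have := ltn_ord r; lia.
Qed.

(** Differences of consecutive members of a nested family of idempotents are orthogonal idempotents,
    and they telescope to 1. Along the curve the grading is known only through such a family. *)
Lemma hodge_projs_of_filt (Pi : nat -> 'M[C]_n) :
  Pi 0%N = 1%:M -> Pi k.+1 = 0 ->
  (forall p q, (p <= q <= k.+1)%N -> Pi p *m Pi q = Pi q /\ Pi q *m Pi p = Pi q) ->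
  (forall p, (p <= k.+1)%N -> conj_mx (Pi p) = 1%:M - Pi (k.+1 - p)%N) ->
  hodge_projs (fun p : 'I_k.+1 => Pi p - Pi p.+1).
Proof.
move=> P0 Pk PP PJ; split=> [p q||p].
- have pk := ltn_ord p; have qk := ltn_ord q.
  rewrite mulmxBl !mulmxBr.
  case: (ltngtP p q) => [pq|qp|/val_inj ->]; last 1 first.
  + have [-> _] := PP q q ltac:(lia); have [-> ->] := PP q q.+1 ltac:(lia).
    have [-> _] := PP q.+1 q.+1 ltac:(lia).
    by rewrite eqxx subrr subr0.
  + have [-> _] := PP p q ltac:(lia); have [-> _] := PP p q.+1 ltac:(lia).
    have [-> _] := PP p.+1 q ltac:(lia); have [-> _] := PP p.+1 q.+1 ltac:(lia).
    by rewrite -(inj_eq val_inj) ltn_eqF //= subrr.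
  have [_ ->] := PP q p ltac:(lia); have [_ ->] := PP q.+1 p ltac:(lia).
  have [_ ->] := PP q p.+1 ltac:(lia); have [_ ->] := PP q.+1 p.+1 ltac:(lia).
  by rewrite -(inj_eq val_inj) gtn_eqF //= subrr subrr subr0.
- rewrite -(big_mkord xpredT (fun p => Pi p - Pi p.+1)).
  transitivity (- Pi k.+1 - - Pi 0%N); last by rewrite Pk P0 oppr0 add0r opprK.
  rewrite -(telescope_sumr (fun i => - Pi i) (leq0n k.+1)).
  by apply: eq_bigr => i _; rewrite opprK addrC.
- have pk := ltn_ord p.
  rewrite conj_mxB (PJ p (ltnW pk)) (PJ p.+1 pk) opprB addrC addrA subrK.
  by congr (Pi _ - Pi _); rewrite /=; lia.
Qed.

Lemma projs_eqmx_hodge_proj P F :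
  hodge_projs P -> (forall p, (F p :=: P p)%MS) -> forall p, hodge_proj F p = P p.
Proof.
move=> [PP P1 _] FP p; apply: proj_mx_uniq.
- rewrite -P1 (bigD1 p) //= addmx_sub_adds //; first by rewrite FP.
  by rewrite summx_sub // => q qp; apply: (sumsmx_sup q) => //; rewrite FP.
- apply/eqP; rewrite -submx0; apply/rV_subP => v; rewrite sub_capmx => /andP[v1 v2].
  have /submxP[w vw] : (v <= P p)%MS by rewrite -FP.
  have v3 : v *m P p = v by rewrite vw -mulmxA PP eqxx.
  suff v4 : v *m P p = 0 by rewrite -v3 v4 sub0mx.
  have /sub_sumsmxP[u ->] := v2.
  rewrite mulmx_suml big1 // => q qp.
  have /submxP[D ->] : (F q <= P q)%MS by rewrite FP.
  by rewrite -!mulmxA PP (negPf qp) !mulmx0.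
- have /submxP[D ->] : (F p <= P p)%MS by rewrite FP.
  by rewrite -mulmxA PP eqxx.
- apply/eqP; rewrite -submx0 sumsmxMr.
  apply/sumsmx_subP => q qp; have /submxP[D ->] : (F q <= P q)%MS by rewrite FP.
  by rewrite -mulmxA PP (negPf qp) mulmx0.
Qed.

Lemma hodge_proj_projs F : hodge_decomposition F -> hodge_projs (hodge_proj F).
Proof.
move=> [F1 /mxdirect_sumsP Fd FJ].
pose S p := (\sum_(q | q != p) F q)%MS.
have SF p : (F p :&: S p = 0)%MS by exact: Fd.
have PF p : F p *m hodge_proj F p = F p by exact: (proj_mx_id (SF p) (submx_refl _)).
have P0 p q : q != p -> F q *m hodge_proj F p = 0.
  by move=> qp; apply: (proj_mx_0 (SF p)); apply: (sumsmx_sup q).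
have sub p : (hodge_proj F p <= F p)%MS.
  by rewrite -[X in (X <= _)%MS]mul1mx proj_mx_sub.
have ext (A B : 'M[C]_n) : (forall q, F q *m A = F q *m B) -> A = B.
  move=> AB; rewrite -[A]mul1mx -[B]mul1mx.
  have /sub_sumsmxP[u ->] : (1%:M <= \sum_q F q)%MS by rewrite F1.
  by rewrite !mulmx_suml; apply: eq_bigr => q _; rewrite -!mulmxA AB.
have PP p q : hodge_proj F p *m hodge_proj F q = if p == q then hodge_proj F p else 0.
  apply: ext => r; rewrite mulmxA.
  have [->|rp] := eqVneq r p; last by rewrite P0 // mul0mx; case: ifP; rewrite ?P0 ?mulmx0.
  by rewrite PF; case: eqVneq => [->|pq]; rewrite ?PF ?P0 // mulmx0.
split=> // [|p].
  apply: ext => q; rewrite mulmx1 mulmx_sumr (bigD1 q) //= PF big1 ?addr0 // => p pq.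
  by rewrite P0 // eq_sym.
apply: ext => r.
have /submxP[D FrE] : (F r <= conj_mx (F (rev_ord r)))%MS by rewrite FJ rev_ordK.
rewrite [in LHS]FrE -mulmxA -conj_mxM.
have [rp|rp] := eqVneq (rev_ord r) p.
  by rewrite rp PF -rp -FrE rev_ordK PF.
rewrite !P0 //; first by rewrite /conj_mx map_mx0 mulmx0.
by apply: contraNneq rp => ->; rewrite rev_ordK.
Qed.

Lemma hodge_proj_eqmx F p : hodge_decomposition F -> (F p :=: hodge_proj F p)%MS.
Proof.
move=> [F1 /mxdirect_sumsP Fd FJ]; apply/eqmxP/andP; split.
  by rewrite -[X in (X <= _)%MS](proj_mx_id (Fd p isT) (submx_refl _)) submxMl.
by rewrite -[X in (X <= _)%MS]mul1mx proj_mx_sub.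
Qed.

Lemma hodge_filt_eqmx P F p : hodge_projs P -> (forall p, (F p :=: P p)%MS) ->
  (hodge_filt F p :=: filt_proj P p)%MS.
Proof.
move=> HP FP; have [PP _ _] := HP; apply/eqmxP/andP; split.
  apply/sumsmx_subP => r pr; rewrite FP.
  by rewrite -[X in (X <= _)%MS](_ : P r *m filt_proj P p = _) ?submxMl // mul_proj_filt // pr.
by apply: summx_sub => r pr; apply: (sumsmx_sup r) => //; rewrite FP.
Qed.

(** The truncation of [X] and [Y] to m^- disappears into the condition s < r: inside the trace, the
    block of [X] from [r] to [s] selects the block of [conj_mx Y] from [s] to [r], which is the
    conjugate of a block of [Y] that the truncation keeps. *)
Lemma hodge_metricE P F X Y :
  hodge_projs P -> (forall p, hodge_proj F p = P p) ->
  hodge_metric F X Y =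
    - \sum_(r < k.+1) \sum_(s < k.+1 | (s < r)%N)
        (-1) ^+ (r + s)%N * \tr (P r *m X *m P s *m conj_mx Y).
Proof.
move=> HP FP; have [PP P1 PJ] := HP.
have mE Z : mminus_part F Z = \sum_(r < k.+1) \sum_(s < k.+1 | (s < r)%N) (P r *m Z *m P s).
  by apply: eq_bigr => r _; apply: eq_bigr => s _; rewrite /hodge_block !FP.
have PmP Z r s : P r *m mminus_part F Z *m P s = if (s < r)%N then P r *m Z *m P s else 0.
  rewrite mE mulmx_sumr mulmx_suml (bigD1 r) //= [X in _ + X]big1 ?addr0; last first.
    move=> i ir; rewrite mulmx_sumr mulmx_suml big1 // => j _.
    by rewrite !mulmxA PP eq_sym (negPf ir) !mul0mx.
  rewrite mulmx_sumr mulmx_suml; case: ifP => sr.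
    rewrite (bigD1 s) //= big1 ?addr0; last first.
      by move=> i /andP[_ is']; rewrite -!mulmxA PP (negPf is') !mulmx0.
    by rewrite !mulmxA PP eqxx -mulmxA PP eqxx.
  apply: big1 => i ir; rewrite -!mulmxA PP; case: eqP => [ies|]; last by rewrite !mulmx0.
  by rewrite ies sr in ir.
have cE : cartan_inv F (mminus_part F Y) =
    \sum_(r < k.+1) \sum_(s < k.+1 | (s < r)%N)
      (-1) ^+ (r + s)%N *: (P s *m conj_mx Y *m P r).
  rewrite /cartan_inv.
  transitivity (\sum_(r < k.+1) \sum_(s < k.+1 | (s < r)%N)
      (-1) ^+ (r + s)%N *: (P (rev_ord r) *m conj_mx Y *m P (rev_ord s))).
    apply: eq_bigr => r _; rewrite [RHS]big_mkcond; apply: eq_bigr => s _.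
    rewrite /hodge_block !FP PmP; case: ifP => _; last by rewrite /conj_mx map_mx0 scaler0.
    by rewrite !conj_mxM !PJ.
  (* Exchanging the two indices undoes the reversal of their order by [rev_ord]; the sign survives
     because the reversed indices add up to 2k minus the old sum. *)
  rewrite (exchange_big_dep predT) //= (reindex_inj rev_ord_inj); apply: eq_bigr => r _ /=.
  rewrite (reindex_inj rev_ord_inj) /=; apply: eq_big => [s|s _].
    have := ltn_ord r; have := ltn_ord s; lia.
  rewrite !rev_ordK; congr (_ *: _).
  rewrite -signr_odd -[RHS]signr_odd; congr (_ ^+ nat_of_bool _).
  have := ltn_ord r; have := ltn_ord s; lia.
rewrite /hodge_metric cE; congr (- _); rewrite mulmx_sumr (raddf_sum (@mxtrace C n)); apply: eq_bigr => r _.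
rewrite mulmx_sumr (raddf_sum (@mxtrace C n)); apply: eq_bigr => s sr.
rewrite /= -scalemxAr mxtraceZ; congr (_ * _).
rewrite !mulmxA mxtrace_mulC !mulmxA.
by have := PmP X r s; rewrite sr => <-.
Qed.

End Projections.

(** * The truncated exponential and its differential *)

Section Exponential.
Variables (R : realType) (n : nat).
Local Notation C := R[i].
Implicit Types (X Y Z : 'M[C]_n).

Lemma exprmxZ X s j : (s *: X) ^+ j = s ^+ j *: X ^+ j.
Proof.
elim: j => [|j IH]; first by rewrite !expr0 scale1r.
by rewrite !exprS IH -[LHS]/(s *: X *m (s ^+ j *: X ^+ j)) -scalemxAl -scalemxAr scalerA.
Qed.

Lemma cdiff_expn X j s :
  is_cdiff (fun u => (u *: X) ^+ j) s (j%:R *: (X *m (s *: X) ^+ j.-1)) 0.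
Proof.
elim: j => [|j IH].
  by rewrite scale0r; apply: cdiff_ext (cdiff_cst 1 s) => u; rewrite expr0.
apply: (cdiff_ext (f := fun u => (u *: X) *m (u *: X) ^+ j)) => [u|].
  by rewrite exprS.
apply: cdiff_eq (cdiffM (cdiff_scale X s) IH) _ _; last by rewrite mul0mx mulmx0 addr0.
rewrite /= -scalemxAr; case: j {IH} => [|j] /=; first by rewrite !scale0r addr0 scale1r.
have -> : s *: X *m (X *m (s *: X) ^+ j) = X *m (s *: X) ^+ j.+1.
  have c : s *: X *m X = X *m (s *: X) by rewrite -scalemxAl -scalemxAr.
  by rewrite mulmxA c -mulmxA exprS.
by rewrite -[in RHS]natr1 scalerDl scale1r addrC.
Qed.

(** The differential of the polynomial map [exp_nilp] at [X] in the direction [Y], by the Leibniz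
    rule for factors that need not commute. *)
Definition dexp_nilp X Y : 'M[C]_n :=
  \sum_(j < n) (j`!%:R)^-1 *: \sum_(a < j) X ^+ a *m Y *m X ^+ (j.-1 - a).

Lemma cdiff_expnD X Y j :
  is_cdiff (fun u => (X + u *: Y) ^+ j) 0 (\sum_(a < j) X ^+ a *m Y *m X ^+ (j.-1 - a)) 0.
Proof.
elim: j => [|j IH].
  by rewrite big_ord0; apply: cdiff_ext (cdiff_cst 1 0) => u; rewrite expr0.
apply: (cdiff_ext (f := fun u => (X + u *: Y) *m (X + u *: Y) ^+ j)) => [u|].
  by rewrite exprS.
apply: cdiff_eq (cdiffM (cdiffD (cdiff_cst X 0) (cdiff_scale Y 0)) IH) _ _.
  rewrite /= add0r scale0r addr0 big_ord_recl subn0 expr0 mul1mx mulmx_sumr.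
  congr (_ + _); apply: eq_bigr => a _; rewrite !mulmxA lift0 exprS.
  by congr (_ *m _ *m (_ ^+ _)); lia.
by rewrite addr0 mul0mx mulmx0 addr0.
Qed.

Lemma d_z_exp_nilp X Y : d_z (@exp_nilp R n) X Y = dexp_nilp X Y.
Proof.
apply: (cdiff_d_z (B := 0)).
have H := cdiff_sum (index_enum 'I_n) (P := xpredT)
  (fun j _ => cdiffZ (j`!%:R)^-1 (cdiff_expnD X Y j)).
apply: cdiff_eq H _ _ => //.
by under eq_bigr do rewrite scaler0; rewrite big1.
Qed.

Lemma dexp_nilp_linear X (I : Type) (r : seq I) (c : I -> C) (Y : I -> 'M[C]_n) :
  dexp_nilp X (\sum_(i <- r) c i *: Y i) = \sum_(i <- r) c i *: dexp_nilp X (Y i).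
Proof.
rewrite /dexp_nilp; under [RHS]eq_bigr do rewrite scaler_sumr.
rewrite [RHS]exchange_big; apply: eq_bigr => j _ /=.
under [RHS]eq_bigr do rewrite scalerA mulrC -scalerA.
rewrite -scaler_sumr; congr (_ *: _).
under [RHS]eq_bigr do rewrite scaler_sumr.
rewrite exchange_big; apply: eq_bigr => a _ /=.
rewrite mulmx_sumr mulmx_suml; apply: eq_bigr => i _.
by rewrite -scalemxAr -scalemxAl.
Qed.

Lemma dexp_nilp_comm X Y : X *m Y = Y *m X ->
  dexp_nilp X Y = \sum_(j < n) (j`!%:R)^-1 *: (j%:R *: (Y *m X ^+ j.-1)).
Proof.
move=> XY; apply: eq_bigr => j _; congr (_ *: _).
rewrite (eq_bigr (fun=> Y *m X ^+ j.-1)) => [|a _]; first by rewrite sumr_const card_ord scaler_nat.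
have -> : X ^+ a *m Y = Y *m X ^+ a by apply: esym; apply: commrX; apply: esym.
by rewrite -mulmxA -[_ *m X ^+ _]exprD; congr (_ *m _ ^+ _); have := ltn_ord a; lia.
Qed.

(** Differentiating the truncated series loses its top term; nilpotency makes the missing term
    vanish. *)
Lemma exp_nilp_shift (X : 'M[C]_n) : X ^+ n = 0 -> 
  \sum_(j < n) (j`!%:R)^-1 *: (j%:R *: (X ^+ j)) = X *m exp_nilp X.
Proof.
move=> Xn; rewrite /exp_nilp mulmx_sumr.
have e m : X ^+ m = 0 ->
    \sum_(j < m) (j`!%:R)^-1 *: (j%:R *: X ^+ j) = \sum_(j < m) X *m ((j`!%:R)^-1 *: X ^+ j).
  case: m => [|m] Xm; first by rewrite !big_ord0.
  rewrite big_ord_recl big_ord_recr /= scale0r scaler0 add0r -scalemxAr.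
  rewrite -[X *m _]exprS Xm scaler0 addr0; apply: eq_bigr => j _.
  rewrite -scalemxAr -[X *m _]exprS scalerA; congr (_ *: _).
  rewrite /bump leq0n add1n factS natrM.
  by rewrite invfM mulrAC mulVf ?mul1r // pnatr_eq0.
exact: e.
Qed.

Lemma dexp_nilp_self X s : X ^+ n = 0 -> dexp_nilp (s *: X) X = X *m exp_nilp (s *: X).
Proof.
move=> Xn; rewrite dexp_nilp_comm -?scalemxAl -?scalemxAr //.
(* The general argument cancels a factor [s]. At s = 0 only the linear term of the series
   contributes; it is absent when n <= 1, but [X] is then zero. *)
have [->|s0] := eqVneq s 0.
  rewrite scale0r /exp_nilp; case: (n) X Xn => [|m] X Xn; first by rewrite !big_ord0 mulmx0.
  rewrite !big_ord_recl /= scale0r scaler0 add0r fact0 invr1 expr0 scale1r.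
  rewrite [X in _ = _ *m (_ + X)]big1 ?addr0 => [|i _]; last by rewrite exprS mul0r scaler0.
  case: m X Xn => [|m] X Xn; first by rewrite big_ord0 mulmx1 -[X]expr1 Xn.
  rewrite big_ord_recl /= big1 ?addr0 => [|i _].
    by rewrite /bump leq0n /= expr0 !scale1r invr1 scale1r.
  by rewrite exprS mul0r mulmx0 !scaler0.
have sX : (s *: X) ^+ n = 0 by rewrite exprmxZ Xn scaler0.
apply: (scalerI s0); rewrite scalemxAl -exp_nilp_shift // scaler_sumr.
apply: eq_bigr => j _; rewrite scalerA mulrC -scalerA; congr (_ *: _).
case: (nat_of_ord j) => [|i]; first by rewrite !scale0r scaler0.
by rewrite scalerA mulrC -scalerA /= scalemxAl -[_ *m _]exprS.
Qed.

Lemma cdiff_exp_nilp X s : X ^+ n = 0 ->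
  is_cdiff (fun u => exp_nilp (u *: X)) s (exp_nilp (s *: X) *m X) 0.
Proof.
move=> Xn.
have H := cdiff_sum (index_enum 'I_n) (P := xpredT)
  (fun j _ => cdiffZ (j`!%:R)^-1 (cdiff_expn X j s)).
apply: cdiff_eq H _ _.
  have -> : exp_nilp (s *: X) *m X = X *m exp_nilp (s *: X).
    rewrite /exp_nilp mulmx_suml mulmx_sumr; apply: eq_bigr => j _.
    rewrite -scalemxAl -scalemxAr; congr (_ *: _).
    have c : GRing.comm X (s *: X).
      by rewrite /GRing.comm -[LHS]/(X *m (s *: X)) -[RHS]/(s *: X *m X) -scalemxAl -scalemxAr.
    exact: esym (commrX _ c).
  by rewrite -dexp_nilp_self // dexp_nilp_comm // -scalemxAl -scalemxAr.
by under eq_bigr do rewrite scaler0; rewrite big1.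
Qed.

End Exponential.

(** In the product of the two truncated series the terms of degree m < n add up to (1 - 1)^m X^m /
    m! by the binomial theorem, and those of degree at least n vanish. *)
Lemma exp_nilpN (R : realType) n (X : 'M[R[i]]_n) :
  X ^+ n = 0 -> exp_nilp (- X) *m exp_nilp X = 1%:M.
Proof.
case: n X => [|n'] X Xn; first by apply/matrixP => -[].
set m0 := n'.+1 in X Xn *.
have Xge m : (m0 <= m)%N -> X ^+ m = 0.
  by move=> nm; rewrite -(subnK nm) exprD Xn mulr0.
pose F i j : 'M[R[i]]_m0 := ((-1) ^+ i / i`!%:R / j`!%:R) *: X ^+ (i + j).
have -> : exp_nilp (- X) *m exp_nilp X = \sum_(0 <= i < m0) \sum_(0 <= j < m0) F i j.
  rewrite /exp_nilp big_mkord mulmx_suml; apply: eq_bigr => i _.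
  rewrite mulmx_sumr big_mkord; apply: eq_bigr => j _.
  rewrite -scalemxAl -scalemxAr -scaleN1r exprmxZ -scalemxAl -[_ *m _]exprD /F.
  by rewrite !scalerA; congr (_ *: _); ring.
have -> : \sum_(0 <= i < m0) \sum_(0 <= j < m0) F i j
    = \sum_(0 <= m < m0) \sum_(0 <= i < m0 | (i <= m)%N) F i (m - i)%N.
  rewrite [RHS](exchange_big_dep_nat xpredT) //=; apply: eq_big_nat => i /andP[_ ltin].
  rewrite (big_cat_nat (leq0n (m0 - i)) (leq_subr i m0)) /= [X in _ + X]big_nat [X in _ + X]big1 ?addr0; last first.
    by move=> j /andP[ij _]; rewrite /F Xge ?scaler0 // -leq_subLR.
  rewrite [RHS](big_cat_nat (leq0n i) (ltnW ltin)) /=.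
  rewrite [X in _ = X + _]big_nat_cond [X in _ = X + _]big1 ?add0r; last first.
    by move=> m /andP[/andP[_ mi]]; rewrite leqNgt mi.
  rewrite -[X in index_iota X m0]add0n big_addn; apply: eq_big => [j|j _].
    by rewrite leq_addl.
  by rewrite addnK.
rewrite /m0.
rewrite big_nat_recl // big_mkcond big_nat_recl //= big1 ?addr0; last first.
  by move=> i _.
rewrite /F subnn fact0 !expr0 !invr1 !mulr1 scale1r big_nat big1 ?addr0 // => m /andP[_ mn].
transitivity (((m.+1)`!%:R^-1 * (1 - 1) ^+ m.+1) *: X ^+ m.+1); last first.
  by rewrite subrr exprS mul0r mulr0 scale0r.
rewrite exprBn mulr_sumr scaler_suml.
rewrite (big_cat_nat (leq0n m.+2) (mn : (m.+2 <= n'.+1)%N)) /= [X in _ + X]big_nat_cond [X in _ + X]big1 ?addr0; last first.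
  by move=> i /andP[/andP[mi _]]; rewrite leqNgt mi.
rewrite big_nat_cond (eq_bigl (fun i => (0 <= i < m.+2)%N && true)); last first.
  by move=> i; rewrite /= ltnS andbb andbT.
rewrite -big_nat_cond big_mkord; apply: eq_bigr => i _; have im : (i <= m.+1)%N by rewrite -ltnS.
rewrite subnKC //; congr (_ *: _); rewrite !expr1n !mulr1.
have fE : (m.+1)`!%:R = ('C(m.+1, i))%:R * i`!%:R * (m.+1 - i)`!%:R :> R[i].
  by rewrite -(bin_fact im) mulnA !natrM.
have nz j : (j`!%:R : R[i]) != 0 by rewrite pnatr_eq0 -lt0n fact_gt0.
have nzb : (('C(m.+1, i))%:R : R[i]) != 0 by rewrite pnatr_eq0 -lt0n bin_gt0.
rewrite fE -[_ *+ 'C(_, _)]mulr_natr; field.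
by rewrite nzb !nz.
Qed.

(** * Second-order jets along a complex line *)

Section Jets.
Variable R : realType.
Local Notation C := R[i].
Variable U : C -> Prop.
Hypothesis U0 : U 0.

Lemma jet_cst p q (A : 'M[C]_(p, q)) : is_jet U (fun=> A) (fun=> 0) (fun=> 0) 0.
Proof. by split=> [s _|]; [|exists 0]; apply: cdiff_cst. Qed.

Lemma jetD p q (f fz fw g gz gw : C -> 'M[C]_(p, q)) fzw gzw :
  is_jet U f fz fw fzw -> is_jet U g gz gw gzw ->
  is_jet U (fun s => f s + g s) (fun s => fz s + gz s) (fun s => fw s + gw s) (fzw + gzw).
Proof.
move=> [fd [A fzd]] [gd [B gzd]]; split=> [s Us|]; first exact: cdiffD (fd s Us) (gd s Us).
by exists (A + B); apply: cdiffD.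
Qed.

Lemma jetZ p q (f fz fw : C -> 'M[C]_(p, q)) fzw a :
  is_jet U f fz fw fzw ->
  is_jet U (fun s => a *: f s) (fun s => a *: fz s) (fun s => a *: fw s) (a *: fzw).
Proof.
move=> [fd [A fzd]]; split=> [s Us|]; first exact: cdiffZ (fd s Us).
by exists (a *: A); apply: cdiffZ.
Qed.

Lemma jetM p q r (f fz fw : C -> 'M[C]_(p, q)) (g gz gw : C -> 'M[C]_(q, r)) fzw gzw :
  is_jet U f fz fw fzw -> is_jet U g gz gw gzw ->
  is_jet U (fun s => f s *m g s) (fun s => fz s *m g s + f s *m gz s)
    (fun s => fw s *m g s + f s *m gw s)
    (fzw *m g 0 + fz 0 *m gw 0 + (fw 0 *m gz 0 + f 0 *m gzw)).
Proof.
move=> [fd [A fzd]] [gd [B gzd]]; split=> [s Us|]; first exact: cdiffM (fd s Us) (gd s Us).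
by eexists; apply: cdiffD; [apply: cdiffM fzd (gd 0 U0)|apply: cdiffM (fd 0 U0) gzd].
Qed.

Lemma jet_sum p q (I : Type) (l : seq I) (S : pred I) (f fz fw : I -> C -> 'M[C]_(p, q)) fzw :
  (forall i, S i -> is_jet U (f i) (fz i) (fw i) (fzw i)) ->
  is_jet U (fun s => \sum_(i <- l | S i) f i s) (fun s => \sum_(i <- l | S i) fz i s)
    (fun s => \sum_(i <- l | S i) fw i s) (\sum_(i <- l | S i) fzw i).
Proof.
move=> fj; elim: l => [|i l IH].
  rewrite big_nil; have := jet_cst (0 : 'M[C]_(p, q)).
  by congr is_jet; apply/funext => s; rewrite big_nil.
case: (boolP (S i)) => Si; last first.
  by rewrite big_cons (negPf Si); move: IH; congr is_jet; apply/funext => s;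
    rewrite big_cons (negPf Si).
rewrite big_cons Si; have := jetD (fj i Si) IH.
by congr is_jet; apply/funext => s; rewrite big_cons Si.
Qed.

Lemma jet_trace n (f fz fw : C -> 'M[C]_n) fzw :
  is_jet U f fz fw fzw ->
  is_jet U (fun s => (\tr (f s))%:M : 'M_1) (fun s => (\tr (fz s))%:M)
    (fun s => (\tr (fw s))%:M) (\tr fzw)%:M.
Proof.
move=> [fd [A fzd]]; split=> [s Us|]; first exact: cdiff_trace (fd s Us).
by eexists; apply: cdiff_trace fzd.
Qed.

Lemma jet_matrix p q (f fz fw : 'I_p -> 'I_q -> C -> 'M[C]_1) fzw :
  (forall i j, is_jet U (f i j) (fz i j) (fw i j) (fzw i j)) ->
  is_jet U (fun s => \matrix_(i, j) f i j s 0 0) (fun s => \matrix_(i, j) fz i j s 0 0)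
    (fun s => \matrix_(i, j) fw i j s 0 0) (\matrix_(i, j) fzw i j 0 0).
Proof.
move=> fj; split=> [s Us|]; first by apply: cdiff_matrix => i j; have [fd _] := fj i j; apply: fd.
have [A AP] : {A : 'I_p * 'I_q -> 'M_1 & forall ij, is_cdiff (fz ij.1 ij.2) 0 (A ij) (fzw ij.1 ij.2)}.
  have step (ij : 'I_p * 'I_q) : exists A, is_cdiff (fz ij.1 ij.2) 0 A (fzw ij.1 ij.2).
    by have [_] := fj ij.1 ij.2.
  have [A AP] := boolp.choice step; by exists A.
by eexists; apply: (cdiff_matrix (A := fun i j => A (i, j))) => i j; apply: (AP (i, j)).
Qed.

Lemma jet_ext p q (f f' fz fz' fw fw' : C -> 'M[C]_(p, q)) fzw fzw' :
  is_jet U f fz fw fzw -> f =1 f' -> fz =1 fz' -> fw =1 fw' -> fzw = fzw' ->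
  is_jet U f' fz' fw' fzw'.
Proof. by move=> ? /funext <- /funext <- /funext <- <-. Qed.

(** The z-derivatives agree on all of [U] and can therefore be differentiated again at 0. This is
    how a second derivative that is only known to exist is identified with an explicit one. *)
Lemma jet_uniq p q (f f' fz fz' fw fw' : C -> 'M[C]_(p, q)) fzw fzw' :
  line_open U -> is_jet U f fz fw fzw -> is_jet U f' fz' fw' fzw' ->
  (forall s, U s -> f s = f' s) -> fz 0 = fz' 0 /\ fzw = fzw'.
Proof.
move=> Uo [fd [A fzd]] [fd' [A' fzd']] ff'.
have zE s : U s -> fz s = fz' s.
  move=> Us; suff [] : fz s = fz' s /\ fw s = fw' s by [].
  apply: cdiff_uniq (fd' s Us); apply: cdiff_near (fd s Us) => c.
  by apply: filterS (Uo s Us c) => t; apply: ff'.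
split; first exact: zE.
suff [] : A = A' /\ fzw = fzw' by [].
apply: cdiff_uniq fzd'; apply: cdiff_near fzd => c.
by apply: filterS (Uo 0 U0 c) => t; apply: zE.
Qed.

End Jets.

Section HoloJets.
Variable R : realType.
Local Notation C := R[i].

(** Holomorphy in the strength that jets require: a complex derivative everywhere and a second one
    at 0. *)
Definition is_holo p q (f : C -> 'M[C]_(p, q)) : Prop :=
  exists f', (forall s, is_cdiff f s (f' s) 0) /\ exists f'', is_cdiff f' 0 f'' 0.

Lemma holo_cst p q (A : 'M[C]_(p, q)) : is_holo (fun=> A).
Proof. by exists (fun=> 0); split=> [s|]; [|exists 0]; apply: cdiff_cst. Qed.

Lemma holo_scale p q (A : 'M[C]_(p, q)) : is_holo (fun s => s *: A).
Proof.
by exists (fun=> A); split=> [s|]; [apply: cdiff_scale|exists 0; apply: cdiff_cst].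
Qed.

Lemma holoM p q r (f : C -> 'M[C]_(p, q)) (g : C -> 'M[C]_(q, r)) :
  is_holo f -> is_holo g -> is_holo (fun s => f s *m g s).
Proof.
move=> [f' [fd [f'' fd']]] [g' [gd [g'' gd']]].
exists (fun s => f' s *m g s + f s *m g' s); split=> [s|].
  by apply: cdiff_eq (cdiffM (fd s) (gd s)) _ _; rewrite // mul0mx mulmx0 addr0.
eexists; apply: cdiff_eq (cdiffD (cdiffM fd' (gd 0)) (cdiffM (fd 0) gd')) erefl _.
by rewrite !mul0mx !mulmx0 !addr0.
Qed.

Lemma holo_sumZ p q (I : Type) (l : seq I) (c : I -> C) (f : I -> C -> 'M[C]_(p, q)) :
  (forall i, is_holo (f i)) -> is_holo (fun s => \sum_(i <- l) c i *: f i s).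
Proof.
move=> fh.
have [f' f'P] := boolp.choice fh.
have [f'' f''P] := boolp.choice (fun i => (f'P i).2).
exists (fun s => \sum_(i <- l) c i *: f' i s); split=> [s|].
  have H := cdiff_sum l (P := xpredT) (fun i _ => cdiffZ (c i) ((f'P i).1 s)).
  by apply: cdiff_eq H erefl _; rewrite big1 // => i _; rewrite scaler0.
have H := cdiff_sum l (P := xpredT) (fun i _ => cdiffZ (c i) (f''P i)).
by eexists; apply: cdiff_eq H erefl _; rewrite big1 // => i _; rewrite scaler0.
Qed.

Lemma holo_ext p q (f g : C -> 'M[C]_(p, q)) : f =1 g -> is_holo f -> is_holo g.
Proof. by move=> /funext ->. Qed.

Lemma holo_exp n (f : C -> 'M[C]_n) j : is_holo f -> is_holo (fun s => f s ^+ j).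
Proof.
move=> fh; elim: j => [|j IH].
  by apply: holo_ext (holo_cst 1) => s; rewrite expr0.
by apply: holo_ext (holoM fh IH) => s; rewrite exprS.
Qed.

Lemma holo_jet U p q (f : C -> 'M[C]_(p, q)) : is_holo f ->
  exists fz fw fzw, is_jet U f fz fw fzw.
Proof.
move=> [f' [fd [f'' fd']]]; exists f', (fun=> 0), 0; split=> [s _|]; first exact: fd.
by exists f''.
Qed.

Lemma holo_conj_jet U p q (f : C -> 'M[C]_(p, q)) : is_holo f ->
  exists fw, is_jet U (fun s => conj_mx (f s)) (fun=> 0) fw 0.
Proof.
move=> [f' [fd [f'' fd']]]; exists (fun s => conj_mx (f' s)); split=> [s _|].
  by apply: cdiff_eq (cdiffJ (fd s)) _ _; rewrite // /conj_mx map_mx0.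
by exists 0; apply: cdiff_cst.
Qed.

Lemma holo_dexp n (X Y : 'M[C]_n) : is_holo (fun s => dexp_nilp (s *: X) Y).
Proof.
apply: holo_sumZ => j.
apply: (holo_ext (f := fun s => \sum_(a < j) 1 *: ((s *: X) ^+ a *m Y *m (s *: X) ^+ (j.-1 - a)))).
  by move=> s; apply: eq_bigr => a _; rewrite scale1r.
apply: holo_sumZ => a; apply: holoM; first apply: holoM.
- by apply: holo_exp; apply: holo_scale.
- exact: holo_cst.
- by apply: holo_exp; apply: holo_scale.
Qed.

Lemma holo_exp_nilp n (X : 'M[C]_n) : is_holo (fun s => exp_nilp (s *: X)).
Proof. by apply: holo_sumZ => j; apply: holo_exp; apply: holo_scale. Qed.

End HoloJets.

(** * The Hodge filtration along s |-> exp(sX) F *)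

Section Curve.
Variables (R : realType) (n k : nat).
Local Notation C := R[i].
Variable P : 'I_k.+1 -> 'M[C]_n.
Hypothesis HP : hodge_projs P.
Variable X : 'M[C]_n.
Hypothesis Xn : X ^+ n = 0.
Local Notation f := (filt_proj P).
Local Notation Xb := (conj_mx X).

(* curve_mx p s carries F^p to F^p exp(sX) and conj F^(k+1-p) to its conjugate  *)
(* translate, so that curve_filt p s is the projection onto the p-th step of    *)
(* the filtration exp(sX) F along the conjugate of the (k+1-p)-th step.         *)
Definition curve_mx (p : nat) (s : C) : 'M[C]_n :=
  f p *m exp_nilp (s *: X) + (1%:M - f p) *m conj_mx (exp_nilp (s *: X)).

Definition curve_filt (p : nat) (s : C) : 'M[C]_n :=
  invmx (curve_mx p s) *m f p *m curve_mx p s.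

Definition curve_proj (p : nat) (s : C) : 'M[C]_n := curve_filt p s - curve_filt p.+1 s.

(** Invertibility at [p] keeps the translate of F^p complementary to the conjugate of the translate
    of F^(k+1-p). The steps run from 0 to k + 1, both ends included. *)
Definition curve_dom (s : C) : Prop := forall p : 'I_k.+2, curve_mx p s \in unitmx.

Lemma filt_proj_idem p : f p *m f p = f p.
Proof. by rewrite filt_projM // maxnn. Qed.

Lemma filt_projC_idem p : (1%:M - f p) *m (1%:M - f p) = 1%:M - f p.
Proof. by rewrite mulmxBr mulmx1 mulmxBl mul1mx filt_proj_idem subrr subr0. Qed.

Lemma filt_mulC p : f p *m (1%:M - f p) = 0.
Proof. by rewrite mulmxBr mulmx1 filt_proj_idem subrr. Qed.

Lemma filtC_mul p : (1%:M - f p) *m f p = 0.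
Proof. by rewrite mulmxBl mul1mx filt_proj_idem subrr. Qed.

Local Opaque filt_proj.

Lemma mul_filt_curve p s : f p *m curve_mx p s = f p *m exp_nilp (s *: X).
Proof. by rewrite mulmxDr !mulmxA filt_proj_idem filt_mulC mul0mx addr0. Qed.

Lemma mul_filtC_curve p s :
  (1%:M - f p) *m curve_mx p s = (1%:M - f p) *m conj_mx (exp_nilp (s *: X)).
Proof. by rewrite mulmxDr !mulmxA filtC_mul mul0mx add0r filt_projC_idem. Qed.

Local Opaque curve_mx.

Lemma curve_filtE p s : curve_filt p s = invmx (curve_mx p s) *m f p *m curve_mx p s.
Proof. by []. Qed.

Local Opaque curve_filt.

Lemma curve_filt_idem p s : curve_mx p s \in unitmx ->
  curve_filt p s *m curve_filt p s = curve_filt p s.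
Proof.
move=> Mu; rewrite curve_filtE !mulmxA (mulmxK Mu).
by rewrite -(mulmxA _ (f p) (f p)) filt_proj_idem.
Qed.

Lemma curve_filtC p s : curve_mx p s \in unitmx ->
  1%:M - curve_filt p s = invmx (curve_mx p s) *m (1%:M - f p) *m curve_mx p s.
Proof. by move=> Mu; rewrite curve_filtE mulmxBr mulmx1 mulmxBl mulVmx. Qed.

Lemma cdiff_curve_mx p s :
  is_cdiff (curve_mx p) s (f p *m curve_mx p s *m X) ((1%:M - f p) *m curve_mx p s *m Xb).
Proof.
have E := cdiff_exp_nilp s Xn; rewrite mul_filt_curve mul_filtC_curve.
apply: cdiff_eq (cdiffD (cdiffM (cdiff_cst (f p) s) E)
  (cdiffM (cdiff_cst (1%:M - f p) s) (cdiffJ E))) _ _.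
  by rewrite !mul0mx !add0r /conj_mx map_mx0 mulmx0 addr0 mulmxA.
by rewrite !mul0mx !add0r mulmx0 add0r conj_mxM mulmxA.
Qed.

(** The image of the projection moves holomorphically with [s] and accounts for the first
    derivative; its kernel moves antiholomorphically and accounts for the second. *)
Lemma cdiff_curve_filt p s : curve_mx p s \in unitmx ->
  is_cdiff (curve_filt p) s
    (curve_filt p s *m X *m (1%:M - curve_filt p s))
    (- ((1%:M - curve_filt p s) *m Xb *m curve_filt p s)).
Proof.
move=> Mu; have D := cdiff_curve_mx p s.
apply: cdiff_eq (cdiffM (cdiffM (cdiff_inv D Mu) (cdiff_cst (f p) s)) D) _ _.
  rewrite mulmx0 addr0 mulmxBr mulmx1 addrC curve_filtE; congr (_ + _).
    by rewrite !mulmxA -(mulmxA _ (f p) (f p)) filt_proj_idem.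
  by rewrite !mulNmx !mulmxA.
rewrite mulmx0 addr0 curve_filtC // curve_filtE.
rewrite !mulmxA -(mulmxA _ (f p) (1%:M - f p)) filt_mulC mulmx0 !mul0mx addr0.
by rewrite !mulNmx.
Qed.

Lemma curve_mx0 p : curve_mx p 0 = 1%:M.
Proof.
Local Transparent curve_mx.
rewrite /curve_mx scale0r.
Local Opaque curve_mx.
have -> : exp_nilp (0 : 'M[C]_n) = 1%:M.
  rewrite /exp_nilp; case: n => [|m]; first by apply/matrixP => -[].
  rewrite big_ord_recl big1 ?addr0 => [|i _]; last by rewrite exprS mul0r scaler0.
  by rewrite expr0 fact0 invr1 scale1r.
by rewrite conj_mx1 !mulmx1 addrC subrK.
Qed.

Lemma curve_filt0 p : curve_filt p 0 = f p.
Proof. by rewrite curve_filtE curve_mx0 invmx1 mul1mx mulmx1. Qed.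

Lemma curve_dom0 : curve_dom 0.
Proof. by move=> p; rewrite curve_mx0 unitmx1. Qed.

Lemma curve_dom_open : line_open curve_dom.
Proof.
move=> s Us c; rewrite /curve_dom.
have : \forall t \near (0 : R^o), forall p : 'I_k.+2, p \in enum 'I_k.+2 ->
    curve_mx p (s + t%:C * c) \in unitmx.
  elim: (enum 'I_k.+2) => [|p l IH]; first by near=> t => p.
  apply: filterS2 IH (cdiff_near_unit (cdiff_curve_mx p s) (Us p) c) => t Hl Hp q.
  by rewrite in_cons => /orP[/eqP ->|/Hl].
by apply: filterS => t Ht p; apply: Ht; rewrite mem_enum.
Unshelve. all: by end_near. Qed.

Lemma curve_domP s p : curve_dom s -> (p <= k.+1)%N -> curve_mx p s \in unitmx.
Proof. by move=> Us pk; have := Us (Ordinal (pk : (p < k.+2)%N)). Qed.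

(** For row vectors the first equation is an inclusion of kernels and the second one of images. Both
    persist because one matrix, exp(sX) or its conjugate, moves all the steps. *)
Lemma curve_filtM p q s : curve_dom s -> (p <= q <= k.+1)%N ->
  curve_filt p s *m curve_filt q s = curve_filt q s /\
  curve_filt q s *m curve_filt p s = curve_filt q s.
Proof.
move=> Us /andP[pq qk].
have up := curve_domP Us (leq_trans pq qk); have uq := curve_domP Us qk.
split.
  suff : (1%:M - curve_filt p s) *m curve_filt q s = 0.
    by rewrite mulmxBl mul1mx => /eqP; rewrite subr_eq0 eq_sym => /eqP.
  have c1 : (1%:M - f p) *m (1%:M - f q) = 1%:M - f p.
    by rewrite mulmxBr mulmx1 mulmxBl mul1mx filt_projM // (maxn_idPr pq) subrr subr0.
  have c2 : (1%:M - f p) *m curve_mx q s = (1%:M - f p) *m curve_mx p s.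
    by rewrite -{1}c1 -mulmxA mul_filtC_curve mulmxA c1 mul_filtC_curve.
  have -> : 1%:M - curve_filt p s = invmx (curve_mx p s) *m (1%:M - f p) *m curve_mx q s *m
       (1%:M - curve_filt q s).
    rewrite (curve_filtC uq) !mulmxA (mulmxK uq) -(mulmxA _ (1%:M - f p)) c1.
    by rewrite -mulmxA c2 mulmxA (curve_filtC up).
  by rewrite -[LHS]mulmxA mulmxBl mul1mx (curve_filt_idem uq) subrr mulmx0.
have c1 : f q *m f p = f q by rewrite filt_projM // (maxn_idPl pq).
have c2 : f q *m curve_mx p s = f q *m curve_mx q s.
  by rewrite -{1}c1 -mulmxA mul_filt_curve mulmxA c1 mul_filt_curve.
suff -> : curve_filt q s = invmx (curve_mx q s) *m f q *m curve_mx p s *m curve_filt p s.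
  by rewrite -[LHS]mulmxA (curve_filt_idem up).
rewrite [in RHS]curve_filtE !mulmxA (mulmxK up) -(mulmxA _ (f q) (f p)) c1.
by rewrite -mulmxA c2 mulmxA curve_filtE.
Qed.

Lemma conj_curve_mx p s : (p <= k.+1)%N ->
  conj_mx (curve_mx p s) = curve_mx (k.+1 - p) s.
Proof.
Local Transparent curve_mx.
move=> pk; rewrite /curve_mx conj_mxD !conj_mxM conj_mxK conj_mxB conj_mx1 conj_filt_proj //.
have -> : 1%:M - (1%:M - f (k.+1 - p)) = f (k.+1 - p) by rewrite opprB addrC subrK.
by rewrite addrC.
Local Opaque curve_mx.
Qed.

Lemma conj_invmx (A : 'M[C]_n) : conj_mx (invmx A) = invmx (conj_mx A).
Proof. exact: map_invmx. Qed.

Lemma conj_curve_filt p s : curve_dom s -> (p <= k.+1)%N ->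
  conj_mx (curve_filt p s) = 1%:M - curve_filt (k.+1 - p) s.
Proof.
move=> Us pk; rewrite curve_filtC; last by apply: curve_domP => //; apply: leq_subr.
by rewrite curve_filtE !conj_mxM conj_invmx (conj_curve_mx s pk) (conj_filt_proj HP pk).
Qed.

Lemma curve_filt_zero s : curve_dom s -> curve_filt 0 s = 1%:M.
Proof.
move=> Us; have [_ P1 _] := HP; rewrite curve_filtE filt_proj0 P1 mulmx1 mulVmx //.
exact: curve_domP.
Qed.

Lemma curve_filt_max s : curve_filt k.+1 s = 0.
Proof. by rewrite curve_filtE filt_proj_max mulmx0 mul0mx. Qed.

Lemma hodge_projs_curve s : curve_dom s ->
  hodge_projs (fun p : 'I_k.+1 => curve_proj p s).
Proof.
move=> Us; apply: (hodge_projs_of_filt (Pi := fun p => curve_filt p s)).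
- exact: curve_filt_zero.
- exact: curve_filt_max.
- by move=> p q; apply: curve_filtM.
- by move=> p; apply: conj_curve_filt.
Qed.

(** The conjugate of step k - p of the translated filtration is the kernel of the projection onto
    step p + 1. For nested idempotents A and B, the image of A meets the kernel of B in the image of
    A - B. *)
Lemma chart_eqmx (F : 'I_k.+1 -> 'M[C]_n) s (p : 'I_k.+1) :
  (forall p, (F p :=: P p)%MS) -> curve_dom s ->
  (chart F (s *: X) p :=: curve_proj p s)%MS.
Proof.
move=> FP Us; have pk := ltn_ord p.
set E := exp_nilp (s *: X).
have up := curve_domP Us (ltnW pk); have uS := curve_domP Us pk.
have e1 : (hodge_filt F p *m E :=: curve_filt p s)%MS.
  apply: eqmx_trans (eqmxMr _ (hodge_filt_eqmx p HP FP)) _.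
  rewrite -mul_filt_curve curve_filtE -mulmxA.
  by apply: eqmx_sym; apply: eqmxMfull; rewrite row_full_unit unitmx_inv.
have e2 : (conj_mx (hodge_filt F (rev_ord p) *m E) :=: 1%:M - curve_filt p.+1 s)%MS.
  rewrite (curve_filtC uS) -mulmxA mul_filtC_curve.
  apply: eqmx_trans (eqmx_sym (eqmxMfull _ _)); last by rewrite row_full_unit unitmx_inv.
  rewrite conj_mxM; apply: eqmxMr.
  have -> : 1%:M - f p.+1 = conj_mx (f (rev_ord p)).
    by rewrite conj_filt_proj ?leq_subLR ?leq_addl //= subSS; congr (_ - f _); lia.
  by apply/eqmxP; rewrite !map_submx; apply/eqmxP; apply: hodge_filt_eqmx.
have [c1 c2] := curve_filtM Us (p := p) (q := p.+1) ltac:(lia).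
have i1 := curve_filt_idem up; have i2 := curve_filt_idem uS.
apply: eqmx_trans (cap_eqmx e1 e2) _; rewrite /curve_proj.
move: (curve_filt p s) (curve_filt p.+1 s) c1 c2 i1 i2 => A B c1 c2 i1 i2.
apply/eqmxP/andP; split.
  apply/rV_subP => v; rewrite sub_capmx => /andP[/submxP[a va] /submxP[b vb]].
  have vA : v *m A = v by rewrite va -mulmxA i1.
  have vB : v *m B = 0 by rewrite vb -mulmxA mulmxBl mul1mx i2 subrr mulmx0.
  by rewrite -[v](_ : v *m (A - B) = v) ?submxMl // mulmxBr vA vB subr0.
rewrite sub_capmx; apply/andP; split.
  by rewrite -[A - B](_ : (A - B) *m A = _) ?submxMl // mulmxBl i1 c2.
rewrite -[A - B](_ : (A - B) *m (1%:M - B) = _) ?submxMl //.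
by rewrite mulmxBr mulmx1 mulmxBl c1 i2 subrr subr0.
Qed.

Lemma hodge_proj_chart (F : 'I_k.+1 -> 'M[C]_n) s p :
  (forall p, (F p :=: P p)%MS) -> curve_dom s ->
  hodge_proj (chart F (s *: X)) p = curve_proj p s.
Proof.
move=> FP Us; apply: (projs_eqmx_hodge_proj (hodge_projs_curve Us)) => q.
exact: chart_eqmx.
Qed.

End Curve.

(** The linear elimination that closes [second_variation_trace], where each letter is a trace and
    the three [z] are the traces that vanish. *)
Lemma addr_elim (V : zmodType) (a b c d e f g z1 z2 z3 : V) :
  z1 = 0 -> z2 = 0 -> z3 = 0 ->
  a + b + c + z1 = 0 -> d + e + f + z2 = 0 -> b + g + e + z3 = 0 -> a + c + (d + f) = g.
Proof.
move=> -> -> ->; rewrite !addr0.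
rewrite addrAC => /eqP; rewrite addr_eq0 => /eqP ->.
rewrite addrAC => /eqP; rewrite addr_eq0 => /eqP ->.
by rewrite addrAC => /eqP; rewrite addr_eq0 => /eqP h; rewrite -opprD h opprK.
Qed.

Section TraceIdentity.
Variables (R : realType) (n : nat).
Implicit Types (p q x y : 'M[R[i]]_n).

Definition lie_br x y : 'M[R[i]]_n := x *m y - y *m x.

Lemma lie_brM x y z : lie_br (x *m y) z = lie_br x z *m y + x *m lie_br y z.
Proof. by rewrite /lie_br mulmxBl mulmxBr !mulmxA [RHS]addrC addrA subrK. Qed.

Lemma lie_brxx x : lie_br x x = 0.
Proof. exact: subrr. Qed.

Lemma lie_brB x y z : lie_br (x - y) z = lie_br x z - lie_br y z.
Proof. by rewrite /lie_br mulmxBl mulmxBr !opprD !opprK addrACA. Qed.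

Lemma mxtrace_lie_br x y : \tr (lie_br x y) = 0.
Proof. by rewrite /lie_br raddfB /= mxtrace_mulC subrr. Qed.

Lemma lie_brE x y : lie_br x y = x *m y - y *m x.
Proof. by []. Qed.

Lemma lie_brC x y : lie_br x y = - lie_br y x.
Proof. by rewrite /lie_br opprB. Qed.

Local Opaque lie_br.

Lemma mxtrace_leibniz a b c d z :
  \tr (lie_br a z *m b *m c *m d) + \tr (a *m lie_br b z *m c *m d)
  + \tr (a *m b *m lie_br c z *m d) + \tr (a *m b *m c *m lie_br d z) = 0.
Proof.
rewrite -[RHS](mxtrace_lie_br (a *m b *m c *m d) z) !lie_brM.
move: (lie_br a z) (lie_br b z) (lie_br c z) (lie_br d z) => a' b' c' d'.
by rewrite !mulmxDl !mxtraceD.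
Qed.

Lemma mxtrace_sum4 a b c d y :
  \tr ((a + b + (c + d)) *m y)
  = \tr (a *m y) + \tr (b *m y) + (\tr (c *m y) + \tr (d *m y)).
Proof. by rewrite !mulmxDl !mxtraceD. Qed.

(* Integration by parts for the derivations [-, x] and [-, y], which have     *)
(* trace zero.                                                                *)
Lemma second_variation_trace p q x y :
  q *m lie_br x y = lie_br x y *m q -> p *m q = 0 ->
  \tr (lie_br (lie_br p x) y *m x *m q *m y) + \tr (lie_br p x *m x *m lie_br q y *m y)
     + (\tr (lie_br p y *m x *m lie_br q x *m y) + \tr (p *m x *m lie_br (lie_br q x) y *m y))
  = \tr (p *m lie_br (lie_br x y) x *m q *m y).
Proof.
move=> qH pq.
have e1 := mxtrace_leibniz (lie_br p x) x q y y.
have e2 := mxtrace_leibniz p x (lie_br q x) y y.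
have e3 := mxtrace_leibniz p (lie_br x y) q y x.
have e4 : \tr (p *m lie_br x y *m q *m lie_br y x) = 0.
  by rewrite -(mulmxA p) -qH mulmxA pq !mul0mx mxtrace0.
have z0 (M : 'M[R[i]]_n) : \tr (M *m lie_br y y) = 0.
  by rewrite lie_brxx mulmx0 mxtrace0.
exact: addr_elim (z0 _) (z0 _) e4 e1 e2 e3.
Qed.
End TraceIdentity.

(** * Second variation of the metric in a direction of degree -1 *)

Section Variation.
Variables (R : realType) (n k : nat).
Local Notation C := R[i].
Variable P : 'I_k.+1 -> 'M[C]_n.
Hypothesis HP : hodge_projs P.
Variable X : 'M[C]_n.
Hypothesis Xn : X ^+ n = 0.
Hypothesis PX : forall r s : 'I_k.+1, r != s.+1 :> nat -> P r *m X *m P s = 0.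
Local Notation f := (filt_proj P).
Local Notation Xb := (conj_mx X).

Lemma projs_ext (A B : 'M[C]_n) :
  (forall r s, P r *m A *m P s = P r *m B *m P s) -> A = B.
Proof.
have [_ P1 _] := HP => AB.
rewrite -[A]mul1mx -[B]mul1mx -P1 !mulmx_suml; apply: eq_bigr => r _.
rewrite -[LHS]mulmx1 -[RHS]mulmx1 -P1 !mulmx_sumr; apply: eq_bigr => s _.
exact: AB.
Qed.

Lemma mul_filt_proj r q : f q *m P r = if (q <= r)%N then P r else 0.
Proof.
have [PP _ _] := HP; rewrite mulmx_suml; case: ifP => qr.
  rewrite (bigD1 r) //= PP eqxx big1 ?addr0 // => i /andP[_ ir].
  by rewrite PP (negPf ir).
by apply: big1 => i qi; rewrite PP; case: eqP => // ri; rewrite -ri qi in qr.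
Qed.

(** Both sides are the part of [X] that starts in degree above [p], or equivalently ends in degree
    at least [p]. *)
Lemma filt_lower p : f p.+1 *m X = X *m f p.
Proof.
apply: projs_ext => r s.
rewrite !mulmxA mul_proj_filt // -(mulmxA _ (f p)) mul_filt_proj.
case: (eqVneq (r : nat) s.+1) => [->|rs]; first by rewrite ltnS; case: ifP => _; rewrite ?mul0mx ?mulmx0.
by case: ifP => _; case: ifP => _; rewrite ?mul0mx ?mulmx0 ?PX ?mul0mx.
Qed.

Lemma conj_raise p : Xb *m f p.+1 = f p *m Xb.
Proof.
have [pk|kp] := leqP p k; last first.
  by rewrite /filt_proj !big1 ?mulmx0 ?mul0mx // => r; have := ltn_ord r; lia.
have := congr1 (@conj_mx R n n) (filt_lower (k - p)).
rewrite !conj_mxM !(conj_filt_proj HP) ?ltnS ?leq_subr ?(leqW (leq_subr _ _)) //.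
rewrite subSS subKn // subSn ?leq_subr // subKn // mulmxBl mulmxBr mul1mx mulmx1.
by move/(congr1 (fun M => Xb - M)); rewrite !opprB !(addrC Xb) !subrK.
Qed.

Local Opaque filt_proj curve_mx curve_filt.

Lemma filt_anti p q : (p <= q)%N -> f p *m f q = f q /\ f q *m f p = f q.
Proof. by move=> pq; rewrite !filt_projM // (maxn_idPr pq) (maxn_idPl pq). Qed.

Lemma filt0 : f 0 = 1%:M.
Proof. by have [_ P1 _] := HP; rewrite filt_proj0. Qed.

Lemma filt_XXb p : f p *m (X *m Xb) = X *m Xb *m f p.
Proof.
case: p => [|p]; first by rewrite filt0 mul1mx mulmx1.
by rewrite mulmxA filt_lower -mulmxA -conj_raise mulmxA.
Qed.

Lemma filt_XbX p : f p *m (Xb *m X) = Xb *m X *m f p.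
Proof. by rewrite mulmxA -conj_raise -mulmxA filt_lower mulmxA. Qed.

Lemma filt_X_filt p : f p *m X *m f p = X *m f p.
Proof.
case: p => [|p]; first by rewrite filt0 mul1mx.
by rewrite filt_lower -mulmxA; have [-> _] := filt_anti (leqnSn p).
Qed.

Lemma filt_Xb_filt p : f p *m Xb *m f p = f p *m Xb.
Proof. by rewrite -conj_raise -mulmxA; have [_ ->] := filt_anti (leqnSn p). Qed.

(** Since [X] lowers the degree by one and Xb raises it by one, the derivatives of the projections
    collapse at s = 0 to commutators. In this form they are derivations, which the trace can
    integrate by parts. *)
Lemma filt_variation p :
  [/\ f p *m X *m (1%:M - f p) = lie_br (f p) X,
      - ((1%:M - f p) *m Xb *m f p) = lie_br (f p) Xb &
      lie_br (f p) Xb *m X *m (1%:M - f p) + f p *m X *m (- lie_br (f p) Xb)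
        = lie_br (lie_br (f p) X) Xb].
Proof.
have e1 := filt_XXb p; have e2 := filt_XbX p; have e3 := filt_X_filt p; have e4 := filt_Xb_filt p.
have e5 := filt_proj_idem HP p.
move: (f p) Xb e1 e2 e3 e4 e5 => g Y e1 e2 e3 e4 e5.
split.
- by rewrite mulmxBr mulmx1 e3.
- by rewrite mulmxBl mul1mx mulmxBl e4 opprB.
rewrite /lie_br !(mulmxBl, mulmxBr, mulmxN, mulmx1, opprB).
rewrite !mulmxA in e1 e2 e3 e4 e5 *.
have c1 : Y *m g *m X *m g = Y *m X *m g.
  by rewrite -(mulmxA Y g X) -(mulmxA Y _ g) e3 mulmxA.
have c2 : g *m Y *m X *m g = Y *m X *m g.
  by rewrite e2 -(mulmxA (Y *m X)) e5.
have c3 : g *m X *m Y *m g = g *m X *m Y.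
  by rewrite e1 -(mulmxA (X *m Y)) e5.
by rewrite c2 c1 c3 e3 e2 subrr addr0 addrC.
Qed.

Local Opaque filt_proj curve_mx curve_filt lie_br.

Lemma jet_curve_filt p : (p <= k.+1)%N -> exists fz fw,
  [/\ is_jet (curve_dom P X) (curve_filt P X p) fz fw (lie_br (lie_br (f p) X) Xb),
      fz 0 = lie_br (f p) X & fw 0 = lie_br (f p) Xb].
Proof.
move=> pk; pose D := curve_dom P X; pose F := curve_filt P X p.
have D0 : D 0 by apply: curve_dom0.
have d s : D s -> is_cdiff F s (F s *m X *m (1%:M - F s)) (- ((1%:M - F s) *m Xb *m F s)).
  by move=> Ds; apply: cdiff_curve_filt => //; apply: curve_domP.
exists (fun s => F s *m X *m (1%:M - F s)), (fun s => - ((1%:M - F s) *m Xb *m F s)).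
have F0 : F 0 = f p by apply: curve_filt0.
have [zE wE e] := filt_variation p.
split; last 2 first; first by rewrite F0; exact: zE.
  by rewrite F0; exact: wE.
split=> [s Ds|]; first exact: d.
have d0 := d 0 D0; rewrite F0 zE wE in d0.
have H := cdiffM (cdiffM d0 (cdiff_cst X 0)) (cdiffD (cdiff_cst 1%:M 0) (cdiffN d0)).
eexists; apply: cdiff_eq H erefl _.
by rewrite mulmx0 addr0 add0r F0; exact: e.
Qed.

Local Notation Q r := (f r - f r.+1).

Lemma jet_curve_proj p : (p <= k)%N -> exists fz fw,
  [/\ is_jet (curve_dom P X) (curve_proj P X p) fz fw (lie_br (lie_br (Q p) X) Xb),
      fz 0 = lie_br (Q p) X & fw 0 = lie_br (Q p) Xb].
Proof.
move=> pk.
have [az [aw [ja az0 aw0]]] := jet_curve_filt (leqW pk).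
have [bz [bw [jb bz0 bw0]]] := jet_curve_filt (pk : (p.+1 <= k.+1)%N).
exists (fun s => az s - bz s), (fun s => aw s - bw s); split; last 2 first.
- by rewrite az0 bz0 -lie_brB.
- by rewrite aw0 bw0 -lie_brB.
apply: jet_ext (jetD ja (jetZ (-1) jb)) _ _ _ _ => [s|s|s|].
- by rewrite scaleN1r.
- by rewrite scaleN1r.
- by rewrite scaleN1r.
- by rewrite scaleN1r lie_brB lie_brB.
Qed.

Lemma filt_diff_proj (r : 'I_k.+1) : Q r = P r.
Proof. by rewrite filt_projS addrK. Qed.

(** The metric as in [hodge_metricE], with [B] in the place of [conj_mx Y]: bilinear over C, so that
    jets can be taken factor by factor. *)
Definition graded_form (A B : 'M[C]_n) : C :=
  - \sum_(r < k.+1) \sum_(s < k.+1 | (s < r)%N) (-1) ^+ (r + s)%N * \tr (P r *m A *m P s *m B).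

(* The hypothesis holds as soon as A or B has degree -1 or 1, and the only      *)
(* signs that occur are then (-1)^(r + s) = -1.                                 *)
Lemma graded_form_trace A B :
  (forall r s : 'I_k.+1, r != s.+1 :> nat -> \tr (P r *m A *m P s *m B) = 0) ->
  graded_form A B = \tr (A *m B).
Proof.
move=> AB; have [_ P1 _] := HP.
have -> : \tr (A *m B) = \sum_(r < k.+1) \sum_(s < k.+1) \tr (P r *m A *m P s *m B).
  have {1}-> : A *m B = \sum_r P r *m A *m B.
    by rewrite -!mulmx_suml P1 mul1mx.
  rewrite (raddf_sum (@mxtrace C n)); apply: eq_bigr => r _ /=.
  have {1}-> : P r *m A *m B = \sum_s P r *m A *m P s *m B.
    by rewrite -mulmx_suml -mulmx_sumr P1 mulmx1.
  exact: (raddf_sum (@mxtrace C n)).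
rewrite /graded_form -sumrN; apply: eq_bigr => r _.
rewrite big_mkcond -sumrN; apply: eq_bigr => s _ /=.
have [rs|rs] := eqVneq (r : nat) s.+1; last by rewrite AB // mulr0 if_same oppr0.
by rewrite rs ltnSn addSn addnn -signr_odd /= odd_double mulN1r opprK.
Qed.

Lemma PXbP (r s : 'I_k.+1) : r != s.+1 :> nat -> P s *m Xb *m P r = 0.
Proof.
move=> rs; have [_ _ PJ] := HP.
have E : P (rev_ord s) *m X *m P (rev_ord r) = 0.
  by apply: PX; move: rs; have := ltn_ord r; have := ltn_ord s; rewrite /=; lia.
have := congr1 (@conj_mx R n n) E.
by rewrite !conj_mxM !PJ !rev_ordK /conj_mx map_mx0.
Qed.

Lemma trace_projl r (A : 'M[C]_n) : \tr (P r *m A) = \tr (P r *m A *m P r).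
Proof. by have [PP _ _] := HP; rewrite [RHS]mxtrace_mulC mulmxA PP eqxx. Qed.

Lemma graded_form_Xb A : graded_form A Xb = \tr (A *m Xb).
Proof.
apply: graded_form_trace => r s rs; rewrite -!mulmxA trace_projl.
by rewrite -!mulmxA [P s *m _]mulmxA PXbP // !mulmx0 mxtrace0.
Qed.

Lemma graded_form_X B : graded_form X B = \tr (X *m B).
Proof. by apply: graded_form_trace => r s rs; rewrite PX // mul0mx mxtrace0. Qed.

Lemma jet_curve_projs : exists Pz Pw : 'I_k.+1 -> C -> 'M[C]_n, forall r : 'I_k.+1,
  [/\ is_jet (curve_dom P X) (curve_proj P X r) (Pz r) (Pw r) (lie_br (lie_br (P r) X) Xb),
      Pz r 0 = lie_br (P r) X & Pw r 0 = lie_br (P r) Xb].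
Proof.
have H (r : 'I_k.+1) : exists ff : (C -> 'M[C]_n) * (C -> 'M[C]_n),
    [/\ is_jet (curve_dom P X) (curve_proj P X r) ff.1 ff.2 (lie_br (lie_br (P r) X) Xb),
      ff.1 0 = lie_br (P r) X & ff.2 0 = lie_br (P r) Xb].
  have [fz [fw]] := jet_curve_proj (leq_ord r).
  by rewrite filt_diff_proj => h; exists (fz, fw).
have [g gP] := boolp.choice H.
by exists (fun r => (g r).1), (fun r => (g r).2).
Qed.

Definition curve_form (A B : C -> 'M[C]_n) (s : C) : 'M[C]_1 :=
  \sum_(r < k.+1) \sum_(t < k.+1 | (t < r)%N)
    (- (-1) ^+ (r + t)%N) *: (\tr (curve_proj P X r s *m A s *m curve_proj P X t s *m B s))%:M.

Lemma curve_proj0 (r : 'I_k.+1) : curve_proj P X r 0 = P r.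
Proof. by rewrite /curve_proj !curve_filt0 // filt_diff_proj. Qed.

(** The right-hand sides are the output of [jetM] on four factors, left unexpanded: in each use most
    of the derivatives in them are zero. *)
Lemma jet_curve_form A Az Aw Azw B Bz Bw Bzw :
  is_jet (curve_dom P X) A Az Aw Azw -> is_jet (curve_dom P X) B Bz Bw Bzw ->
  exists fz fw fzw, [/\ is_jet (curve_dom P X) (curve_form A B) fz fw fzw,
   fz 0 = \sum_(r < k.+1) \sum_(t < k.+1 | (t < r)%N) (- (-1) ^+ (r + t)%N) *:
     (\tr (((lie_br (P r) X *m A 0 + P r *m Az 0) *m P t
             + P r *m A 0 *m lie_br (P t) X) *m B 0
            + P r *m A 0 *m P t *m Bz 0))%:M &
   fzw = \sum_(r < k.+1) \sum_(t < k.+1 | (t < r)%N) (- (-1) ^+ (r + t)%N) *: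
     (\tr (((lie_br (lie_br (P r) X) Xb *m A 0 + lie_br (P r) X *m Aw 0
              + (lie_br (P r) Xb *m Az 0 + P r *m Azw)) *m P t
            + (lie_br (P r) X *m A 0 + P r *m Az 0) *m lie_br (P t) Xb
            + ((lie_br (P r) Xb *m A 0 + P r *m Aw 0) *m lie_br (P t) X
               + P r *m A 0 *m lie_br (lie_br (P t) X) Xb)) *m B 0
           + ((lie_br (P r) X *m A 0 + P r *m Az 0) *m P t
             + P r *m A 0 *m lie_br (P t) X) *m Bw 0
           + (((lie_br (P r) Xb *m A 0 + P r *m Aw 0) *m P t
             + P r *m A 0 *m lie_br (P t) Xb) *m Bz 0
             + P r *m A 0 *m P t *m Bzw)))%:M].
Proof.
have [Pz [Pw PJ]] := jet_curve_projs; have D0 := curve_dom0 P X.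
have PJ1 (r : 'I_k.+1) : is_jet (curve_dom P X) (curve_proj P X r) (Pz r) (Pw r) (lie_br (lie_br (P r) X) Xb).
  by have [] := PJ r.
have Pz0 (r : 'I_k.+1) : Pz r 0 = lie_br (P r) X by have [] := PJ r.
have Pw0 (r : 'I_k.+1) : Pw r 0 = lie_br (P r) Xb by have [] := PJ r.
move=> JA JB.
have J (r t : 'I_k.+1) := jetZ (- (-1) ^+ (r + t)%N)
   (jet_trace (jetM D0 (jetM D0 (jetM D0 (PJ1 r) JA) (PJ1 t)) JB)).
have H := jet_sum (index_enum 'I_k.+1) (S := xpredT) (fun r _ =>
  jet_sum (index_enum 'I_k.+1) (S := fun t : 'I_k.+1 => (t < r)%N) (fun t _ => J r t)).
eexists _, _, _; split; first exact: H.
  by apply: eq_bigr => r _; apply: eq_bigr => t _; rewrite !curve_proj0 !Pz0.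
by apply: eq_bigr => r _; apply: eq_bigr => t _; rewrite !curve_proj0 !Pz0 !Pw0.
Qed.

Lemma scalar_graded_form A B :
  \sum_(r < k.+1) \sum_(t < k.+1 | (t < r)%N) (- (-1) ^+ (r + t)%N) *:
     (\tr (P r *m A *m P t *m B))%:M = (graded_form A B)%:M :> 'M[C]_1.
Proof.
rewrite /graded_form -sumrN (raddf_sum (@scalar_mx C 1)); apply: eq_bigr => r _.
rewrite -sumrN (raddf_sum (@scalar_mx C 1)); apply: eq_bigr => t _.
by rewrite scale_scalar_mx mulNr.
Qed.

(** As [X, X] = 0, integrating by parts along [X] moves the derivative from the projections to
    [B 0]. What is left is - tr(X [B 0, X]), which is zero by cyclicity of the trace. *)
Lemma jet_curve_form_X B Bw Bzw :
  is_jet (curve_dom P X) B (fun=> 0) Bw Bzw ->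
  exists fz fw fzw, is_jet (curve_dom P X) (curve_form (fun=> X) B) fz fw fzw /\ fz 0 = 0.
Proof.
move=> JB; have [fz [fw [fzw [J z0 _]]]] := jet_curve_form (jet_cst _ X) JB.
exists fz, fw, fzw; split=> //; rewrite {}z0.
transitivity ((- graded_form X (lie_br (B 0) X))%:M : 'M[C]_1); last first.
  by rewrite graded_form_X mulmxBr !mulmxA raddfB /= [\tr (X *m B 0 *m X)]mxtrace_mulC mulmxA subrr oppr0 raddf0.
rewrite raddfN /= -scalar_graded_form -sumrN; apply: eq_bigr => r _.
rewrite -sumrN; apply: eq_bigr => t _.
rewrite -scalerN; congr (_ *: _); rewrite -[RHS](raddfN (@scalar_mx C 1)) /=; congr (_%:M).
have := mxtrace_leibniz (P r) X (P t) (B 0) X.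
rewrite lie_brxx !mulmx0 !mul0mx mxtrace0 !addr0 => /eqP; rewrite addr_eq0 => /eqP <-.
by rewrite mulmxDl mxtraceD.
Qed.

Lemma proj_H (r : 'I_k.+1) : P r *m (Xb *m X) = Xb *m X *m P r /\
   P r *m lie_br X Xb = lie_br X Xb *m P r.
Proof.
have c : P r *m (Xb *m X) = Xb *m X *m P r.
  by rewrite -filt_diff_proj mulmxBl mulmxBr !filt_XbX.
split=> //; rewrite lie_brE mulmxBr mulmxBl c; congr (_ - _).
by rewrite -filt_diff_proj mulmxBl mulmxBr !filt_XXb.
Qed.

(** [second_variation_trace] applies block by block because [X, Xb] has degree 0 and commutes with
    every projection. Summing gives the trace of [[X, Xb], X] Xb, and one more integration by parts
    gives that of [X, Xb]^2. *)
Lemma jet_curve_form_XX : exists fz fw,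
  is_jet (curve_dom P X) (curve_form (fun=> X) (fun=> Xb)) fz fw
    (\tr (lie_br X Xb *m lie_br X Xb))%:M.
Proof.
have [fz [fw [fzw [J _ zw]]]] := jet_curve_form (jet_cst _ X) (jet_cst _ Xb).
exists fz, fw; suff <- : fzw = (\tr (lie_br X Xb *m lie_br X Xb))%:M by [].
transitivity ((graded_form (lie_br (lie_br X Xb) X) Xb)%:M : 'M[C]_1); last first.
  rewrite graded_form_Xb; congr (_%:M).
  have := mxtrace_lie_br (lie_br X Xb *m Xb) X; rewrite lie_brM mxtraceD => /eqP.
  by rewrite addr_eq0 [lie_br Xb X]lie_brC mulmxN raddfN opprK => /eqP.
rewrite zw -scalar_graded_form; apply: eq_bigr => r _; apply: eq_bigr => t tr.
congr (_ *: _%:M); rewrite !mulmx0 !addr0.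
have [rX rH] := proj_H r; have [tX tH] := proj_H t; have [PP _ _] := HP.
rewrite -second_variation_trace //; last first.
  by rewrite PP; case: eqP => // rt; rewrite rt ltnn in tr.
exact: mxtrace_sum4.
Qed.

End Variation.

Section GradedForm.
Variables (R : realType) (n k : nat).
Local Notation C := R[i].
Implicit Types (P : 'I_k.+1 -> 'M[C]_n).

Lemma graded_form_suml P (I : Type) (l : seq I) (c : I -> C) (A : I -> 'M[C]_n) B :
  graded_form P (\sum_(i <- l) c i *: A i) B = \sum_(i <- l) c i * graded_form P (A i) B.
Proof.
under [RHS]eq_bigr do rewrite /graded_form mulrN mulr_sumr.
rewrite sumrN exchange_big /graded_form; congr (- _); apply: eq_bigr => r _ /=.
under [RHS]eq_bigr do rewrite mulr_sumr.
rewrite exchange_big; apply: eq_bigr => s _ /=.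
rewrite mulmx_sumr !mulmx_suml (raddf_sum (@mxtrace C n)) mulr_sumr.
by apply: eq_bigr => i _; rewrite /= -scalemxAr -!scalemxAl mxtraceZ mulrCA.
Qed.

Lemma graded_form_sumr P (I : Type) (l : seq I) (c : I -> C) A (B : I -> 'M[C]_n) :
  graded_form P A (\sum_(i <- l) c i *: B i) = \sum_(i <- l) c i * graded_form P A (B i).
Proof.
under [RHS]eq_bigr do rewrite /graded_form mulrN mulr_sumr.
rewrite sumrN exchange_big /graded_form; congr (- _); apply: eq_bigr => r _ /=.
under [RHS]eq_bigr do rewrite mulr_sumr.
rewrite exchange_big; apply: eq_bigr => s _ /=.
rewrite mulmx_sumr (raddf_sum (@mxtrace C n)) mulr_sumr.
by apply: eq_bigr => i _; rewrite /= -scalemxAr mxtraceZ mulrCA.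
Qed.

Lemma curve_formE P X A B s :
  curve_form P X A B s = (graded_form (fun r : 'I_k.+1 => curve_proj P X r s) (A s) (B s))%:M.
Proof. exact: (scalar_graded_form (fun r : 'I_k.+1 => curve_proj P X r s)). Qed.

End GradedForm.

Section JetRestriction.
Variable R : realType.
Local Notation C := R[i].

Lemma jet_congr (U : C -> Prop) p q (f g fz fw : C -> 'M[C]_(p, q)) fzw :
  line_open U -> is_jet U f fz fw fzw -> (forall s, U s -> f s = g s) ->
  is_jet U g fz fw fzw.
Proof.
move=> Uo [fd fzd] fg; split=> // s Us.
apply: cdiff_near (fd s Us) => c.
by apply: filterS (Uo s Us c) => t; apply: fg.
Qed.

Lemma jet_sub (U U' : C -> Prop) p q (f fz fw : C -> 'M[C]_(p, q)) fzw :
  (forall s, U' s -> U s) -> is_jet U f fz fw fzw -> is_jet U' f fz fw fzw.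
Proof. by move=> UU [fd fzd]; split=> // s /UU; apply: fd. Qed.

End JetRestriction.

Lemma exp_nilp0 (R : realType) n : exp_nilp (0 : 'M[R[i]]_n) = 1%:M.
Proof.
rewrite /exp_nilp; case: n => [|m]; first by apply/matrixP => -[].
rewrite big_ord_recl big1 ?addr0 => [|i _]; last by rewrite exprS mul0r scaler0.
by rewrite expr0 fact0 invr1 scale1r.
Qed.

(* For n = 1 the truncated exponential is constant.                           *)
Lemma dexp_nilp0 (R : realType) n (Y : 'M[R[i]]_n) : (1 < n)%N -> dexp_nilp 0 Y = Y.
Proof.
rewrite /dexp_nilp; case: n Y => [|[|n]] // Y _.
rewrite 2!big_ord_recl !big_ord0 scaler0 add0r big_ord_recl big_ord0 addr0.
rewrite big1 ?addr0 => [|i _].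
  by rewrite /= !expr0 mul1mx mulmx1 invr1 scale1r.
rewrite big1 ?scaler0 // => a _.
have [a0|a0] := eqVneq (a : nat) 0%N.
  by rewrite a0 subn0 /= exprS mul0r mulmx0.
by rewrite -(prednK (n := a)) ?lt0n // exprS mul0r !mul0mx.
Qed.

(** * The curvature as a trace of commutators *)

Section HodgeCurvature.
Variables (R : realType) (n k : nat) (Q : 'M[int]_n).
Local Notation C := R[i].
Variable F : 'I_k.+1 -> 'M[C]_n.
Hypothesis Fdec : hodge_decomposition F.
Local Notation P := (hodge_proj F).
Local Notation V := (lie_mminus Q F).
Local Notation e i := (vbasis V)`_i.
Variable X : 'M[C]_n.
Hypothesis n_gt1 : (1 < n)%N.
Hypothesis Xn : X ^+ n = 0.
Hypothesis PX : forall r s : 'I_k.+1, r != s.+1 :> nat -> P r *m X *m P s = 0.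
Hypothesis XV : X \in V.
Hypothesis h_pos : forall Y, Y \in V -> Y != 0 -> hodge_metric F Y Y != 0.

Let HP : hodge_projs P := hodge_proj_projs Fdec.
Let FP p : (F p :=: P p)%MS := hodge_proj_eqmx p Fdec.
Definition tangent_dir : 'rV[C]_(\dim V) := \row_i coord (vbasis V) i X.
Definition tangent_frame (i : 'I_(\dim V)) (s : C) : 'M[C]_n := exp_nilp (- (s *: X)) *m dexp_nilp (s *: X) (e i).
Definition gram_curve (s : C) : 'M[C]_(\dim V) :=
  \matrix_(i, j) curve_form P X (tangent_frame i) (fun s => conj_mx (tangent_frame j s)) s 0 0.

Local Notation v := tangent_dir.
Local Notation Y := tangent_frame.
Local Notation G := gram_curve.

Lemma tangent_dirE i : v 0 i = coord (vbasis V) i X.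
Proof. exact: mxE. Qed.

Lemma gram_curveE s i j : G s i j =
  graded_form (fun r : 'I_k.+1 => curve_proj P X r s) (Y i s) (conj_mx (Y j s)).
Proof. by rewrite mxE curve_formE mxE mulr1n. Qed.

Lemma chart_point_dir s : chart_point (s *: v) = s *: X.
Proof.
rewrite /chart_point [in RHS](coord_vbasis XV) scaler_sumr; apply: eq_bigr => i _.
by rewrite mxE tangent_dirE scalerA.
Qed.

Lemma chart_gram_curve s : curve_dom P X s -> chart_gram (s *: v) = G s.
Proof.
move=> Us; apply/matrixP => i j; rewrite gram_curveE mxE chart_point_dir.
have cY (a : 'I_(\dim V)) : chart_diff (s *: X) (e a) = Y a s.
  by rewrite /chart_diff d_z_exp_nilp.
rewrite !cY.
rewrite (hodge_metricE _ _ (hodge_projs_curve HP Us)); last first.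
  by move=> p; apply: hodge_proj_chart.
reflexivity.
Qed.

(** [X] commutes with exp(sX), so the velocity of the curve is represented by the constant [X].
    Contracted with this direction, the Gram matrix varies only through the projections. *)
Lemma dir_sum s : \sum_i v 0 i *: Y i s = X.
Proof.
have -> : \sum_i v 0 i *: Y i s
    = exp_nilp (- (s *: X)) *m dexp_nilp (s *: X) (\sum_i v 0 i *: e i).
  by rewrite dexp_nilp_linear mulmx_sumr; apply: eq_bigr => i _; rewrite -scalemxAr.
have -> : \sum_i v 0 i *: e i = X.
  by rewrite [RHS](coord_vbasis XV); apply: eq_bigr => i _; rewrite tangent_dirE.
have sXn : (s *: X) ^+ n = 0 by rewrite exprmxZ Xn scaler0.
rewrite dexp_nilp_self // (_ : X *m exp_nilp (s *: X) = exp_nilp (s *: X) *m X).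
  by rewrite mulmxA exp_nilpN // mul1mx.
rewrite /exp_nilp mulmx_suml mulmx_sumr; apply: eq_bigr => j _.
rewrite -scalemxAl -scalemxAr exprmxZ -scalemxAl -scalemxAr.
by congr (_ *: (_ *: _)); rewrite -[LHS]exprS -[RHS]exprSr.
Qed.

Lemma holo_tangent_frame i : is_holo (Y i).
Proof.
apply: holoM; last exact: holo_dexp.
by apply: holo_ext (holo_exp_nilp (- X)) => s; rewrite scalerN.
Qed.

Local Opaque gram_curve tangent_frame tangent_dir curve_form.

Lemma dir_gram s : v *m G s =
  \matrix_(i, j) curve_form P X (fun=> X) (fun s => conj_mx (Y j s)) s 0 0.
Proof.
apply/matrixP => i j; rewrite ord1 [LHS]mxE [RHS]mxE curve_formE [RHS]mxE mulr1n -{2}(dir_sum s).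
rewrite graded_form_suml; apply: eq_bigr => a _.
by rewrite gram_curveE.
Qed.

Lemma dir_gram_dir s :
  v *m G s *m (conj_mx v)^T = curve_form P X (fun=> X) (fun=> conj_mx X) s.
Proof.
apply/matrixP => i j; rewrite !ord1 dir_gram curve_formE [LHS]mxE [RHS]mxE mulr1n.
have -> : conj_mx X = \sum_a (v 0 a)^* *: conj_mx (Y a s).
  by rewrite -(dir_sum s) conj_mx_sum; apply: eq_bigr => a _; rewrite conj_mxZ.
rewrite graded_form_sumr; apply: eq_bigr => a _.
by rewrite [X in X * _]mxE [X in _ * X]mxE [conj_mx _ _ _]mxE curve_formE [X in X * _]mxE mulr1n mulrC.
Qed.

Lemma jet_gram : exists Gz Gw Gzw, is_jet (curve_dom P X) G Gz Gw Gzw.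
Proof.
have H (ij : 'I_(\dim V) * 'I_(\dim V)) : exists t : (C -> 'M[C]_1) * (C -> 'M[C]_1) * 'M[C]_1,
    is_jet (curve_dom P X) (curve_form P X (Y ij.1) (fun s => conj_mx (Y ij.2 s))) t.1.1 t.1.2 t.2.
  have [az [aw [azw JA]]] := holo_jet (curve_dom P X) (holo_tangent_frame ij.1).
  have [bw JB] := holo_conj_jet (curve_dom P X) (holo_tangent_frame ij.2).
  have [fz [fw [fzw [J _ _]]]] := jet_curve_form HP Xn PX JA JB.
  by exists (fz, fw, fzw).
have [g gP] := boolp.choice H.
Local Transparent gram_curve.
eexists _, _, _; apply: (jet_matrix (fz := fun i j => (g (i, j)).1.1)
  (fw := fun i j => (g (i, j)).1.2) (fzw := fun i j => (g (i, j)).2)) => i j.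
exact: (gP (i, j)).
Qed.

Local Opaque gram_curve.

(** A row in the left kernel gives the coordinates of some Z in m^- with h(Z, Z) = 0. *)
Lemma gram_unit0 : G 0 \in unitmx.
Proof.
rewrite -row_free_unit -kermx_eq0; apply/eqP/row_matrixP => a; rewrite row0.
set w := row a _.
have wG : w *m G 0 = 0.
  by apply/eqP; rewrite -sub_kermx row_sub.
pose Z := \sum_i w 0 i *: e i.
have ZV : Z \in V by apply: memv_suml => i _; apply/memvZ/vbasis_mem/mem_nth; rewrite size_tuple.
have Y0 i : Y i 0 = e i.
  Local Transparent tangent_frame.
  have X0 : 0 *: X = 0 :> 'M[C]_n by rewrite scale0r.
  have N0 : - (0 *: X) = 0 :> 'M[C]_n by rewrite X0 oppr0.
  by rewrite /tangent_frame N0 X0 (exp_nilp0 R n) mul1mx dexp_nilp0.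
have P0 : (fun r : 'I_k.+1 => curve_proj P X r 0) = P.
  by apply/funext => r; apply: curve_proj0.
have G0 i j : G 0 i j = graded_form P (e i) (conj_mx (e j)).
  by rewrite gram_curveE !Y0 P0.
have ZE : hodge_metric F Z Z = (w *m G 0 *m (conj_mx w)^T) 0 0.
  rewrite (hodge_metricE _ _ HP) // -/(graded_form P Z (conj_mx Z)) /Z graded_form_suml mxE.
  transitivity (\sum_i \sum_j w 0 i * (w 0 j)^* * graded_form P (e i) (conj_mx (e j))).
    apply: eq_bigr => i _; rewrite conj_mx_sum.
    under [X in graded_form _ _ X]eq_bigr do rewrite conj_mxZ.
    by rewrite graded_form_sumr mulr_sumr; apply: eq_bigr => j _; rewrite mulrA.
  rewrite exchange_big; apply: eq_bigr => j _ /=; rewrite [(w *m _) _ _]mxE mulr_suml.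
  apply: eq_bigr => i _; rewrite [(_^T) _ _]mxE [conj_mx _ _ _]mxE G0.
  exact: mulrAC.
have Z0 : Z = 0.
  apply: contraTeq isT => Zn0; have := h_pos ZV Zn0.
  by rewrite ZE wG mul0mx mxE eqxx.
have /freeP fr := basis_free (vbasisP V).
apply/rowP => i; rewrite [RHS]mxE; apply: (fr (fun i => w 0 i)).
by rewrite -[RHS]Z0.
Qed.

(** The jet of the whole Gram matrix is only known to exist. Uniqueness of jets evaluates the two
    contractions that matter: once with the direction, which kills the first derivative, and twice,
    which gives the numerator. *)
Lemma hodge_curvE :
  hodge_curv Q F X = - \tr (lie_br X (conj_mx X) *m lie_br X (conj_mx X))
                       / \tr (X *m conj_mx X) ^+ 2.
Proof.
have Do := curve_dom_open HP Xn; have D0 := curve_dom0 P X.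
have [Gz [Gw [Gzw JG]]] := jet_gram.
(* The Chern form contains the inverse Gram matrix, so the domain is cut down to where that matrix
   is invertible. *)
pose U s := curve_dom P X s /\ G s \in unitmx.
have Uo : line_open U.
  move=> s [Us Gu] c; have [JGd _] := JG.
  apply: filterS2 (Do s Us c) (cdiff_near_unit (JGd s Us) Gu c) => t; exact: conj.
have U0 : U 0 by split=> //; apply: gram_unit0.
have JH : is_jet U (fun s => chart_gram (s *: v)) Gz Gw Gzw.
  apply: jet_congr Uo (jet_sub _ JG) _ => s; first by case.
  by case=> Us _; rewrite (chart_gram_curve Us).
have JvG := jetM D0 (jet_cst _ v) JG.
have vGz : v *m Gz 0 = 0.
  have H j : exists t : (C -> 'M[C]_1) * (C -> 'M[C]_1) * 'M[C]_1,
      is_jet (curve_dom P X) (curve_form P X (fun=> X) (fun s => conj_mx (Y j s))) t.1.1 t.1.2 t.2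
      /\ t.1.1 0 = 0.
    have [bw JB] := holo_conj_jet (curve_dom P X) (holo_tangent_frame j).
    have [fz [fw [fzw J]]] := jet_curve_form_X HP Xn PX JB.
    by exists (fz, fw, fzw).
  have [g gP] := boolp.choice H.
  have J2 := jet_matrix (p := 1) (fun i j => (gP j).1).
  have [+ _] := jet_uniq D0 Do JvG J2 (fun s _ => dir_gram s).
  rewrite mul0mx add0r => ->; apply/matrixP => i j.
  by rewrite !mxE (gP j).2 mxE.
have [fz [fw JXX]] := jet_curve_form_XX HP Xn PX.
have [_ vGv] := jet_uniq D0 Do (jetM D0 JvG (jet_cst _ (conj_mx v)^T)) JXX
  (fun s _ => dir_gram_dir s).
rewrite !mul0mx !mulmx0 !addr0 !add0r in vGv.
have Hu s : U s -> chart_gram (s *: v) \in unitmx.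
  by move=> [Us Gu]; rewrite (chart_gram_curve Us).
rewrite /hodge_curv (hol_sect_curv_jet Uo U0 JH Hu vGz).
rewrite vGv.
have -> : chart_gram (0 : 'rV[C]_(\dim V)) = G 0.
  by rewrite -(chart_gram_curve D0) scale0r.
have P0 : (fun r : 'I_k.+1 => curve_proj P X r 0) = P.
  by apply/funext => r; apply: curve_proj0.
by rewrite dir_gram_dir curve_formE P0 (graded_form_X HP PX) !mxE !mulr1n.
Qed.

End HodgeCurvature.

(** * The nilpotent norm inequality *)

Section NilpotentWeights.
Variable K : fieldType.

Definition shift_mx l : 'M[K]_l := \matrix_(i, j) (j == i.+1 :> nat)%:R.

Lemma mxrank_block_diag m n (A : 'M[K]_m) (D : 'M[K]_n) :
  \rank (block_mx A 0 0 D) = (\rank A + \rank D)%N.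
Proof.
rewrite block_mxEv -addsmxE mxrank_disjoint_sum ?rank_row_mx0 ?rank_row_0mx //.
apply/eqP; rewrite -submx0; apply/rV_subP => v.
rewrite sub_capmx => /andP[/submxP[a ->] /submxP[b]].
rewrite !mul_mx_row !mulmx0 => /eq_row_mx[-> _].
by rewrite row_mx0 sub0mx.
Qed.

Lemma expr_block_diag m n (A : 'M[K]_m) (D : 'M[K]_n) d :
  (block_mx A 0 0 D) ^+ d = block_mx (A ^+ d) 0 0 (D ^+ d).
Proof.
elim: d => [|d IH]; first by rewrite !expr0 -[RHS]scalar_mx_block.
rewrite !exprS IH -[LHS]/(block_mx A 0 0 D *m block_mx (A ^+ d) 0 0 (D ^+ d)).
by rewrite mulmx_block !mulmx0 !mul0mx !addr0 !add0r.
Qed.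

(** The shift has corank at most one, and by Sylvester's inequality coranks add at most under
    multiplication. *)
Lemma mxrank_shift_exp l d : (l.+1 - d <= \rank (shift_mx l.+1 ^+ d))%N.
Proof.
have r1 : (l <= \rank (shift_mx l.+1))%N.
  have E : shift_mx l.+1 *m (shift_mx l.+1)^T = pid_mx l.
    apply/matrixP => i j; rewrite !mxE.
    have [il|li] := ltnP i l; last first.
      rewrite andbF big1 // => a _; rewrite !mxE.
      case: eqP => [ai|_]; last by rewrite mul0r.
      by have := ltn_ord a; rewrite ai; lia.
    rewrite (bigD1 (inord i.+1)) //= !mxE inordK ?ltnS // eqxx mul1r andbT eqSS.
    rewrite big1 ?addr0 // => a ai; rewrite !mxE.
    case: eqP => [ea|_]; last by rewrite mul0r.
    by case/eqP: ai; apply: val_inj; rewrite /= inordK ?ltnS.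
  by have := mxrankM_maxl (shift_mx l.+1) (shift_mx l.+1)^T; rewrite E rank_pid_mx.
elim: d => [|d IH]; first by rewrite subn0 mxrank1.
have := mxrank_mul_min (shift_mx l.+1) (shift_mx l.+1 ^+ d).
rewrite exprS -[_ *m _]/(_ * _); lia.
Qed.

(** Splits off a Jordan block of maximal size. A nonzero entry of X^l gives a row v and a column f
    with v X^l f = 1. The rows v X^a form the chain, and the common kernel of the columns X^(l-b) f
    is an invariant complement, because the pairing of the two families is unitriangular. *)
Lemma nilp_chain n (X : 'M[K]_n) l : X ^+ l != 0 -> X ^+ l.+1 = 0 ->
  exists n' (A : 'M[K]_(l.+1, n)) (K0 : 'M[K]_(n', n)) (X' : 'M[K]_n'),
    [/\ (n = l.+1 + n')%N, row_free (col_mx A K0), A *m X = shift_mx l.+1 *m A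
      & K0 *m X = X' *m K0].
Proof.
move=> Xl XS.
have Xge m : (l < m)%N -> X ^+ m = 0.
  by move=> lm; rewrite -(subnK lm) exprD XS mulr0.
have [i [j Xij]] : exists i j, (X ^+ l) i j != 0.
  have /existsP[i /existsP[j ij]] : [exists i, exists j, (X ^+ l) i j != 0].
    apply: contraNT Xl => /existsPn H; apply/eqP/matrixP => i j.
    by rewrite mxE; apply/eqP; have /existsPn/(_ j) := H i; rewrite negbK.
  by exists i, j.
pose v : 'rV[K]_n := delta_mx 0 i.
pose f : 'cV[K]_n := ((X ^+ l) i j)^-1 *: delta_mx j 0.
have vXf : v *m X ^+ l *m f = 1%:M.
  rewrite -scalemxAr -rowE -colE; apply/matrixP => a b.
  by rewrite !ord1 !mxE mulVf.
pose A : 'M[K]_(l.+1, n) := \matrix_(a < l.+1) (v *m X ^+ a).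
pose B : 'M[K]_(n, l.+1) := \matrix_(a, b) (X ^+ (l - b) *m f) a 0.
have colB b : col b B = X ^+ (l - b) *m f.
  by apply/matrixP => a c; rewrite ord1 !mxE.
have AB a b : (A *m B) a b = (v *m X ^+ (a + (l - b)) *m f) 0 0.
  transitivity ((row a A *m col b B) 0 0); first by rewrite !mxE; apply: eq_bigr => c _; rewrite !mxE.
  by rewrite rowK colB exprD !mulmxA.
have ABu : A *m B \in unitmx.
  rewrite unitmxE -det_tr det_trig; last first.
    apply/is_trig_mxP => a b ab; rewrite mxE AB Xge ?mulmx0 ?mul0mx ?mxE //.
    by have := ltn_ord a; lia.
  rewrite big1 ?unitr1 // => a _; rewrite mxE AB subnKC -1?ltnS //.
  by rewrite vXf mxE eqxx.
have rkB : \rank B = l.+1.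
  apply/eqP; rewrite eqn_leq rank_leq_col /= -[X in (X <= _)%N](mxrank_unit ABu).
  exact: mxrankM_maxr.
have nE : (n = l.+1 + (n - l.+1))%N.
  by rewrite subnKC // -rkB; apply: rank_leq_row.
(* [X] shifts the columns of [B], hence preserves their span, and therefore the left kernel of [B]
   is stable under [X]. *)
have [N XB] : exists N, X *m B = B *m N.
  pose N : 'M[K]_l.+1 := \matrix_(b', b) (b'.+1 == b :> nat)%:R.
  have NE b' b : N b' b = (b'.+1 == b :> nat)%:R by rewrite mxE.
  exists N; apply/matrixP => a b.
  transitivity ((X *m col b B) a 0); first by rewrite !mxE; apply: eq_bigr => c _; rewrite !mxE.
  rewrite colB mulmxA -[X *m _]exprS [RHS]mxE.
  case: (posnP b) => [b0|b_gt0].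
    rewrite b0 subn0 XS mul0mx mxE big1 // => c _.
    by rewrite NE b0 mulr0.
  have bl := ltn_ord b.
  pose c0 : 'I_l.+1 := inord b.-1.
  have c0E : c0 = b.-1 :> nat by rewrite inordK //; lia.
  rewrite (bigD1 c0) //= NE c0E prednK // eqxx mulr1 big1 ?addr0 => [|c cb].
    by rewrite [RHS]mxE c0E; congr ((_ ^+ _ *m _) _ _); lia.
  rewrite NE; case: eqP => [cb'|_]; last by rewrite mulr0.
  by case/eqP: cb; apply: val_inj; rewrite /= c0E -cb'.
have rkK : \rank (kermx B) = (n - l.+1)%N by rewrite mxrank_ker rkB.
move: (row_base (kermx B)) (eq_row_base (kermx B)) (row_base_free (kermx B)).
rewrite rkK => K0 K0E K0f.
have K0B : K0 *m B = 0 by apply/sub_kermxP; rewrite K0E.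
have [X' X'E] : exists X', K0 *m X = X' *m K0.
  apply/submxP; rewrite K0E; apply/sub_kermxP.
  by rewrite -mulmxA XB mulmxA K0B mul0mx.
exists (n - l.+1)%N, A, K0, X'; split=> //.
  rewrite -kermx_eq0; apply/eqP/row_matrixP => r; rewrite row0.
  set u := row r _.
  have : u *m col_mx A K0 = 0 by apply/eqP; rewrite -sub_kermx row_sub.
  rewrite -[u]hsubmxK mul_row_col => H.
  have u1 : lsubmx u = 0.
    have := congr1 (mulmx^~ B) H; rewrite /= mulmxDl -mulmxA -[X in _ + X]mulmxA K0B mulmx0 addr0 mul0mx.
    by move/(congr1 (mulmx^~ (invmx (A *m B)))); rewrite /= mulmxK // mul0mx.
  move: H; rewrite u1 mul0mx add0r => H.
  have -> : rsubmx u = 0.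
    apply/eqP; rewrite -(mulmx_free_eq0 _ K0f); exact/eqP.
  by rewrite row_mx0.
apply/row_matrixP => a; rewrite !row_mul rowK -mulmxA -[X ^+ a *m X]exprSr.
have [al|la] := ltnP a l.
  have -> : row a (shift_mx l.+1) = delta_mx 0 (inord a.+1).
    apply/rowP => c; rewrite !mxE eqxx /= -(inj_eq val_inj) /= inordK //.
  by rewrite -rowE rowK inordK.
have -> : row a (shift_mx l.+1) = 0.
  by apply/rowP => c; rewrite !mxE; case: eqP => // ca; have := ltn_ord c; lia.
by rewrite mul0mx Xge ?mulmx0.
Qed.

(** The d-th power of a Jordan block of size l + 1 has rank l + 1 - d, so a single chain attains the
    bound of [nilp_weights]. *)
Lemma sum_sqr_chain_weights l :
  \sum_(i < l.+1) (l%:Z - 2 * i%:Z) ^+ 2 = (2 * \sum_(d < l.+1) (d * (l.+1 - d)))%N%:Z.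
Proof.
(* In both closed forms the parameter inside the summand is freed from the number of terms;
   otherwise every summand would change in the induction step. *)
have e1 (N : nat) (a : int) : 3 * (\sum_(i < N) (a - 2 * i%:Z) ^+ 2)
   = 3 * N%:Z * a ^+ 2 - 6 * a * N%:Z * (N%:Z - 1) + 2 * (N%:Z - 1) * N%:Z * (2 * N%:Z - 1).
  elim: N => [|N IH]; first by rewrite big_ord0; ring.
  rewrite big_ord_recr /= mulrDr IH -natr1; ring.
have e2 (N M : nat) : (N <= M)%N -> 6 * ((\sum_(d < N) (d * (M - d)))%N%:Z)
   = 3 * M%:Z * N%:Z * (N%:Z - 1) - (N%:Z - 1) * N%:Z * (2 * N%:Z - 1).
  elim: N => [|N IH] NM; first by rewrite big_ord0; ring.
  rewrite big_ord_recr /= PoszD mulrDr IH ?(ltnW NM) // PoszM -subzn ?(ltnW NM) // -natr1; ring.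
have i3 : injective (fun x : int => 3 * x) by apply: mulfI.
apply: i3; rewrite /= e1 PoszM mulrA (_ : 3 * 2%:Z = 6) // e2 // -natr1; ring.
Qed.

(* The weights come from an sl2-triple through X: a Jordan chain of length l   *)
(* gets the weights l - 1, l - 3, ..., 1 - l.                                  *)
Lemma nilp_weights n (X : 'M[K]_n) m : X ^+ m = 0 ->
  exists (B N : 'M[K]_n) (w : 'I_n -> int), [/\ B \in unitmx, B *m X = N *m B,
    forall i j, N i j != 0 -> w j = w i - 2 &
    \sum_i w i ^+ 2 <= (2 * \sum_(d < m) (d * \rank (X ^+ d)))%N%:Z].
Proof.
elim/ltn_ind: n X => n IH X Xm.
case: (posnP n) => [n0|n_gt0].
  exists 1%:M, X, (fun=> 0); split; first exact: unitmx1.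
    by rewrite mul1mx mulmx1.
    by case=> i lin; exfalso; rewrite n0 in lin.
  by rewrite big1 // => i _; rewrite expr0n.
have X0 : X ^+ 0 != 0.
  apply/eqP => /matrixP/(_ (Ordinal n_gt0) (Ordinal n_gt0)).
  by rewrite expr0 !mxE eqxx => /eqP; rewrite oner_eq0.
have [l Xl XS] : exists2 l, X ^+ l != 0 & X ^+ l.+1 = 0.
  have ex : exists l, X ^+ l == 0 by exists m; apply/eqP.
  case: (ex_minnP ex) => -[|l] /eqP Xl lmin; first by rewrite Xl eqxx in X0.
  exists l => //; apply/negP => /lmin; by rewrite ltnn.
have lm : (l < m)%N.
  rewrite ltnNge; apply: contraNN Xl => ml.
  by rewrite -(subnK ml) exprD Xm mulr0.
have [n' [A [K0 [X' [nE fr AX KX]]]]] := nilp_chain Xl XS.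
subst n; set P := col_mx A K0 in fr.
have Pu : P \in unitmx by rewrite -row_free_unit.
have PX : P *m X = block_mx (shift_mx l.+1) 0 0 X' *m P.
  by rewrite mul_col_mx AX KX mul_block_col !mul0mx addr0 add0r.
have PXd d : P *m X ^+ d = block_mx (shift_mx l.+1 ^+ d) 0 0 (X' ^+ d) *m P.
  rewrite -expr_block_diag; elim: d => [|d IHd]; first by rewrite !expr0 mulmx1 mul1mx.
  by rewrite exprSr [P *m _]mulmxA IHd -mulmxA PX mulmxA -[_ *m block_mx _ _ _ _]exprSr.
have X'm : X' ^+ m = 0.
  have := PXd m; rewrite Xm mulmx0 => /(congr1 (mulmx^~ (invmx P))).
  rewrite /= mulmxK // mul0mx -[X in X = _ -> _](block_mx0 _ l.+1 n' l.+1 n').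
  by move/eq_block_mx => [_ _ _ <-].
have n'lt : (n' < l.+1 + n')%N by rewrite addSn ltnS leq_addl.
have [B' [N' [w' [B'u BN' w'P w'S]]]] := IH n' n'lt X' X'm.
exists (block_mx 1%:M 0 0 B' *m P), (block_mx (shift_mx l.+1) 0 0 N').
exists (fun i => match fintype.split i with inl a => l%:Z - 2 * a%:Z | inr b => w' b end).
have Bu : block_mx (1%:M : 'M_l.+1) 0 0 B' \in unitmx by rewrite block_diag_mx_unit unitmx1.
split.
- by rewrite unitmx_mul Bu Pu.
- rewrite -mulmxA PX !mulmxA; congr (_ *m _); rewrite !mulmx_block.
  by rewrite !mulmx0 !mul0mx !addr0 !add0r mul1mx mulmx1 BN'.
- move=> i j.
  case: (split_ordP i) => a ->; case: (split_ordP j) => b ->.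
  + rewrite block_mxEul mxE.
    case: (eqVneq (b : nat) a.+1) => [ba _|_]; last by rewrite eqxx.
    by rewrite ba; lia.
  + by rewrite block_mxEur mxE eqxx.
  + by rewrite block_mxEdl mxE eqxx.
  by rewrite block_mxEdr; apply: w'P.
rewrite big_split_ord /=.
under eq_bigr do rewrite (unsplitK (inl _)).
under [X in _ + X <= _]eq_bigr do rewrite (unsplitK (inr _)).
rewrite sum_sqr_chain_weights.
have rk d : \rank (X ^+ d) = (\rank (shift_mx l.+1 ^+ d) + \rank (X' ^+ d))%N.
  have := mxrankMfree (block_mx (shift_mx l.+1 ^+ d) 0 0 (X' ^+ d)) fr.
  by rewrite -PXd mxrank_block_diag => <-; rewrite eqmxMfull // row_full_unit.
have -> : (\sum_(d < m) d * \rank (X ^+ d) =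
    \sum_(d < m) d * \rank (shift_mx l.+1 ^+ d) + \sum_(d < m) d * \rank (X' ^+ d))%N.
  by rewrite -big_split; apply: eq_bigr => d _; rewrite rk mulnDr.
rewrite mulnDr PoszD lerD // lez_nat leq_mul2l /=.
rewrite (big_ord_widen _ (fun d => d * (l.+1 - d))%N lm) big_mkcond /=.
apply: leq_sum => d _; case: ifP => // _.
by rewrite leq_mul2l mxrank_shift_exp orbT.
Qed.

End NilpotentWeights.

(** * Triangular factors of positive definite matrices *)

Section Cholesky.
Variable R : realType.
Local Notation C := R[i].

Definition adj_mx m n (A : 'M[C]_(m, n)) : 'M[C]_(n, m) := (conj_mx A)^T.

Lemma adj_mxM m n p (A : 'M[C]_(m, n)) (B : 'M[C]_(n, p)) :
  adj_mx (A *m B) = adj_mx B *m adj_mx A.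
Proof. by rewrite /adj_mx conj_mxM trmx_mul. Qed.

Lemma adj_mxK m n (A : 'M[C]_(m, n)) : adj_mx (adj_mx A) = A.
Proof. by rewrite /adj_mx /conj_mx map_trmx trmxK -/(conj_mx _) -/(conj_mx _) conj_mxK. Qed.

Lemma adj_mxE m n (A : 'M[C]_(m, n)) i j : adj_mx A i j = (A j i)^*.
Proof. by rewrite !mxE. Qed.

Lemma adj_block m1 m2 n1 n2 (A : 'M[C]_(m1, n1)) (B : 'M[C]_(m1, n2)) D E :
  adj_mx (block_mx A B D E : 'M_(m1 + m2, _)) = block_mx (adj_mx A) (adj_mx D) (adj_mx B) (adj_mx E).
Proof. by rewrite /adj_mx /conj_mx map_block_mx tr_block_mx. Qed.

Lemma adj_row m n1 n2 (A : 'M[C]_(m, n1)) (B : 'M[C]_(m, n2)) :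
  adj_mx (row_mx A B) = col_mx (adj_mx A) (adj_mx B).
Proof. by rewrite /adj_mx /conj_mx map_row_mx tr_row_mx. Qed.

Lemma conj_mxZ_real m n (c : C) (A : 'M[C]_(m, n)) : c^* = c ->
  conj_mx (c *: A) = c *: conj_mx A.
Proof. by move=> cJ; apply/matrixP => i j; rewrite !mxE rmorphM /= cJ. Qed.

Lemma adj_mxZ_real m n (c : C) (A : 'M[C]_(m, n)) : c^* = c ->
  adj_mx (c *: A) = c *: adj_mx A.
Proof. by move=> cJ; rewrite /adj_mx conj_mxZ_real // linearZ. Qed.

Definition posdef_mx n (G : 'M[C]_n) : Prop :=
  adj_mx G = G /\ forall u : 'rV[C]_n, u != 0 -> 0 < (u *m G *m adj_mx u) 0 0.

(** Induction through the Schur complement [S] of the corner entry: [S] is the form on vectors (t,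
    w) with t chosen to complete the square, hence positive definite. The triangular shape serves
    the ordering by weights, and the reality clause serves the frames exchanged by conjugation. *)
Lemma cholesky n (G : 'M[C]_n) : posdef_mx G ->
  exists E : 'M[C]_n, [/\ forall i j : 'I_n, (i < j)%N -> E i j = 0,
    E *m G *m adj_mx E = 1%:M & conj_mx G = G -> conj_mx E = E].
Proof.
elim: n G => [|n IH] G.
  by exists 1%:M; split=> [[]//||_]; apply/matrixP => -[].
move: G; rewrite -[n.+1]/(1 + n)%N => G [Gh Gp].
pose a := ulsubmx G 0 0; pose y : 'rV[C]_n := ursubmx G.
pose G' := drsubmx G.
have GE : G = block_mx a%:M y (adj_mx y) G'.
  rewrite -[LHS]submxK; congr block_mx.
    by apply/matrixP => i j; rewrite !ord1 [RHS]mxE mulr1n.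
  rewrite -{1}Gh; apply/matrixP => i j; rewrite !mxE.
  by congr (conjc (G _ _)); apply: val_inj.
have aE (u : 'M[C]_1) : (u *m a%:M *m adj_mx u) 0 0 = u 0 0 * a * (u 0 0)^*.
  by rewrite -scalemx1 -scalemxAr mulmx1 !mxE big_ord1 !mxE [a * _]mulrC.
have a_gt0 : 0 < a.
  have := Gp (row_mx (1%:M : 'M_1) 0); rewrite GE adj_row mul_row_block !mul0mx !addr0.
  rewrite mul_row_col mul1mx /adj_mx /conj_mx map_mx0 trmx0 mulmx0 addr0 map_mx1 trmx1 mulmx1.
  rewrite mxE mulr1n; apply.
  apply/eqP => /matrixP/(_ 0 0); rewrite !mxE; case: splitP => // j _; rewrite !mxE ord1.
  by move/eqP; rewrite oner_eq0.
have aR : a = (complex.Re a)%:C by rewrite RRe_real // ger0_real // ltW.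
have aJ : a^* = a by rewrite {1}aR conjc_real -aR.
have a0 : a != 0 by rewrite gt_eqF.
pose e : C := ((Num.sqrt (complex.Re a))^-1)%:C.
have eJ : e^* = e by rewrite conjc_real.
have e2 : e * a * e = 1.
  rewrite mulrAC -expr2 /e [((_)^-1)%:C]fmorphV /= exprVn -rmorphXn /= sqr_sqrtr; last first.
    by rewrite -lecR -aR ltW.
  by rewrite -aR mulVf.
have [ai [aiJ naiJ aai]] : exists ai : C, [/\ ai^* = ai, (- ai)^* = - ai & a * ai = 1].
  exists a^-1; have aiJ : (a^-1)^* = a^-1 by rewrite conjc_inv aJ.
  by split=> //; [rewrite rmorphN /= aiJ|rewrite mulfV].
pose S := G' - ai *: (adj_mx y *m y).
have adjB m p (M N : 'M[C]_(m, p)) : adj_mx (M - N) = adj_mx M - adj_mx N.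
  by apply/matrixP => i j; rewrite !mxE rmorphB.
have G'h : adj_mx G' = G'.
  by have := Gh; rewrite GE adj_block => /eq_block_mx[].
have Sp : posdef_mx S.
  split; first by rewrite adjB (adj_mxZ_real _ aiJ) adj_mxM adj_mxK G'h.
  move=> w w0; pose t := - (ai *: (w *m adj_mx y)).
  have := Gp (row_mx t w); rewrite GE adj_row mul_row_block mul_row_col.
  have -> : t *m a%:M + w *m adj_mx y = 0.
    by rewrite mul_mx_scalar scalerN scalerA aai scale1r addNr.
  rewrite mul0mx add0r /S mulmxBr mulNmx -scalemxAl -mulmxA -scalemxAr addrC; apply.
  apply: contraNneq w0 => /(congr1 (@rsubmx _ 1 1 n)); rewrite row_mxKr => ->.
  by rewrite linear0.
have [E' [E'l E'S E'c]] := IH S Sp.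
exists (block_mx e%:M 0 (- (ai *: (E' *m adj_mx y))) E' : 'M_(1 + n)); split.
- move=> i j ij.
  case: (splitP (i : 'I_(1 + n))) => i' iE; case: (splitP (j : 'I_(1 + n))) => j' jE.
  + by move: ij; rewrite iE jE !ord1.
  + have -> : i = lshift n i' by apply: val_inj.
    have -> : j = rshift 1 j' by apply: val_inj.
    by rewrite block_mxEur mxE.
  + by move: ij; rewrite iE jE ord1.
  have -> : i = rshift 1 i' by apply: val_inj.
  have -> : j = rshift 1 j' by apply: val_inj.
  by rewrite block_mxEdr E'l //; move: ij; rewrite iE jE ltn_add2l.
- rewrite GE adj_block mulmx_block !mul0mx !addr0.
  rewrite mulmx_block.
  have e1 : - (ai *: (E' *m adj_mx y)) *m a%:M + E' *m adj_mx y = 0.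
    by rewrite mul_mx_scalar scalerN scalerA aai scale1r addNr.
  have e3 : - (ai *: (E' *m adj_mx y)) *m y + E' *m G' = E' *m S.
    by rewrite /S mulmxBr mulNmx -scalemxAl -mulmxA -scalemxAr addrC.
  rewrite e1 e3 !mul0mx !add0r E'S.
  have eA : adj_mx (e%:M : 'M_1) = e%:M.
    by apply/matrixP => i j; rewrite !ord1 !mxE !mulr1n eJ.
  have z1 : adj_mx (0 : 'M[C]_(1, n)) = 0 by rewrite /adj_mx /conj_mx map_mx0 trmx0.
  rewrite z1 !mulmx0 !addr0 eA -!scalar_mxM e2.
  have -> : (e * a)%:M *m adj_mx (- (ai *: (E' *m adj_mx y))) + e%:M *m y *m adj_mx E' = 0.
    rewrite -[in adj_mx _]scaleNr (adj_mxZ_real _ naiJ) adj_mxM adj_mxK !mul_scalar_mx scalerA.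
    by rewrite mulrN -mulrA aai mulr1 scaleNr -scalemxAl addNr.
  by rewrite -scalar_mx_block.
move=> Gc.
have yc : conj_mx y = y by rewrite /y /conj_mx map_ursubmx -/(conj_mx _) Gc.
have G'c : conj_mx G' = G' by rewrite /G' /conj_mx map_drsubmx -/(conj_mx _) Gc.
have ayc : conj_mx (adj_mx y) = adj_mx y by rewrite /adj_mx yc {1}/conj_mx -map_trmx -/(conj_mx y) yc.
have Sc : conj_mx S = S.
  by rewrite conj_mxB (conj_mxZ_real _ aiJ) conj_mxM ayc yc G'c.
have E'r := E'c Sc.
rewrite {1}/conj_mx map_block_mx -/(conj_mx E') E'r map_mx0; congr block_mx.
  by apply/matrixP => i j; rewrite !ord1 !mxE !mulr1n eJ.
by rewrite -/(conj_mx _) -scaleNr (conj_mxZ_real _ naiJ) conj_mxM E'r ayc.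
Qed.

End Cholesky.

Lemma sorting_perm n (w : 'I_n -> int) :
  exists s : {perm 'I_n}, forall i j : 'I_n, (i <= j)%N -> w (s i) <= w (s j).
Proof.
pose leT i j := w i <= w j.
have /tuple_permP[s sE] : perm_eq (sort leT (ord_tuple n)) (ord_tuple n) by rewrite perm_sort.
have srt : sorted leT (sort leT (ord_tuple n)).
  by apply: sort_sorted => i j; apply: le_total.
have tr : transitive leT by move=> j i l; apply: le_trans.
exists s => i j; rewrite leq_eqVlt => /predU1P[/val_inj -> //|ij].
have nthE (a : 'I_n) : nth i (sort leT (ord_tuple n)) a = s a.
  by rewrite sE (nth_map a) ?size_enum_ord // nth_ord_enum tnth_ord_tuple.
have := sorted_ltn_nth tr i srt; rewrite size_sort size_tuple.
by move=> /(_ i j (ltn_ord i) (ltn_ord j) ij); rewrite !nthE.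
Qed.

(** * From weights to the norm inequality *)

Section NilpotentInequality.
Variable R : realType.
Local Notation C := R[i].

(** Lagrange's identity: the difference of the two sides is half the sum of the squares (a_i b_j -
    a_j b_i)^2, which are nonnegative because the entries are real. *)
Lemma cauchy_schwarz_real n (a b : 'I_n -> C) :
  (forall i, a i \is Num.real) -> (forall i, b i \is Num.real) ->
  (\sum_i a i * b i) ^+ 2 <= (\sum_i a i ^+ 2) * (\sum_i b i ^+ 2).
Proof.
move=> ar br; rewrite -subr_ge0.
have -> : (\sum_i a i ^+ 2) * (\sum_i b i ^+ 2) - (\sum_i a i * b i) ^+ 2 =
   2^-1 * \sum_i \sum_j (a i * b j - a j * b i) ^+ 2.
  have -> : \sum_i \sum_j (a i * b j - a j * b i) ^+ 2 =
     (\sum_i \sum_j a i ^+ 2 * b j ^+ 2 + \sum_i \sum_j b i ^+ 2 * a j ^+ 2)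
       - 2 * \sum_i \sum_j (a i * b i) * (a j * b j).
    rewrite mulr_sumr -big_split -sumrB; apply: eq_bigr => i _.
    rewrite mulr_sumr -big_split -sumrB; apply: eq_bigr => j _ /=; ring.
  rewrite -!big_distrlr /=.
  move: (\sum_i a i ^+ 2) (\sum_i b i ^+ 2) (\sum_i a i * b i) => x y z.
  have -> : x * y + y * x - 2 * (z * z) = 2 * (x * y - z ^+ 2) by ring.
  by rewrite mulKf // pnatr_eq0.
rewrite mulr_ge0 ?invr_ge0 ?ler0n // sumr_ge0 // => i _; rewrite sumr_ge0 // => j _.
by apply: real_exprn_even_ge0 => //; rewrite rpredB ?rpredM.
Qed.

Lemma mul_conj_ge0 (z : C) : 0 <= z * z^*.
Proof. exact: mulcJ_ge0. Qed.

(** The Jordan basis is sorted by increasing weight before it is orthogonalized. The triangular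
    factor [E] then adds to each vector only vectors of no larger weight, which turns the equality w
    j = w i - 2 into an inequality. *)
Lemma unitary_weights n (X : 'M[C]_n) m : X ^+ m = 0 ->
  exists (U Y : 'M[C]_n) (w : 'I_n -> int),
   [/\ U *m adj_mx U = 1%:M, U *m X = Y *m U,
      forall i j, Y i j != 0 -> w j <= w i - 2 &
      \sum_i w i ^+ 2 <= (2 * \sum_(d < m) (d * \rank (X ^+ d)))%N%:Z].
Proof.
move=> /nilp_weights[B0 [N0 [w0 [B0u BN0 w0P w0S]]]].
have [s sP] := sorting_perm w0.
pose w i := w0 (s i); pose B := row_perm s B0; pose N := row_perm s (col_perm s N0).
have Bu : B \in unitmx by rewrite /B row_permE unitmx_mul unitmx_perm.
have BN : B *m X = N *m B.
  rewrite /B /N col_permE !row_permE -!mulmxA BN0; congr (_ *m (_ *m _)).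
  by rewrite mulmxA -perm_mxM mulVg perm_mx1 mul1mx.
have wP i j : N i j != 0 -> w j = w i - 2.
  by rewrite !mxE => /w0P.
have wS : \sum_i w i ^+ 2 = \sum_i w0 i ^+ 2.
  by rewrite [RHS](reindex_inj (@perm_inj _ s)).
have Gp : posdef_mx (B *m adj_mx B).
  split; first by rewrite adj_mxM adj_mxK.
  move=> u u0; rewrite mulmxA -mulmxA -adj_mxM.
  have : u *m B != 0 by apply: contraNneq u0 => h; rewrite -[u](mulmxK Bu) h mul0mx.
  move: (u *m B) => z /rV0Pn[j zj]; rewrite mxE (bigD1 j) //= ltr_wpDr //.
    by apply: sumr_ge0 => i _; rewrite adj_mxE mul_conj_ge0.
  by rewrite adj_mxE lt_def mul_conj_ge0 mulf_neq0 // conjc_eq0.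
have [E [El EG _]] := cholesky Gp.
have UU : (E *m B) *m adj_mx (E *m B) = 1%:M by rewrite adj_mxM !mulmxA in EG *.
have Eu : E \in unitmx by have := mulmx1_unit EG; rewrite unitmx_mul => -[/andP[]].
have Ejj j : E j j != 0.
  move: Eu; rewrite unitmxE det_trig; last by apply/is_trig_mxP => a b; apply: El.
  by rewrite unitfE => /prodf_neq0; apply.
have [Y YE] : exists Y, Y *m E = E *m N by exists (E *m N *m invmx E); rewrite mulmxKV.
exists (E *m B), Y, w; split=> //; last by rewrite wS.
  by rewrite -mulmxA BN !mulmxA -YE.

(* Descending induction on the column [j]. In entry (i, j) of Y E = E N the terms after [j] vanish
   by induction and those before [j] by triangularity, so only Y_ij E_jj is left. On the right a
   nonzero term would need some a <= i with w j = w a - 2 <= w i - 2. *)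
move=> i j; apply: contraNT; rewrite -ltNge => wij.
have [b] := ubnP (n - j)%N; elim: b j wij => // b IHb j wij jb.
have wmon (a c : 'I_n) : (a <= c)%N -> w a <= w c by apply: sP.
have := congr1 (fun M : 'M_n => M i j) YE; rewrite !mxE (bigD1 j) //=.
rewrite [X in _ + X]big1 ?addr0; last first.
  move=> c cj; have [jc|cj'|jc] := ltngtP (j : nat) c.
  - rewrite (eqP (IHb c _ _)) ?mul0r //; first by apply: lt_le_trans wij _; apply: wmon; apply: ltnW.
    have := ltn_ord c; lia.
  - by rewrite El ?mulr0.
  by case/eqP: cj; apply: val_inj; apply: esym.
rewrite big1 => [/eqP|a _]; first by rewrite mulf_eq0 (negPf (Ejj j)) orbF.
have [ia|ai] := ltnP i a; first by rewrite El // mul0r.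
have [->|/wP wj] := eqVneq (N a j) 0; first by rewrite mulr0.
by have := wmon _ _ ai; move: wij; rewrite wj; lia.
Qed.

Definition self_comm n (X : 'M[C]_n) : 'M[C]_n := X *m adj_mx X - adj_mx X *m X.

Lemma self_comm_trace_ineq n (Y : 'M[C]_n) (w : 'I_n -> int) (c : nat) :
  (forall i j, Y i j != 0 -> w j <= w i - 2) -> \sum_i w i ^+ 2 <= (2 * c)%N%:Z ->
  2 * \tr (Y *m adj_mx Y) ^+ 2 <= \tr (self_comm Y *m self_comm Y) * c%:R.
Proof.
move=> Yw wS; set T := \tr _; set A := self_comm Y.
pose S (i j : 'I_n) : C := Y i j * (Y i j)^*.
have S0 i j : 0 <= S i j by apply: mul_conj_ge0.
have TE : T = \sum_i \sum_j S i j.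
  apply: eq_bigr => i _; rewrite mxE; apply: eq_bigr => j _; by rewrite adj_mxE.
have T0 : 0 <= T by rewrite TE sumr_ge0 // => i _; rewrite sumr_ge0.
have AE i : A i i = \sum_j S i j - \sum_j S j i.
  rewrite !mxE; congr (_ - _); apply: eq_bigr => j _; first by rewrite adj_mxE.
  by rewrite adj_mxE mulrC.
have Ar i : A i i \is Num.real.
  by rewrite AE rpredB // ger0_real // sumr_ge0.
pose wc i : C := (w i)%:~R.
have wr i : wc i \is Num.real by apply: realz.
have h1 : 2 * T <= \sum_i A i i * wc i.
  have -> : \sum_i A i i * wc i = \sum_i \sum_j S i j * (wc i - wc j).
    transitivity (\sum_i \sum_j S i j * wc i - \sum_i \sum_j S i j * wc j).
      rewrite [X in _ = _ - X]exchange_big -sumrB; apply: eq_bigr => i _ /=.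
      by rewrite AE mulrBl !mulr_suml.
    rewrite -sumrB; apply: eq_bigr => i _; rewrite -sumrB; apply: eq_bigr => j _.
    by rewrite mulrBr.
  rewrite TE mulr_sumr ler_sum // => i _; rewrite mulr_sumr ler_sum // => j _.
  rewrite mulrC; have [Y0|Y0] := eqVneq (Y i j) 0; first by rewrite /S Y0 !mul0r.
  apply: ler_wpM2l => //; rewrite /wc -rmorphB /= -[2]/(2%:~R) ler_int.
  by have := Yw i j Y0; lia.
have h2 : (\sum_i A i i * wc i) ^+ 2 <= (\sum_i A i i ^+ 2) * (\sum_i wc i ^+ 2).
  exact: cauchy_schwarz_real.
have h3 : \sum_i A i i ^+ 2 <= \tr (A *m A).
  have Ah i j : A j i = (A i j)^*.
    have Aadj : adj_mx A = A.
      rewrite /A /self_comm {1}/adj_mx conj_mxB linearB /= -/(adj_mx _) -/(adj_mx _).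
      by rewrite !adj_mxM adj_mxK.
    by rewrite -{1}Aadj adj_mxE.
  apply: ler_sum => i _; rewrite [X in _ <= X]mxE (bigD1 i) //= -expr2 lerDl sumr_ge0 // => j _.
  by rewrite (Ah i j) mul_conj_ge0.
have h4 : \sum_i wc i ^+ 2 <= (2 * c)%N%:R.
  rewrite (eq_bigr (fun i => ((w i) ^+ 2)%:~R)) => [|i _]; last by rewrite rmorphXn.
  by rewrite -rmorph_sum /= -[(2 * c)%N%:R]/(((2 * c)%N%:Z)%:~R) ler_int.
have A0 : 0 <= \sum_i A i i ^+ 2.
  by rewrite sumr_ge0 // => i _; apply: real_exprn_even_ge0.
have w0 : 0 <= \sum_i wc i ^+ 2.
  by rewrite sumr_ge0 // => i _; apply: real_exprn_even_ge0.
have : (2 * T) ^+ 2 <= \tr (A *m A) * (2 * c)%N%:R.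
  apply: le_trans (_ : (\sum_i A i i * wc i) ^+ 2 <= _).
    rewrite ler_pXn2r // ?nnegrE; first by rewrite mulr_ge0.
    by apply: le_trans h1; rewrite mulr_ge0.
  by apply: le_trans h2 _; apply: ler_pM.
have -> : (2 * T) ^+ 2 = 2 * (2 * T ^+ 2) by ring.
by rewrite natrM [X in _ <= X]mulrCA ler_pM2l ?ltr0n.
Qed.

Lemma nilp_norm_ineq n (X : 'M[C]_n) m : X ^+ m = 0 ->
  2 * \tr (X *m adj_mx X) ^+ 2
    <= \tr (self_comm X *m self_comm X) * (\sum_(d < m) (d * \rank (X ^+ d)))%N%:R.
Proof.
move=> /unitary_weights[U [Y [w [UU UX Yw wS]]]].
have U'U : adj_mx U *m U = 1%:M by apply: mulmx1C.
have XE : X = adj_mx U *m Y *m U by rewrite -mulmxA -UX mulmxA U'U mul1mx.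
have XadE : adj_mx X = adj_mx U *m adj_mx Y *m U by rewrite XE !adj_mxM adj_mxK mulmxA.
have conjM (A B : 'M[C]_n) : (adj_mx U *m A *m U) *m (adj_mx U *m B *m U) = adj_mx U *m (A *m B) *m U.
  by rewrite !mulmxA -(mulmxA _ U) UU mulmx1.
have trU (A : 'M[C]_n) : \tr (adj_mx U *m A *m U) = \tr A.
  by rewrite mxtrace_mulC mulmxA UU mul1mx.
have cE : self_comm X = adj_mx U *m self_comm Y *m U.
  by rewrite /self_comm XadE [in LHS]XE !conjM mulmxBr mulmxBl.
rewrite cE conjM trU XadE {1}XE conjM trU.
exact: self_comm_trace_ineq Yw wS.
Qed.

End NilpotentInequality.

(** * Runs and segments *)

Section Segments.
Local Open Scope nat_scope.

Section Runs.

(** Vacuously true for q < p, which is harmless in the weighted sums, where the truncated difference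
    q - p is then 0. *)
Definition seg (T : pred nat) (p q : nat) : bool := all T (index_iota p q.+1).

Lemma segP (T : pred nat) p q : reflect (forall z, p <= z <= q -> T z) (seg T p q).
Proof.
apply: (iffP allP) => H z.
  by move=> zpq; apply: H; rewrite mem_index_iota ltnS.
by rewrite mem_index_iota ltnS; apply: H.
Qed.

Lemma max_runP (T : pred nat) a b : reflect
  [/\ a < b, forall z, a <= z < b -> T z, a = 0 \/ ~~ T a.-1 & ~~ T b] (max_run T a b).
Proof.
apply: (iffP and4P) => -[ab aT a0 b0]; split=> //.
- by move=> z zab; apply: (allP aT); rewrite mem_index_iota.
- by case/orP: a0 => [/eqP|]; [left|right].
- by apply/allP => z; rewrite mem_index_iota; apply: aT.
- by case: a0 => [->|->]; rewrite ?orbT.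
Qed.

Lemma max_run_uniq (T : pred nat) a b a' b' p :
  max_run T a b -> max_run T a' b' -> a <= p < b -> a' <= p < b' -> a = a' /\ b = b'.
Proof.
have key c d c' d' : max_run T c d -> max_run T c' d' -> c <= p < d -> c' <= p < d' ->
    c' <= c /\ d <= d'.
  move=> /max_runP[cd cT c0 dT] /max_runP[cd' cT' c0' dT'] cp cp'; split.
    rewrite leqNgt; apply/negP => cc'; case: c0' => [e|/negP]; first by rewrite e in cc'.
    by apply; apply: cT; lia.
  rewrite leqNgt; apply/negP => dd'; move/negP: dT'; apply; apply: cT; lia.
move=> h h' ap ap'; have [] := key _ _ _ _ h h' ap ap'; have [] := key _ _ _ _ h' h ap' ap.
lia.
Qed.

(** The run starts at the least a with [a, q] inside [T] and stops at the least b > q outside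
    [T]. *)
Lemma max_run_exists (T : pred nat) N p q : (forall z, N <= z -> ~~ T z) ->
  p <= q -> seg T p q -> exists a b, [/\ max_run T a b, a <= p, q < b & b <= N].
Proof.
move=> TN pq /segP pqT.
have exa : exists a, seg T a q by exists p; apply/segP.
have exb : exists b, (q < b) && ~~ T b.
  by exists (maxn q.+1 N); rewrite leq_max leqnn /= TN // leq_maxr.
case: (ex_minnP exa) => a /segP aT amin.
case: (ex_minnP exb) => b /andP[qb bT] bmin.
have qN : q < N.
  rewrite ltnNge; apply/negP => Nq; have := TN q Nq.
  by rewrite (pqT q) // pq leqnn.
have ap : a <= p by apply: amin; apply/segP.
exists a, b; split=> //; last first.
  by apply: bmin; rewrite qN TN.
apply/max_runP; split=> //; first by lia.
  move=> z /andP[az zb]; have [zq|qz] := leqP z q; first by apply: aT; rewrite az.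
  by apply/negPn/negP => Tz; have := bmin z; rewrite qz Tz => /(_ isT); rewrite leqNgt zb.
case: (posnP a) => [|a0]; [by left|right].
apply/negP => Ta; have : seg T a.-1 q.
  apply/segP => z /andP[az zq]; have [<-|za] := eqVneq a.-1 z; first by [].
  by apply: aT; lia.
by move/amin; lia.
Qed.

Definition gap_sum (N : nat) : nat := \sum_(p < N) \sum_(q < N) (q - p).

Lemma gap_sumE N : 6 * gap_sum N = N * (N ^ 2 - 1).
Proof.
have tri m : 2 * (\sum_(p < m) (m - p)) = m * m.+1.
  elim: m => [|m IH]; first by rewrite big_ord0.
  rewrite big_ord_recl subn0 mulnDr.
  under eq_bigr do rewrite lift0 subSS.
  rewrite IH; lia.
elim: N => [|N IH]; first by rewrite /gap_sum big_ord0.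
rewrite /gap_sum big_ord_recr /= big_ord_recr /= subnn addn0.
rewrite [X in _ + X]big1 => [|i _]; last by apply/eqP; rewrite subn_eq0; apply: ltnW.
under eq_bigr do rewrite big_ord_recr.
rewrite big_split /= -/(gap_sum N) addn0 mulnDr IH.
have := tri N; move: (\sum_(p < N) (N - p)) => t tE.
have -> : 6 * t = 3 * (N * N.+1) by lia.
case: N {IH tE} => [|N] //.
have -> : N.+1 ^ 2 - 1 = N * (N + 2) by rewrite expnS expn1; nia.
have -> : N.+2 ^ 2 - 1 = N.+1 * N.+3 by rewrite expnS expn1; nia.
nia.
Qed.

Lemma sum_interval (F : nat -> nat) a b N : a <= b -> b <= N ->
  \sum_(p < N) (if a <= p < b then F p else 0) = \sum_(p < b - a) F (p + a).
Proof.
move=> ab bN.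
rewrite -(big_mkord xpredT (fun p => if a <= p < b then F p else 0)).
rewrite (big_cat_nat (leq0n a) (leq_trans ab bN)) /= (big_cat_nat ab bN) /=.
rewrite [X in X + _]big_nat_cond big1 ?add0n; last first.
  by move=> i /andP[/andP[_ ia] _]; rewrite leqNgt ia.
rewrite [X in _ + X]big_nat_cond [X in _ + X]big1 ?addn0; last first.
  by move=> i /andP[/andP[bi _] _]; rewrite [i < b]ltnNge bi andbF.
rewrite -[X in index_iota X b]add0n big_addn big_mkord; apply: eq_bigr => i _.
by rewrite leq_addl (_ : i + a < b) //; have := ltn_ord i; lia.
Qed.

Lemma gap_sum_run a b N : b <= N -> gap_sum (b - a) =
  \sum_(p < N) \sum_(q < N) (if (a <= p < b) && (a <= q < b) then q - p else 0).
Proof.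
move=> bN; have [ab|ba] := leqP a b; last first.
  rewrite (eqnP (ltnW ba)) /gap_sum big_ord0; apply: esym.
  by rewrite big1 // => p _; rewrite big1 // => q _; case: ifP => //; lia.
have red F := sum_interval F ab bN.
transitivity (\sum_(p < N) (if a <= p < b then
    \sum_(q < N) (if a <= q < b then q - p else 0) else 0)).
  rewrite (red (fun p => \sum_(q < N) (if a <= q < b then q - p else 0))).
  apply: eq_bigr => p _; rewrite (red (fun q => q - (p + a))).
  by apply: eq_bigr => q _; rewrite subnDr.
apply: eq_bigr => p _; case: (a <= p < b) => //=.
by rewrite big1.
Qed.

(** Double counting: a pair p < q with [p, q] inside [T] lies in exactly one maximal run. Pairs with
    q <= p weigh nothing. *)
Lemma sum_run_lengths N (T : pred nat) : (forall z, N <= z -> ~~ T z) ->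
  \sum_(x <- run_lengths N T) gap_sum x =
  \sum_(p < N) \sum_(q < N) (if seg T p q then q - p else 0).
Proof.
have io m : iota 0 m = index_iota 0 m by rewrite /index_iota subn0.
move=> TN; rewrite /run_lengths !io big_map big_filter big_mkcond big_allpairs_dep /=.
transitivity (\sum_(a < N) \sum_(b < N.+1) \sum_(p < N) \sum_(q < N)
   (if max_run T a b && ((a <= p < b) && (a <= q < b)) then q - p else 0)).
  rewrite big_mkord; apply: eq_bigr => a _.
  rewrite big_mkord; apply: eq_bigr => b _.
  case: ifP => _ /=; first by apply: gap_sum_run; rewrite -ltnS.
  by rewrite big1 // => p _; rewrite big1.
rewrite exchange_big /=.
transitivity (\sum_(p < N) \sum_(q < N) \sum_(b < N.+1) \sum_(a < N)
   (if max_run T a b && ((a <= p < b) && (a <= q < b)) then q - p else 0)).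
  under eq_bigr do rewrite exchange_big.
  rewrite exchange_big; apply: eq_bigr => p _ /=.
  under eq_bigr do rewrite exchange_big.
  by rewrite exchange_big.
apply: eq_bigr => p _; apply: eq_bigr => q _.
have [qp|pq] := leqP q p.
  rewrite (eqnP qp) if_same big1 // => b _; rewrite big1 // => a _; exact: if_same.
case: ifP => [Tpq|nTpq].
  have [a [b [mr ap qb bN]]] := max_run_exists TN (ltnW pq) Tpq.
  have ab : a < N by have := ltn_ord p; lia.
  rewrite (bigD1 (Ordinal (bN : b < N.+1))) //= (bigD1 (Ordinal ab)) //= mr.
  rewrite (_ : (_ && _)) ?addn0; last by lia.
  rewrite big1 ?addn0 => [|a' a'a]; last first.
    case: ifP => // /andP[mr' /andP[ap' _]].
    have [aE _] := max_run_uniq (p := p) mr mr' ltac:(lia) ltac:(lia).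
    by case/eqP: a'a; apply: val_inj.
  rewrite big1 ?addn0 // => b' b'b; rewrite big1 // => a' _.
  case: ifP => // /andP[mr' /andP[ap' _]].
  have [_ bE] := max_run_uniq (p := p) mr mr' ltac:(lia) ltac:(lia).
  by case/eqP: b'b; apply: val_inj.
rewrite big1 // => b _; rewrite big1 // => a _.
case: ifP => // /andP[/max_runP[ab aT _ _] /andP[ap aq]].
by case/negP: nTpq; apply/segP => z zpq; apply: aT; lia.
Qed.

End Runs.

Definition level (r : seq nat) (i : nat) : pred nat := fun j => i <= nth 0 r j.

Definition seg_weight (r : seq nat) : nat :=
  \sum_(i <- iota 1 (sumn r)) \sum_(p < size r) \sum_(q < size r)
     (if seg (level r i) p q then q - p else 0).

Lemma sum_conj_partition (r : seq nat) :
  \sum_(x <- conj_partition r) gap_sum x = seg_weight r.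
Proof.
rewrite /conj_partition (perm_big _ (permEl (perm_sort _ _))) /= big_flatten /= big_map.
rewrite /seg_weight big_seq [RHS]big_seq; apply: eq_bigr => i; rewrite mem_iota => /andP[i1 _].
apply: sum_run_lengths => z zN; rewrite /level nth_default // -ltnNge //.
Qed.

Lemma partition_const_seg (R : realType) (r : seq nat) :
  partition_const R (conj_partition r) = (2 / (seg_weight r)%:R)%R.
Proof.
rewrite /partition_const.
have -> : (\sum_(x <- conj_partition r) x%:R * (x%:R ^+ 2 - 1) = (6 * seg_weight r)%N%:R :> R)%R.
  rewrite -sum_conj_partition big_distrr /= natr_sum; apply: eq_bigr => x _.
  rewrite gap_sumE; case: x => [|x]; first by rewrite mul0r.
  by rewrite natrM natrB ?expn_gt0 // natrX.
rewrite natrM invfM mulrA; congr (_ / _)%R.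
by rewrite -[12]/((2 * 6)%N)  natrM mulfK // pnatr_eq0.
Qed.

End Segments.

(** * The upper curvature bound *)

Section HodgeGram.
Variables (R : realType) (n k : nat) (Q : 'M[int]_n).
Local Notation C := R[i].
Hypothesis Qsym : Q^T = (-1) ^+ k *: Q.
Variable F : 'I_k.+1 -> 'M[C]_n.
Hypothesis Fdec : hodge_decomposition F.
Hypothesis Fpol : polarized Q F.
Local Notation P := (hodge_proj F).
Local Notation S := (polC R Q).

Let HP : hodge_projs P := hodge_proj_projs Fdec.
Let FP p : (F p :=: P p)%MS := hodge_proj_eqmx p Fdec.

Lemma conj_polC : conj_mx S = S.
Proof. by apply/matrixP => i j; rewrite !mxE rmorph_int. Qed.

Lemma polC_tr : S^T = (-1) ^+ k *: S.
Proof.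
rewrite /polC map_trmx Qsym; apply/matrixP => i j.
by rewrite !mxE rmorphM rmorphXn rmorphN1.
Qed.

Lemma polC_orth r s : s != rev_ord r -> P r *m S *m (P s)^T = 0.
Proof.
move=> sr; apply/matrixP => i j; rewrite [RHS]mxE.
have [h _] := Fpol.
have := h r s (row i (P r)) (row j (P s)) sr; rewrite !FP !row_sub => /(_ isT isT) <-.
rewrite /pol tr_row -!row_mul !mxE; apply: eq_bigr => a _; rewrite !mxE; congr (_ * _).
Qed.

(** [Q] pairs the piece [r] only with the piece k - r, so the two projections are adjoint for
    [Q]. *)
Lemma proj_polC r : P r *m S = S *m (P (rev_ord r))^T.
Proof.
have [_ P1 _] := HP.
have P1T : \sum_s (P s)^T = 1%:M.
  by rewrite -(raddf_sum (@trmx _ _ _)) /= P1 trmx1.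
transitivity (P r *m S *m (P (rev_ord r))^T).
  rewrite -[LHS]mulmx1 -P1T mulmx_sumr (bigD1 (rev_ord r)) //= big1 ?addr0 // => s.
  exact: polC_orth.
rewrite -[S *m (P _)^T]mul1mx -P1 mulmx_suml (bigD1 r) //= big1 ?addr0 => [|s sr].
  by rewrite mulmxA.
rewrite mulmxA polC_orth // (inj_eq rev_ord_inj) eq_sym //.
Qed.

Definition weil_coef (p : 'I_k.+1) : C := 'i%C ^ (p%:Z - (rev_ord p)%:Z).

(** The Gram matrix of the Hodge inner product Q(Cu, conj v), where C is the Weil operator. *)
Definition hodge_gram : 'M[C]_n := \sum_p weil_coef p *: (P p *m S).

(** The Weil operator divided by its value i^(-k) on H^{0,k}; conjugation by it multiplies degree p
    by (-1)^p, which is the sign in the Cartan involution. *)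
Definition parity_mx : 'M[C]_n := \sum_(p < k.+1) (-1) ^+ p *: P p.

Lemma weil_coefE p : weil_coef p = (-1) ^+ p * weil_coef ord0.
Proof.
have i0 : 'i%C != 0 :> C by rewrite eq_complex /= negb_and oner_eq0 orbT.
rewrite /weil_coef -sqr_i -exprM exprnP -expfzDr //; congr (_ ^ _).
have := ltn_ord p; rewrite /=; lia.
Qed.

Lemma weil_coef0 : weil_coef ord0 = ('i%C ^+ k)^-1.
Proof. by rewrite /weil_coef /= subn1 sub0r -exprnN. Qed.

Lemma conj_sign j (x : C) : x = (-1) ^+ j -> x^* = x.
Proof. by move=> ->; rewrite rmorphXn rmorphN rmorph1. Qed.

Lemma weil_coef_conj p : (weil_coef p)^* = (-1) ^+ k * weil_coef p.
Proof.
have cM (x y : C) : (x * y)^* = x^* * y^* by apply: rmorphM.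
have cI : (('i%C ^+ k)^-1)^* = ((- 'i%C) ^+ k)^-1 :> C.
  by rewrite conjc_inv; congr (_^-1); rewrite -conjc_i; apply: rmorphXn.
rewrite weil_coefE weil_coef0 cM.
apply: etrans (congr2 _ (@conj_sign p _ erefl) cI) _.
rewrite [in LHS](exprNn _ k) invfM mulrCA; congr (_ * _).
by rewrite -signr_odd; case: (odd k); rewrite ?expr1 ?expr0 ?invrN1 ?invr1.
Qed.

Lemma conj_parity : conj_mx parity_mx = (-1) ^+ k *: parity_mx.
Proof.
have [_ _ PJ] := HP.
rewrite conj_mx_sum (reindex_inj rev_ord_inj) scaler_sumr; apply: eq_bigr => p _ /=.
rewrite (conj_mxZ_real _ (conj_sign erefl)) PJ rev_ordK scalerA -exprD; congr (_ *: _).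
rewrite -signr_odd -[RHS]signr_odd; congr (_ ^+ nat_of_bool _).
by have := ltn_ord p; lia.
Qed.

Lemma parity2 : parity_mx *m parity_mx = 1%:M.
Proof.
have [PP P1 _] := HP.
rewrite mulmx_suml -P1; apply: eq_bigr => r _.
rewrite mulmx_sumr (bigD1 r) //= big1 ?addr0 => [|s sr].
  by rewrite -scalemxAl -scalemxAr PP eqxx scalerA -expr2 sqrr_sign scale1r.
by rewrite -scalemxAl -scalemxAr PP eq_sym (negPf sr) !scaler0.
Qed.

Lemma hodge_gramE : hodge_gram = weil_coef ord0 *: (parity_mx *m S).
Proof.
rewrite /hodge_gram /parity_mx mulmx_suml scaler_sumr; apply: eq_bigr => p _.
by rewrite weil_coefE -scalemxAl scalerA mulrC.
Qed.

Lemma polC_parity : S *m parity_mx^T = (-1) ^+ k *: (parity_mx *m S).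
Proof.
rewrite /parity_mx mulmx_suml scaler_sumr (raddf_sum (@trmx _ _ _)) mulmx_sumr.
rewrite (reindex_inj rev_ord_inj); apply: eq_bigr => p _ /=.
rewrite linearZ /= -scalemxAr -proj_polC -scalemxAl scalerA -exprD; congr (_ *: _).
rewrite -signr_odd -[RHS]signr_odd; congr (_ ^+ nat_of_bool _).
by have := ltn_ord p; lia.
Qed.

(* The Hodge adjoint of an infinitesimal isometry Y is - theta(Y).            *)
Lemma hodge_gram_adj Y : inf_isom Q Y = 0 ->
  Y *m hodge_gram = hodge_gram *m adj_mx (- conj_mx (parity_mx *m Y *m parity_mx)).
Proof.
move=> /eqP; rewrite /inf_isom addr_eq0 => /eqP YS.
have -> : adj_mx (- conj_mx (parity_mx *m Y *m parity_mx))
   = - (parity_mx^T *m (Y^T *m parity_mx^T)).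
  rewrite /adj_mx -[- conj_mx _]scaleN1r (conj_mxZ_real _ (@conj_sign 1 _ erefl)) conj_mxK.
  by rewrite linearZ /= scaleN1r !trmx_mul.
rewrite hodge_gramE -scalemxAr -scalemxAl; congr (_ *: _).
have e1 : parity_mx *m S *m parity_mx^T = (-1) ^+ k *: S.
  by rewrite -mulmxA polC_parity -scalemxAr mulmxA parity2 mul1mx.
have e2 : S *m Y^T = - (Y *m S) by rewrite YS opprK.
rewrite mulmxN [RHS](congr1 -%R (mulmxA _ _ _)) e1 -scalemxAl [in RHS]mulmxA e2 mulNmx -[in RHS]mulmxA polC_parity.
rewrite -scalemxAr scalerN opprK scalerA -exprD addnn.
by rewrite -signr_odd odd_double scale1r.
Qed.

Lemma adj_mxZ m p (c c' : C) (A : 'M[C]_(m, p)) : c^* = c' ->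
  adj_mx (c *: A) = c' *: adj_mx A.
Proof. by move=> <-; apply/matrixP => i j; rewrite !mxE; apply: rmorphM. Qed.

(** The sign (-1)^k occurs four times and cancels: in conjugating the coefficient and the parity, in
    transposing [Q], and in moving the parity across [Q]. *)
Lemma hodge_gram_herm : adj_mx hodge_gram = hodge_gram.
Proof.
rewrite hodge_gramE (adj_mxZ _ (weil_coef_conj ord0)) /adj_mx conj_mxM conj_parity conj_polC.
rewrite trmx_mul linearZ /= -scalemxAr polC_tr -scalemxAl polC_parity !scalerA.
congr (_ *: _).
have s2 : (-1) ^+ k * (-1) ^+ k = 1 :> C by rewrite -exprD addnn -signr_odd odd_double.
move: ((-1) ^+ k) (weil_coef ord0) s2 => s c s2.
by transitivity ((s * s) * (s * s) * c); [ring|rewrite s2 !mul1r].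
Qed.

Lemma weil_form_proj (u : 'rV[C]_n) p :
  (u *m (weil_coef p *: (P p *m S)) *m adj_mx u) 0 0
   = pol Q (weil_coef p *: (u *m P p)) (conj_mx (u *m P p)).
Proof.
have [PP _ PJ] := HP.
rewrite /pol; apply: (congr1 (fun M : 'M[C]_1 => M 0 0)).
rewrite -scalemxAr -!scalemxAl; congr (_ *: _).
have -> : (conj_mx (u *m P p))^T = (P (rev_ord p))^T *m adj_mx u.
  by rewrite conj_mxM PJ trmx_mul.
rewrite [RHS]mulmxA -(mulmxA (u *m P p)) -proj_polC -(mulmxA u (P p)) (mulmxA (P p) (P p)).
by rewrite PP eqxx.
Qed.

Lemma posdef_hodge_gram : posdef_mx hodge_gram.
Proof.
have [_ P1 PJ] := HP; split; first exact: hodge_gram_herm.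
move=> u u0; have [_ pos] := Fpol.
have posP p : u *m P p != 0 -> 0 < pol Q (weil_coef p *: (u *m P p)) (conj_mx (u *m P p)).
  by apply: pos; rewrite FP submxMl.
have nneg p : 0 <= pol Q (weil_coef p *: (u *m P p)) (conj_mx (u *m P p)).
  have [->|/posP/ltW //] := eqVneq (u *m P p) 0.
  by rewrite scaler0 /pol !mul0mx mxE.
have -> : (u *m hodge_gram *m adj_mx u) 0 0 =
    \sum_p pol Q (weil_coef p *: (u *m P p)) (conj_mx (u *m P p)).
  rewrite /hodge_gram mulmx_sumr mulmx_suml summxE; apply: eq_bigr => p _.
  exact: weil_form_proj.
have [p up] : exists p, u *m P p != 0.
  apply/existsP; apply: contraNT u0 => /existsPn H.
  rewrite -[u]mulmx1 -P1 mulmx_sumr big1 // => p _.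
  by apply/eqP; have := H p; rewrite negbK.
by rewrite (bigD1 p) //= ltr_wpDr ?posP // sumr_ge0.
Qed.

(** The rows of [E] form a unitary frame for the Hodge inner product; in it the Hodge adjoint
    becomes the conjugate transpose, so results on ordinary matrices apply. *)
Lemma hodge_unitary : exists E : 'M[C]_n, E \in unitmx /\
  forall Y, inf_isom Q Y = 0 ->
  adj_mx (E *m Y *m invmx E) = E *m (- conj_mx (parity_mx *m Y *m parity_mx)) *m invmx E.
Proof.
have [E [_ EG _]] := cholesky posdef_hodge_gram.
have Eu : E \in unitmx.
  by have [+ _] := mulmx1_unit EG; rewrite unitmx_mul => /andP[].
exists E; split=> // Y /hodge_gram_adj.
set Y' := - conj_mx _ => YG.
have Ei : invmx E = hodge_gram *m adj_mx E.
  by rewrite -[RHS](mulKmx Eu) [E *m _]mulmxA EG mulmx1.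
have Eai : adj_mx (invmx E) = E *m hodge_gram.
  by rewrite Ei adj_mxM adj_mxK hodge_gram_herm.
rewrite -[RHS]adj_mxK; congr adj_mx.
by rewrite !adj_mxM Eai [RHS]mulmxA -(mulmxA E hodge_gram) -YG Ei !mulmxA.
Qed.

Lemma parity_mul (A : 'M[C]_n) :
  parity_mx *m A *m parity_mx = \sum_(r < k.+1) \sum_(s < k.+1) (-1) ^+ (r + s)%N *: (P r *m A *m P s).
Proof.
rewrite mulmx_suml mulmx_suml; apply: eq_bigr => r _.
rewrite mulmx_sumr; apply: eq_bigr => s _.
by rewrite -!scalemxAl -scalemxAr scalerA exprD mulrC.
Qed.

Lemma trace_parity (A B : 'M[C]_n) :
  \tr (A *m (parity_mx *m B *m parity_mx)) =
  \sum_(r < k.+1) \sum_(s < k.+1) (-1) ^+ (r + s)%N * \tr (P r *m A *m P s *m B).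
Proof.
have -> : \tr (A *m (parity_mx *m B *m parity_mx)) = \tr (parity_mx *m A *m parity_mx *m B).
  by rewrite mulmxA mxtrace_mulC !mulmxA.
rewrite parity_mul mulmx_suml (raddf_sum (@mxtrace C n)); apply: eq_bigr => r _ /=.
rewrite mulmx_suml (raddf_sum (@mxtrace C n)); apply: eq_bigr => s _ /=.
by rewrite -scalemxAl mxtraceZ.
Qed.

Lemma sub_hodge_ext (p : int) (s : 'I_k.+1) : s%:Z != p -> hodge_ext F p *m P s = 0.
Proof.
move=> sp; have [PP _ _] := HP.
apply/eqP; rewrite -submx0 sumsmxMr; apply/sumsmx_subP => r /eqP rp.
have /submxP[D ->] : (F r <= P r)%MS by rewrite FP.
rewrite -mulmxA PP; case: eqP => [rs|_]; last by rewrite mulmx0.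
by rewrite -rs rp eqxx in sp.
Qed.

Lemma lie_graded_proj p X : X \in lie_graded Q F p ->
  forall r s : 'I_k.+1, s%:Z != r%:Z + p -> P r *m X *m P s = 0.
Proof.
move=> /mem_lie_graded[_ _ XF] r s srp.
have /submxP[D DE] : (P r <= F r)%MS by rewrite FP.
have /submxP[D' D'E] := XF r.
by rewrite DE -(mulmxA D) D'E -!mulmxA sub_hodge_ext // !mulmx0.
Qed.

Lemma lie_graded_isom p X : X \in lie_graded Q F p -> inf_isom Q X = 0.
Proof. by case/mem_lie_graded. Qed.

Lemma inf_isomD (X Y : 'M[C]_n) : inf_isom Q (X + Y) = inf_isom Q X + inf_isom Q Y.
Proof. by rewrite /inf_isom linearD /= mulmxDl mulmxDr addrACA. Qed.

Lemma lie_mminusP Y : Y \in lie_mminus Q F ->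
  inf_isom Q Y = 0 /\ forall r s : 'I_k.+1, ~~ (s < r)%N -> P r *m Y *m P s = 0.
Proof.
move=> /memv_sumP[y yV ->]; split.
  apply: (big_ind (fun Z => inf_isom Q Z = 0)).
  - by rewrite /inf_isom mul0mx trmx0 mulmx0 addr0.
  - by move=> A B A0 B0; rewrite inf_isomD A0 B0 addr0.
  - by move=> j _; apply: lie_graded_isom (yV j isT).
move=> r s sr; rewrite mulmx_sumr mulmx_suml big1 // => j _.
by apply: (lie_graded_proj (yV j isT)); lia.
Qed.

(** In a unitary frame h(Y, Y) is the squared Frobenius norm, whence the positivity that makes the
    Gram matrix invertible. *)
Lemma hodge_metric_frobenius Y E : Y \in lie_mminus Q F ->
  (forall Y, inf_isom Q Y = 0 ->
     adj_mx (E *m Y *m invmx E) = E *m (- conj_mx (parity_mx *m Y *m parity_mx)) *m invmx E) ->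
  E \in unitmx ->
  hodge_metric F Y Y = \tr (E *m Y *m invmx E *m adj_mx (E *m Y *m invmx E)).
Proof.
move=> /lie_mminusP[Yi Yl] EA Eu.
rewrite EA // !mulmxA mulmxKV // mxtrace_mulC !mulmxA mulVmx // mul1mx.
have kk : (-1) ^+ k * (-1) ^+ k = 1 :> C by rewrite -exprD addnn -signr_odd odd_double.
have -> : conj_mx (parity_mx *m Y *m parity_mx) = parity_mx *m conj_mx Y *m parity_mx.
  by rewrite !conj_mxM conj_parity -scalemxAr -!scalemxAl scalerA kk scale1r.
rewrite mulmxN raddfN /= trace_parity (hodge_metricE _ _ HP) //; congr (- _).
apply: eq_bigr => r _; rewrite big_mkcond; apply: eq_bigr => s _ /=.
by case: ifPn => // sr; rewrite Yl // mul0mx mxtrace0 mulr0.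
Qed.

Lemma trace_adj_gt0 m (A : 'M[C]_m) : A != 0 -> 0 < \tr (A *m adj_mx A).
Proof.
move=> A0.
have [i [j Aij]] : exists i j, A i j != 0.
  have /existsP[i /existsP[j ij]] : [exists i, exists j, A i j != 0].
    apply: contraNT A0 => /existsPn H; apply/eqP/matrixP => i j.
    by rewrite mxE; apply/eqP; have /existsPn/(_ j) := H i; rewrite negbK.
  by exists i, j.
have S0 a b : 0 <= A a b * adj_mx A b a by rewrite adj_mxE mul_conj_ge0.
rewrite /mxtrace (bigD1 i) //= mxE (bigD1 j) //=.
rewrite ltr_wpDr //; first by rewrite sumr_ge0 // => a _; rewrite mxE sumr_ge0.
rewrite ltr_wpDr ?sumr_ge0 // lt_def S0 andbT adj_mxE mulf_neq0 //.
by rewrite conjc_eq0.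
Qed.

Lemma conj_unit_neq0 (E Y : 'M[C]_n) : E \in unitmx -> Y != 0 -> E *m Y *m invmx E != 0.
Proof.
move=> Eu; apply: contraNneq => H.
by rewrite -[Y](mulKmx Eu) -[E *m Y](mulmxKV Eu) H mul0mx mulmx0.
Qed.

Lemma hodge_metric_pos Y : Y \in lie_mminus Q F -> Y != 0 -> hodge_metric F Y Y != 0.
Proof.
move=> YV Y0; have [E [Eu EA]] := hodge_unitary.
by rewrite (hodge_metric_frobenius YV EA Eu) gt_eqF // trace_adj_gt0 // conj_unit_neq0.
Qed.

End HodgeGram.

(** * Norms and ranks in horizontal directions *)

Section Horizontal.
Variables (R : realType) (n k : nat) (Q : 'M[int]_n).
Local Notation C := R[i].
Hypothesis Qsym : Q^T = (-1) ^+ k *: Q.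
Variable F : 'I_k.+1 -> 'M[C]_n.
Hypothesis Fdec : hodge_decomposition F.
Hypothesis Fpol : polarized Q F.
Local Notation P := (hodge_proj F).
Variable X : 'M[C]_n.
Hypothesis Xi : inf_isom Q X = 0.
Hypothesis PX : forall r s : 'I_k.+1, r != s.+1 :> nat -> P r *m X *m P s = 0.

Let HP : hodge_projs P := hodge_proj_projs Fdec.
Let FP p : (F p :=: P p)%MS := hodge_proj_eqmx p Fdec.

Lemma parity_horizontal : parity_mx F *m X *m parity_mx F = - X.
Proof.
have [_ P1 _] := HP.
rewrite parity_mul -[in RHS](mul1mx X) -P1 mulmx_suml -sumrN; apply: eq_bigr => r _.
rewrite -[in RHS](mulmx1 (P r *m X)) -P1 mulmx_sumr -sumrN; apply: eq_bigr => s _.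
have [rs|rs] := eqVneq (r : nat) s.+1; last by rewrite PX // scaler0 oppr0.
by rewrite rs addSn addnn -signr_odd /= odd_double scaleN1r.
Qed.

Lemma horizontal_unitary : exists E : 'M[C]_n, E \in unitmx /\
  adj_mx (E *m X *m invmx E) = E *m conj_mx X *m invmx E.
Proof.
have [E [Eu EA]] := hodge_unitary Qsym Fdec Fpol; exists E; split=> //.
rewrite (EA _ Xi) parity_horizontal -[- X]scaleN1r (conj_mxZ_real _ (@conj_sign R 1 _ erefl)).
by rewrite scaleN1r opprK.
Qed.

Lemma horizontal_trace_gt0 : X != 0 -> 0 < \tr (X *m conj_mx X).
Proof.
move=> X0; have [E [Eu EX]] := horizontal_unitary.
have := trace_adj_gt0 (conj_unit_neq0 Eu X0).
by rewrite EX !mulmxA mulmxKV // mxtrace_mulC !mulmxA mulVmx // mul1mx.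
Qed.

Lemma trace_adj_ge0 m (A : 'M[C]_m) : 0 <= \tr (A *m adj_mx A).
Proof.
have [->|/trace_adj_gt0/ltW //] := eqVneq A 0.
by rewrite mul0mx mxtrace0.
Qed.

Lemma self_comm_adj m (A : 'M[C]_m) : adj_mx (self_comm A) = self_comm A.
Proof.
have adjB (B D : 'M[C]_m) : adj_mx (B - D) = adj_mx B - adj_mx D.
  by rewrite /adj_mx conj_mxB linearB.
by rewrite /self_comm adjB !adj_mxM adj_mxK.
Qed.

Lemma horizontal_comm_ge0 : 0 <= \tr (lie_br X (conj_mx X) *m lie_br X (conj_mx X)).
Proof.
have [E [Eu EX]] := horizontal_unitary.
have := trace_adj_ge0 (self_comm (E *m X *m invmx E)).
rewrite self_comm_adj /self_comm EX.
have -> : E *m X *m invmx E *m (E *m conj_mx X *m invmx E)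
   - E *m conj_mx X *m invmx E *m (E *m X *m invmx E) = E *m lie_br X (conj_mx X) *m invmx E.
  by rewrite lie_brE mulmxBr mulmxBl !mulmxA !mulmxKV.
by rewrite !mulmxA mulmxKV // mxtrace_mulC !mulmxA mulVmx // mul1mx.
Qed.

Lemma horizontal_trace_ineq m : X ^+ m = 0 ->
  2 * \tr (X *m conj_mx X) ^+ 2 <= \tr (lie_br X (conj_mx X) *m lie_br X (conj_mx X))
     * (\sum_(d < m) (d * \rank (X ^+ d)))%N%:R.
Proof.
move=> Xm; have [E [Eu EX]] := horizontal_unitary.
have conjM (A B : 'M[C]_n) : (E *m A *m invmx E) *m (E *m B *m invmx E) = E *m (A *m B) *m invmx E.
  by rewrite !mulmxA mulmxKV.
have trE (A : 'M[C]_n) : \tr (E *m A *m invmx E) = \tr A.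
  by rewrite mxtrace_mulC mulmxA mulVmx // mul1mx.
have expE d : (E *m X *m invmx E) ^+ d = E *m X ^+ d *m invmx E.
  elim: d => [|d IH]; first by rewrite !expr0 mulmx1 mulmxV.
  by rewrite !exprS -[LHS]/(E *m X *m invmx E *m (E *m X *m invmx E) ^+ d) IH conjM.
have Zm : (E *m X *m invmx E) ^+ m = 0 by rewrite expE Xm mulmx0 mul0mx.
have := nilp_norm_ineq Zm.
rewrite /self_comm EX !conjM.
have -> : E *m (X *m conj_mx X) *m invmx E - E *m (conj_mx X *m X) *m invmx E
    = E *m lie_br X (conj_mx X) *m invmx E.
  by rewrite lie_brE mulmxBr mulmxBl.
rewrite conjM !trE.
have rkE d : \rank ((E *m X *m invmx E) ^+ d) = \rank (X ^+ d).
  by rewrite expE mxrankMfree ?row_free_unit ?unitmx_inv // eqmxMfull ?row_full_unit.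
by under eq_bigr do rewrite rkE.
Qed.

(** A vector of degree less than [d] cannot be lowered [d] times. *)
Lemma filt_exp d : X ^+ d = filt_proj P d *m X ^+ d.
Proof.
elim: d => [|d IH]; first by have [_ P1 _] := HP; rewrite filt_proj0 P1 mul1mx.
by rewrite exprS -[X * _]/(X *m _) {1}IH mulmxA -(filt_lower HP PX) -mulmxA.
Qed.

Lemma horizontal_nilp m : (k < m)%N -> X ^+ m = 0.
Proof.
by move=> km; rewrite -(subnKC km) exprD filt_exp filt_proj_max mul0mx mul0r.
Qed.

Lemma proj_exp (r : 'I_k.+1) (s : 'I_k.+1) d : (r = s + d :> nat)%N ->
  P r *m X ^+ d = X ^+ d *m P s.
Proof.
have step (a b : 'I_k.+1) : a = b.+1 :> nat -> P a *m X = X *m P b.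
  move=> ab; rewrite -!(filt_diff_proj P) mulmxBl mulmxBr !(filt_lower HP PX) ab.
  by rewrite (filt_lower HP PX).
elim: d r => [|d IH] r rs; first by rewrite !expr0 mulmx1 mul1mx; congr P; apply: val_inj; rewrite /= rs addn0.
have r' : (s + d < k.+1)%N by have := ltn_ord r; lia.
have e : X ^+ d.+1 = X *m X ^+ d by rewrite exprS.
have rE : P r *m X = X *m P (Ordinal r') by apply: step; rewrite rs addnS.
by rewrite e mulmxA rE -mulmxA (IH (Ordinal r')) // mulmxA.
Qed.

Lemma rank_proj_exp (r : 'I_k.+1) d z : (r - d <= z <= r)%N -> (d <= r)%N ->
  (\rank (P r *m X ^+ d) <= \rank (F (inord z)))%N.
Proof.
move=> /andP[dz zr] dr; have zk : (z < k.+1)%N by have := ltn_ord r; lia.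
have -> : d = (r - z + (d - (r - z)))%N by lia.
rewrite exprD -[_ * _]/(_ *m _) mulmxA (@proj_exp r (inord z)); last by rewrite inordK //; lia.
rewrite -mulmxA; apply: leq_trans (mxrankM_maxr _ _) _.
by rewrite (FP (inord z)); apply: mxrankM_maxl.
Qed.

Lemma proj_exp0 (r : 'I_k.+1) d : (r < d)%N -> P r *m X ^+ d = 0.
Proof.
move=> rd; rewrite filt_exp mulmxA mul_proj_filt //.
by rewrite leqNgt rd mul0mx.
Qed.

Lemma mxrank_sum_le (I : Type) (l : seq I) (A : I -> 'M[C]_n) :
  (\rank (\sum_(i <- l) A i)%R <= \sum_(i <- l) \rank (A i))%N.
Proof.
elim: l => [|i l IH]; first by rewrite !big_nil mxrank0.
rewrite !big_cons; apply: leq_trans (mxrank_add _ _) _.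
by rewrite leq_add2l.
Qed.

Lemma rank_exp_le d :
  (\rank (X ^+ d) <= \sum_(r < k.+1 | (d <= r)%N) \rank (P r *m X ^+ d))%N.
Proof.
have [_ P1 _] := HP.
have -> : X ^+ d = \sum_r P r *m X ^+ d by rewrite -mulmx_suml P1 mul1mx.
apply: leq_trans (mxrank_sum_le _ _) _.
rewrite [X in (_ <= X)%N]big_mkcond; apply: leq_sum => r _.
case: ifPn => [_|]; first by rewrite -mulmx_suml P1 mul1mx.
by rewrite -ltnNge => rd; rewrite proj_exp0 // mxrank0.
Qed.

End Horizontal.

Definition seg_count (r : seq nat) (p q : nat) : nat :=
  \sum_(i <- iota 1 (sumn r)) seg (level r i) p q.

(** For p <= q the factor [seg_count r p q] is the minimum of the entries of [r] on [p, q]; in this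
    form the weight can be compared with ranks. *)
Lemma seg_weightE (r : seq nat) : seg_weight r =
  (\sum_(q < size r) \sum_(p < size r) (q - p) * seg_count r p q)%N.
Proof.
rewrite /seg_weight.
under eq_bigr do rewrite exchange_big.
rewrite exchange_big; apply: eq_bigr => q _ /=.
rewrite exchange_big; apply: eq_bigr => p _ /=.
rewrite /seg_count big_distrr; apply: eq_bigr => i _ /=.
by case: seg; rewrite ?muln1 ?muln0.
Qed.

Lemma nth_leq_sumn (r : seq nat) z : (nth 0 r z <= sumn r)%N.
Proof.
elim: r z => [|a r IH] [|z] //=; first exact: leq_addr.
by apply: leq_trans (IH z) _; apply: leq_addl.
Qed.

Lemma leq_seg_count (r : seq nat) p q m : (p <= q)%N ->
  (forall z, (p <= z <= q)%N -> (m <= nth 0 r z)%N) -> (m <= seg_count r p q)%N.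
Proof.
move=> pq H.
have mN : (m <= sumn r)%N by apply: leq_trans (H p _) (nth_leq_sumn r p); rewrite leqnn.
rewrite /seg_count -(subnKC mN) iotaD big_cat /=; apply: leq_trans (leq_addr _ _).
rewrite big_seq (eq_bigr (fun=> 1%N)) => [|i].
  by rewrite -big_seq sum1_size size_iota.
rewrite mem_iota add1n ltnS => /andP[_ im].
by rewrite (_ : seg _ _ _) //; apply/segP => z /H; apply: leq_trans.
Qed.

(** A power [d] starting in degree [q] corresponds to the segment [q - d, q]; under p = q - d the
    factor d becomes the weight q - p. *)
Lemma seg_weight_ge (r : seq nat) N (rk : nat -> nat -> nat) : size r = N ->
  (forall d q, (d <= q < N)%N -> (rk d q <= seg_count r (q - d) q)%N) ->
  (\sum_(d < N) d * (\sum_(q < N | (d <= q)%N) rk d q) <= seg_weight r)%N.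
Proof.
move=> <- H; rewrite seg_weightE.
under eq_bigr do rewrite big_distrr.
rewrite (exchange_big_dep predT) //=; apply: leq_sum => q _.
have qs : (q.+1 <= size r)%N by apply: ltn_ord.
rewrite [X in (_ <= X)%N](bigID (fun p : 'I_(size r) => (p < q.+1)%N)) /=.
apply: leq_trans (leq_addr _ _).
rewrite -(big_ord_widen _ (fun p => (q - p) * seg_count r p q)%N qs).
under eq_bigl do rewrite -ltnS.
rewrite -(big_ord_widen _ (fun d => d * rk d q)%N qs) (reindex_inj rev_ord_inj).
apply: leq_sum => p _ /=; rewrite subSS leq_mul2l; apply/orP; right.
have pq : (p <= q)%N by rewrite -ltnS.
by rewrite -{2}(subKn pq) H // leq_subr ltn_ord.
Qed.

(** * The bound for the holomorphic sectional curvature *)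

Section HorizontalCurvature.
Variables (R : realType) (n k : nat) (Q : 'M[int]_n) (h : 'I_k.+1 -> nat).
Local Notation C := R[i].
Hypothesis k_ge1 : (1 <= k)%N.
Hypothesis Qsym : Q^T = (-1) ^+ k *: Q.
Hypothesis h_gt0 : forall p, (0 < h p)%N.
Variable F : 'I_k.+1 -> 'M[C]_n.
Hypothesis Fdom : period_domain Q h F.
Local Notation hn := [seq h (rev_ord j) | j <- enum 'I_k.+1].

Let Fdec : hodge_decomposition F. Proof. by case: Fdom. Qed.
Let Fpol : polarized Q F. Proof. by case: Fdom. Qed.
Let HP : hodge_projs (hodge_proj F) := hodge_proj_projs Fdec.

Lemma hodge_number_rank p : \rank (F p) = h p.
Proof. by case: Fdom. Qed.

Lemma hodge_number_sym p : h (rev_ord p) = h p.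
Proof.
have [_ _ FJ] := Fdec.
by rewrite -!hodge_number_rank -FJ mxrank_map.
Qed.

Lemma size_hodge_numbers : size hn = k.+1.
Proof. by rewrite size_map size_enum_ord. Qed.

(** The array begins with h^{k,0}, but h^{p,q} = h^{q,p} lets it be read from either end. *)
Lemma nth_hodge_numbers z : (z < k.+1)%N -> nth 0 hn z = h (inord z).
Proof.
move=> zk; rewrite (nth_map ord0) ?size_enum_ord // hodge_number_sym.
by congr h; apply: val_inj; rewrite /= nth_enum_ord // inordK.
Qed.

Lemma sum_hodge_numbers : (\sum_p h p = n)%N.
Proof.
have [F1 /mxdirectP Fd _] := Fdec.
under eq_bigr do rewrite -hodge_number_rank.
by rewrite /= in Fd; rewrite -Fd F1 mxrank1.
Qed.

(** The k + 1 positive Hodge numbers add up to [n]. Hence X^(k+1) = 0 implies X^n = 0, and the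
    truncated exponential is the full one. *)
Lemma ltn_weight_dim : (k < n)%N.
Proof.
rewrite -sum_hodge_numbers -[X in (X <= _)%N]card_ord -sum1_card.
by apply: leq_sum => p _; apply: h_gt0.
Qed.

Section Direction.
Variable X : 'M[C]_n.
Hypothesis XF : X \in lie_graded Q F (-1).

Lemma lie_graded_lower (r s : 'I_k.+1) :
  r != s.+1 :> nat -> hodge_proj F r *m X *m hodge_proj F s = 0.
Proof. by move=> rs; apply: (lie_graded_proj Fdec XF); apply: contraNneq rs; lia. Qed.

Let XI : inf_isom Q X = 0 := lie_graded_isom XF.

Lemma horizontal_hodge_curv : hodge_curv Q F X =
  - \tr (lie_br X (conj_mx X) *m lie_br X (conj_mx X)) / \tr (X *m conj_mx X) ^+ 2.
Proof.
apply: hodge_curvE => //.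
- by apply: leq_ltn_trans ltn_weight_dim.
- exact: (horizontal_nilp Fdec lie_graded_lower ltn_weight_dim).
- exact: lie_graded_lower.
(* Degree -1 is the summand of index 0 of m^-, which exists because k >= 1. *)
- by apply: (subvP (sumv_sup (Ordinal k_ge1) _ _)) XF.
- exact: hodge_metric_pos.
Qed.

Lemma horizontal_weight_ineq :
  2 * \tr (X *m conj_mx X) ^+ 2 <= \tr (lie_br X (conj_mx X) *m lie_br X (conj_mx X))
     * (seg_weight hn)%:R.
Proof.
apply: le_trans (horizontal_trace_ineq Qsym Fdec Fpol XI lie_graded_lower
  (horizontal_nilp Fdec lie_graded_lower (ltnSn k))) _.
apply: ler_wpM2l; first exact: (horizontal_comm_ge0 Qsym Fdec Fpol XI lie_graded_lower).
rewrite ler_nat.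
have sz := size_hodge_numbers; have nthE := nth_hodge_numbers.
move: sz nthE; set r := hn => sz nthE.
pose rk d q := \rank (hodge_proj F (inord q) *m X ^+ d).
apply: leq_trans (seg_weight_ge (rk := rk) sz _); last first.
  move=> d q /andP[dq qk].
  apply: leq_seg_count => [|z zq]; first exact: leq_subr.
  have zk : (z < k.+1)%N by lia.
  rewrite nthE // -hodge_number_rank.
  by apply: (rank_proj_exp Fdec lie_graded_lower); rewrite inordK.
apply: leq_sum => d _; rewrite leq_mul2l; apply/orP; right.
apply: leq_trans (rank_exp_le Fdec lie_graded_lower d) _.
by apply: leq_sum => q _; rewrite /rk inord_val.
Qed.

Hypothesis X0 : X != 0.

Let t_gt0 : 0 < \tr (X *m conj_mx X).
Proof. exact: (horizontal_trace_gt0 Qsym Fdec Fpol XI lie_graded_lower X0). Qed.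

(** If the weight were 0, the inequality itself would contradict tr(X Xb) > 0. *)
Lemma seg_weight_gt0 : (0 < seg_weight hn)%N.
Proof.
rewrite lt0n; apply/eqP => W0.
have := horizontal_weight_ineq; rewrite W0 mulr0 => le0.
have : 0 < 2 * \tr (X *m conj_mx X) ^+ 2 by rewrite mulr_gt0 ?exprn_gt0 // ltr0n.
by move/lt_le_trans => /(_ _ le0); rewrite ltxx.
Qed.

Lemma seg_weight_constE : (partition_const R (conj_partition hn))%:C
  = 2 / (seg_weight hn)%:R :> C.
Proof.
by rewrite partition_const_seg rmorphM fmorphV /= !rmorph_nat.
Qed.

Lemma horizontal_curv_le :
  hodge_curv Q F X <= (- partition_const R (conj_partition hn))%:C.
Proof.
have W0 : 0 < (seg_weight hn)%:R :> C by rewrite ltr0n seg_weight_gt0.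
rewrite horizontal_hodge_curv rmorphN /= seg_weight_constE mulNr lerN2.
rewrite ler_pdivrMr // mulrAC ler_pdivlMr ?exprn_gt0 //.
exact: horizontal_weight_ineq.
Qed.

Lemma horizontal_curv_eq :
  2 * \tr (X *m conj_mx X) ^+ 2 = \tr (lie_br X (conj_mx X) *m lie_br X (conj_mx X))
     * (seg_weight hn)%:R ->
  hodge_curv Q F X = (- partition_const R (conj_partition hn))%:C.
Proof.
move=> eqW.
have W0 : (seg_weight hn)%:R != 0 :> C by rewrite pnatr_eq0 -lt0n seg_weight_gt0.
rewrite horizontal_hodge_curv rmorphN /= seg_weight_constE mulNr; congr (- _).
have t0 : \tr (X *m conj_mx X) ^+ 2 != 0 by rewrite expf_neq0 // gt_eqF.
by apply/eqP; rewrite eqr_div // -eqW.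
Qed.

End Direction.
End HorizontalCurvature.

(** * Sharpness *)

Section Crossings.
Local Open Scope nat_scope.

Section CrossCount.
Variables (N : nat) (T : pred nat).
Hypothesis TN : forall z, N <= z -> ~~ T z.

(* On a run [a, b) of T this is (p - a) * (b - p), the squared p-th entry of the *)
(* raising operator of the irreducible unitary sl2-module of dimension b - a.     *)
Definition cross_count (p : nat) : nat :=
  \sum_(x < N) \sum_(y < N) [&& x < p, p <= y & seg T x y].

(** Double counting, with gap [p] lying between positions p - 1 and p: a segment [x, y] crosses y -
    x gaps. *)
Lemma sum_cross_count :
  \sum_(p < N) cross_count p = \sum_(x < N) \sum_(y < N) (if seg T x y then y - x else 0).
Proof.
rewrite exchange_big; apply: eq_bigr => x _ /=.
rewrite exchange_big; apply: eq_bigr => y _ /=.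
case: (seg T x y); last by rewrite big1 // => p _; rewrite !andbF.
transitivity (\sum_(p < N) (if x < p <= y then 1 else 0)).
  by apply: eq_bigr => p _; rewrite andbT; case: ifP.
rewrite (eq_bigr (fun p : 'I_N => if x.+1 <= p < y.+1 then 1 else 0)) //.
have [xy|yx] := leqP x y.
  by rewrite (sum_interval (fun=> 1)) ?ltn_ord // sum1_card card_ord subSS.
rewrite big1 ?(eqnP (ltnW yx)) // => p _.
by case: ifP => // /andP[]; lia.
Qed.

Lemma cross_count_run a b p : max_run T a b -> b <= N -> a <= p <= b ->
  cross_count p = (p - a) * (b - p).
Proof.
move=> mr bN /andP[ap pb]; have /max_runP[ab aT a0 bT] := mr.
transitivity (\sum_(x < N) \sum_(y < N) (if a <= x < p then 1 else 0) * (if p <= y < b then 1 else 0)).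
  apply: eq_bigr => x _; apply: eq_bigr => y _.
  have [xp|px] := ltnP x p; last by rewrite andbF.
  have [py|yp] := leqP p y; last by rewrite /= muln0.
  rewrite /= andbT; case: (leqP a x) => ax; last first.
    case: segP => // H; case: a0 => [a0|/negP[]]; first by rewrite a0 in ax.
    by apply: H; lia.
  case: (ltnP y b) => yb /=; last first.
    by case: segP => // H; case/negP: bT; apply: H; lia.
  by rewrite (_ : seg _ _ _) //; apply/segP => z xzy; apply: aT; lia.
under eq_bigr do rewrite -big_distrr.
rewrite -big_distrl /= (sum_interval (fun=> 1)) ?(leq_trans pb) // (sum_interval (fun=> 1)) //.
by rewrite !sum1_card !card_ord.
Qed.

Lemma cross_count0 : cross_count 0 = 0.
Proof. by rewrite /cross_count big1 // => x _; rewrite big1. Qed.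

Lemma cross_count_big p : N <= p -> cross_count p = 0.
Proof.
move=> Np; rewrite /cross_count big1 // => x _; rewrite big1 // => y _.
by rewrite [p <= y]leqNgt (leq_trans (ltn_ord y)) // andbF.
Qed.

Lemma cross_count_neq0 p : cross_count p != 0 -> T p /\ T p.-1.
Proof.
move=> p0; have /existsP[x /existsP[y]] :
    [exists x : 'I_N, exists y : 'I_N, [&& x < p, p <= y & seg T x y]].
  apply: contraNT p0 => /existsPn H; rewrite /cross_count big1 // => x _; rewrite big1 // => y _.
  by have /existsPn/(_ y)/negPf -> := H x.
by move=> /and3P[xp py /segP H]; split; apply: H; lia.
Qed.

(** A crossed gap is interior to a run [a, b), where the count is the quadratic (p - a)(b - p), with
    second difference -2. The value 0 at both ends of the run fits the same formula. *)
Lemma cross_count_concave p : cross_count p.+1 != 0 ->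
  2 * cross_count p.+1 = cross_count p + cross_count p.+2 + 2.
Proof.
move=> /cross_count_neq0 [TSp Tp].
have [a [b [mr ap pb bN]]] : exists a b, [/\ max_run T a b, a <= p, p.+1 < b & b <= N].
  apply: max_run_exists TN _ _; first exact: leqnSn.
  apply/segP => z /andP[pz zp]; have [->|zp'] := eqVneq z p.+1; first by [].
  by have -> : z = p by lia.
rewrite !(cross_count_run mr bN); [|lia..].
have [x xE] : exists x, p = a + x by exists (p - a); lia.
have [y yE] : exists y, b = p.+2 + y by exists (b - p.+2); lia.
rewrite yE xE.
have -> : (a + x).+1 - a = x.+1 by lia.
have -> : (a + x).+2 + y - (a + x).+1 = y.+1 by lia.
have -> : a + x - a = x by lia.
have -> : (a + x).+2 + y - (a + x) = y.+2 by lia.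
have -> : (a + x).+2 - a = x.+2 by lia.
have -> : (a + x).+2 + y - (a + x).+2 = y by lia.
nia.
Qed.

(** Multiply the relation of [cross_count_concave] by the count itself and sum. The products with
    the left and the right neighbour have equal sums because the count vanishes at both ends. *)
Lemma sum_cross_count_sqr :
  \sum_(p < N) cross_count p ^ 2
    = \sum_(p < N) cross_count p + \sum_(p < N) cross_count p * cross_count p.+1.
Proof.
set g := cross_count.
have g0 : g 0 = 0 := cross_count0; have gN : g N = 0 by apply: cross_count_big.
have shift : \sum_(p < N) g p * g p.-1 = \sum_(p < N) g p * g p.+1.
  case: (N) gN => [|m] gm; first by rewrite !big_ord0.
  rewrite big_ord_recl [RHS]big_ord_recr /= g0 gm mul0n muln0 addn0 add0n.
  by apply: eq_bigr => p _; apply: mulnC.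
(* Where g p = 0 this is trivial; that includes p = 0, so the truncated predecessor does no harm. *)
have step (p : 'I_N) : 2 * g p ^ 2 = 2 * g p + g p * g p.-1 + g p * g p.+1.
  case: p => -[|p] /= pN; first by rewrite g0.
  have [->|gp] := eqVneq (g p.+1) 0; first by [].
  have := cross_count_concave gp; rewrite -/g; nia.
have E : 2 * \sum_(p < N) g p ^ 2 =
   2 * \sum_(p < N) g p + \sum_(p < N) g p * g p.-1 + \sum_(p < N) g p * g p.+1.
  by rewrite !big_distrr /= -!big_split; apply: eq_bigr => p _.
rewrite shift in E; lia.
Qed.

Lemma cross_count_rev p : (forall z, z < N -> T (N - z.+1) = T z) -> p <= N ->
  cross_count (N - p) = cross_count p.
Proof.
move=> Trev pN; rewrite /cross_count exchange_big (reindex_inj rev_ord_inj).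
apply: eq_bigr => x _; rewrite (reindex_inj rev_ord_inj); apply: eq_bigr => y _ /=.
have xN := ltn_ord x; have yN := ltn_ord y.
rewrite andbCA (_ : (N - y.+1 < N - p) = (p <= y)); last by lia.
rewrite (_ : (N - p <= N - x.+1) = (x < p)); last by lia.
rewrite andbCA; case: (x < p) => //; case: (p <= y) => //=; congr (nat_of_bool _).
apply/segP/segP => H z zxy.
  by rewrite -Trev; [apply: H; lia|lia].
by have -> : z = N - (N - z.+1).+1 by [lia]; rewrite Trev; [apply: H; lia|lia].
Qed.

End CrossCount.

End Crossings.

(** * Orthonormal frames compatible with conjugation *)

Section Frames.
Variable R : realType.
Local Notation C := R[i].

(* Real and imaginary parts of the rows span the complexification of a real   *)
(* subspace.                                                                  *)
Lemma real_row_basis n (W : 'M[C]_n) : (conj_mx W :=: W)%MS ->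
  exists A : 'M[C]_(\rank W, n), [/\ (A :=: W)%MS, row_free A & conj_mx A = A].
Proof.
move=> WJ.
pose re : 'M[R]_n := map_mx (@complex.Re R) W.
pose im : 'M[R]_n := map_mx (@complex.Im R) W.
pose toC m (M : 'M[R]_(m, n)) : 'M[C]_(m, n) := map_mx (real_complex R) M.
have WE : W = toC _ re + 'i%C *: toC _ im.
  by apply/matrixP => i j; rewrite !mxE [LHS]complexE.
have JE : conj_mx W = toC _ re - 'i%C *: toC _ im.
  apply/matrixP => i j; rewrite !mxE.
  by case: (W i j) => a b /=; apply/eqP; rewrite eq_complex /=; apply/andP; split; apply/eqP; ring.
pose K := col_mx re im.
have KE : (toC _ K :=: W)%MS.
  have two : (2 : C) != 0 by rewrite pnatr_eq0.
  have i0 : 'i%C != 0 :> C by rewrite eq_complex /= negb_and oner_eq0 orbT.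
  apply/eqmxP/andP; split.
    rewrite /toC map_col_mx -addsmxE addsmx_sub; apply/andP; split.
      have -> : map_mx (real_complex R) re = 2^-1 *: (W + conj_mx W).
        rewrite JE {1}WE addrACA subrr addr0 -[X in X + _]scale1r -[X in _ + X]scale1r -scalerDl.
        by rewrite scalerA -[1 + 1]/(2 : C) mulVf // scale1r.
      by rewrite scalemx_sub // addmx_sub // WJ.
    have -> : map_mx (real_complex R) im = (2 * 'i%C)^-1 *: (W - conj_mx W).
      rewrite JE {1}WE opprB addrC addrA subrK -scalerDl.
      have ii : 'i%C + 'i%C != 0 :> C by rewrite -mulr2n -mulr_natl mulf_neq0.
      by rewrite (_ : (2 * 'i%C)^-1 = ('i%C + 'i%C)^-1) ?scalerA ?mulVf ?scale1r // mulr_natl mulr2n.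
    by rewrite scalemx_sub // addmx_sub // eqmx_opp WJ.
  rewrite WE addmx_sub //.
    by rewrite /toC map_col_mx -addsmxE addsmxSl.
  by rewrite scalemx_sub // /toC map_col_mx -addsmxE addsmxSr.
have rk : \rank K = \rank W by rewrite -KE /toC mxrank_map.
rewrite -rk; exists (toC _ (row_base K)); split.
- apply: eqmx_trans KE; rewrite /toC; apply/eqmxP; rewrite !map_submx.
  by apply/eqmxP; apply: eq_row_base.
- by rewrite /toC row_free_map row_base_free.
- by apply/matrixP => i j; rewrite !mxE conjc_real.
Qed.

(** For a self-conjugate [W] one starts from a real basis; its Gram matrix is real, and so is its
    Cholesky factor. *)
Lemma orthonormal_basis n (G W : 'M[C]_n) : posdef_mx G -> conj_mx G = G ->
  exists A : 'M[C]_(\rank W, n), [/\ (A <= W)%MS, A *m G *m adj_mx A = 1%:M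
    & (conj_mx W :=: W)%MS -> conj_mx A = A].
Proof.
move=> [Gh Gp] Gc.
have [B [BW Bf Bc]] : exists B : 'M[C]_(\rank W, n), [/\ (B :=: W)%MS, row_free B
    & (conj_mx W :=: W)%MS -> conj_mx B = B].
  have [WJ|WJ] := pselect (conj_mx W :=: W)%MS.
    by have [B [? ? ?]] := real_row_basis WJ; exists B.
  by exists (row_base W); split=> //; [apply: eq_row_base|apply: row_base_free].
have Bp : posdef_mx (B *m G *m adj_mx B).
  split; first by rewrite !adj_mxM adj_mxK Gh mulmxA.
  move=> u u0; rewrite !mulmxA -mulmxA -adj_mxM; apply: Gp.
  by rewrite mulmx_free_eq0.
have [E [_ EG Ec]] := cholesky Bp.
exists (E *m B); split; first by rewrite -BW submxMl.
  by rewrite adj_mxM !mulmxA in EG *.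
move=> WJ; rewrite conj_mxM (Bc WJ) Ec // !conj_mxM (Bc WJ) Gc; congr (_ *m _).
have BJ := Bc WJ.
by rewrite /adj_mx BJ {1}/conj_mx -map_trmx -/(conj_mx B) BJ.
Qed.

(** The frame is continued by 0 beyond the rank, so that spaces of different dimensions share one
    index set. *)
Lemma orthonormal_frame n (G W : 'M[C]_n) : posdef_mx G -> conj_mx G = G ->
  exists e : nat -> 'rV[C]_n, [/\ forall i, (e i <= W)%MS,
    forall i j, e i *m G *m adj_mx (e j) = ((i == j) && (i < \rank W)%N)%:R%:M
    & (conj_mx W :=: W)%MS -> forall i, conj_mx (e i) = e i].
Proof.
move=> Gp Gc; have [A [AW AG Ac]] := orthonormal_basis W Gp Gc.
pose e (i : nat) : 'rV[C]_n := if insub i is Some i' then row (i' : 'I_(\rank W)) A else 0.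
have adj0 : adj_mx (0 : 'rV[C]_n) = 0 by rewrite /adj_mx /conj_mx map_mx0 trmx0.
exists e; split.
- by move=> i; rewrite /e; case: insub => [i'|]; rewrite ?sub0mx // (submx_trans (row_sub _ _)).
- move=> i j; rewrite /e; case: insubP => [i' iW iE|iW]; last first.
    by rewrite !mul0mx (negPf iW) andbF raddf0.
  case: insubP => [j' jW jE|jW]; last first.
    rewrite adj0 mulmx0 (_ : (i == j) = false) ?raddf0 //.
    by apply: contraNF jW => /eqP <-.
  have -> : adj_mx (row j' A) = col j' (adj_mx A) by apply/matrixP => a b; rewrite !mxE.
  apply/matrixP => a b; rewrite !ord1 -row_mul.
  transitivity ((A *m G *m adj_mx A) i' j').
    by rewrite [LHS]mxE [RHS]mxE; apply: eq_bigr => c _; rewrite [row _ _ _ _]mxE [col _ _ _ _]mxE.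
  rewrite AG !mxE mulr1n iW andbT -iE -jE.
  by rewrite (inj_eq val_inj).
move=> WJ i; rewrite /e; case: insub => [i'|]; last by rewrite /conj_mx map_mx0.
by rewrite /conj_mx map_row -/(conj_mx A) Ac.
Qed.

End Frames.

Section HodgeFrames.
Variables (R : realType) (n k : nat) (Q : 'M[int]_n).
Local Notation C := R[i].
Hypothesis Qsym : Q^T = (-1) ^+ k *: Q.
Variable F : 'I_k.+1 -> 'M[C]_n.
Hypothesis Fdec : hodge_decomposition F.
Hypothesis Fpol : polarized Q F.
Local Notation P := (hodge_proj F).
Local Notation S := (polC R Q).
Local Notation G := (hodge_gram Q F).

Let HP : hodge_projs P := hodge_proj_projs Fdec.
Let FP p : (F p :=: P p)%MS := hodge_proj_eqmx p Fdec.

Lemma conj_hodge_gram : conj_mx G = G.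
Proof.
have s2 : (-1) ^+ k * (-1) ^+ k = 1 :> C by rewrite -exprD addnn -signr_odd odd_double.
have cJ m p (c c' : C) (A : 'M[C]_(m, p)) : c^* = c' -> conj_mx (c *: A) = c' *: conj_mx A.
  by move=> <-; apply/matrixP => i j; rewrite !mxE; apply: rmorphM.
rewrite hodge_gramE (cJ _ _ _ _ _ (weil_coef_conj R ord0)) conj_mxM conj_parity // conj_polC.
by rewrite -scalemxAl scalerA mulrC mulrA s2 mul1r.
Qed.

Lemma hodge_gram_tr : G^T = G.
Proof. by have := hodge_gram_herm Qsym Fdec Fpol; rewrite /adj_mx conj_hodge_gram. Qed.

Lemma proj_hodge_gram p : P p *m G = weil_coef R p *: (P p *m S).
Proof.
have [PP _ _] := HP.
rewrite /hodge_gram mulmx_sumr (bigD1 p) //= big1 ?addr0 => [|q qp].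
  by rewrite -scalemxAr mulmxA PP eqxx.
by rewrite -scalemxAr mulmxA PP eq_sym (negPf qp) mul0mx scaler0.
Qed.

Lemma hodge_gram_orth p q (u v : 'rV[C]_n) : (u <= F p)%MS -> (v <= F q)%MS -> p != q ->
  u *m G *m adj_mx v = 0.
Proof.
have [PP _ PJ] := HP.
rewrite !FP => /submxP[a ->] /submxP[b ->] pq.
rewrite adj_mxM -(mulmxA a) proj_hodge_gram -scalemxAr -!scalemxAl.
have -> : adj_mx (P q) = (P (rev_ord q))^T by rewrite /adj_mx PJ.
rewrite -[a *m _ *m _]mulmxA [P p *m S *m _]mulmxA polC_orth //.
  by rewrite mul0mx mulmx0 scaler0.
by rewrite (inj_eq rev_ord_inj) eq_sym.
Qed.

(** Frames are chosen for p <= k - p and conjugated for the other indices; they stay orthonormal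
    because the Gram matrix is real. In the middle degree p = k - p the frame must be its own
    conjugate, which is where real bases are needed. *)
Lemma hodge_frames : exists e : 'I_k.+1 -> nat -> 'rV[C]_n,
  [/\ forall p i, (e p i <= F p)%MS,
      forall p q i j, e p i *m G *m adj_mx (e q j)
        = [&& p == q, i == j & (i < \rank (F p))%N]%:R%:M
    & forall p i, conj_mx (e p i) = e (rev_ord p) i].
Proof.
have [_ _ FJ] := Fdec.
have Gp := posdef_hodge_gram Qsym Fdec Fpol.
have [f fP] := boolp.choice (fun p => orthonormal_frame (F p) Gp conj_hodge_gram).
pose e (p : 'I_k.+1) i := if (p <= rev_ord p)%N then f p i else conj_mx (f (rev_ord p) i).
have eF p i : (e p i <= F p)%MS.
  rewrite /e; case: ifP => _; first by have [] := fP p.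
  have [/(_ i) fF _ _] := fP (rev_ord p).
  by rewrite -{2}[p]rev_ordK -FJ map_submx.
have adjJ (A : 'rV[C]_n) : adj_mx (conj_mx A) = conj_mx (adj_mx A).
  by apply/matrixP => a b; rewrite !mxE.
exists e; split=> // [p q i j|p i].
  have [<-|pq] := eqVneq p q; last by rewrite (hodge_gram_orth (eF p i) (eF q j) pq) raddf0.
  rewrite /e; case: ifP => _; first by have [_ -> _] := fP p.
  have [_ fG _] := fP (rev_ord p).
  rewrite adjJ -{1}conj_hodge_gram -!conj_mxM fG.
  have -> : \rank (F (rev_ord p)) = \rank (F p) by rewrite -FJ mxrank_map.
  by apply/matrixP => a b; rewrite !ord1 !mxE !mulr1n conjc_nat.
rewrite /e rev_ordK; have [pr|rp] := leqP p (rev_ord p); have [rp'|pr'] := leqP (rev_ord p) p.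
- have pE : rev_ord p = p by apply: val_inj; apply/eqP; rewrite eqn_leq rp' pr.
  have FpJ : (conj_mx (F p) :=: F p)%MS by have := FJ p; rewrite pE.
  by have [_ _ fJ] := fP p; rewrite pE fJ.
- by [].
- by rewrite conj_mxK.
- by have := ltn_trans rp pr'; rewrite ltnn.
Qed.

Lemma mxtrace_sqrB (A B : 'M[C]_n) :
  \tr ((A - B) *m (A - B)) = \tr (A *m A) + \tr (B *m B) - 2 * \tr (A *m B).
Proof.
rewrite mulmxBl !mulmxBr !raddfB /= [\tr (B *m A)]mxtrace_mulC.
by move: (\tr _) (\tr _) (\tr _) => x y z; ring.
Qed.

(** * The extremal direction *)

Section Model.
Variable e : 'I_k.+1 -> nat -> 'rV[C]_n.
Hypothesis eF : forall p i, (e p i <= F p)%MS.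
Hypothesis eG : forall p q i j, e p i *m G *m adj_mx (e q j)
        = [&& p == q, i == j & (i < \rank (F p))%N]%:R%:M.
Hypothesis eJ : forall p i, conj_mx (e p i) = e (rev_ord p) i.
Variables (N : nat) (g : nat -> nat -> nat).
Let up (j : 'I_k) : 'I_k.+1 := lift ord0 j.
Let lo (j : 'I_k) : 'I_k.+1 := widen_ord (leqnSn k) j.
Hypothesis g_up : forall i (j : 'I_k), g i j.+1 != 0%N -> (i < \rank (F (up j)))%N.
Hypothesis g_lo : forall i (j : 'I_k), g i j.+1 != 0%N -> (i < \rank (F (lo j)))%N.
Hypothesis g_rev : forall i (j : 'I_k), g i (rev_ord j).+1 = g i j.+1.
Hypothesis g_max : forall i, g i k.+1 = 0%N.

(* The f p i are the columns dual to the e p i, so f q j *m e p i is the         *)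
(* endomorphism that sends e q j to e p i and kills the rest of the frame.       *)
Definition dual_frame p i : 'cV[C]_n := G *m adj_mx (e p i).
Local Notation f := dual_frame.
Definition frame_unit p i : 'M[C]_n := f p i *m e p i.
Local Notation D := frame_unit.

Definition model_coef (j : 'I_k) i : C := (Num.sqrt (g i j.+1)%:R)%:C.
Definition model_mx : 'M[C]_n :=
  \sum_(j < k) \sum_(i < N) model_coef j i *: (f (up j) i *m e (lo j) i).
Local Notation Z := model_mx.

Lemma frame_dual p q i j : e p i *m f q j = [&& p == q, i == j & (i < \rank (F p))%N]%:R%:M.
Proof. by rewrite /dual_frame mulmxA eG. Qed.

Lemma conj_dual p i : conj_mx (f p i) = f (rev_ord p) i.
Proof.
rewrite /dual_frame conj_mxM conj_hodge_gram -eJ; congr (_ *m _).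
by apply/matrixP => a b; rewrite !mxE.
Qed.

Lemma dual_frame_rev p i : f (rev_ord p) i = G *m (e p i)^T.
Proof. by rewrite /dual_frame -eJ /adj_mx conj_mxK. Qed.

Local Opaque dual_frame.

Lemma mul_frame p i q i' q' j s l : (f p i *m e q i') *m (f q' j *m e s l) =
  [&& q == q', i' == j & (i' < \rank (F q))%N]%:R *: (f p i *m e s l).
Proof.
rewrite -mulmxA [e q i' *m _]mulmxA frame_dual.
by rewrite mul_scalar_mx -scalemxAr.
Qed.

Lemma rev_up j : rev_ord (up j) = lo (rev_ord j).
Proof. by apply: val_inj; rewrite /= /bump /= add1n subSS. Qed.

Lemma rev_lo j : rev_ord (lo j) = up (rev_ord j).
Proof. by apply: val_inj; rewrite /= /bump /= add1n; have := ltn_ord j; lia. Qed.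

Lemma up_inj : injective up.
Proof. exact: lift_inj. Qed.

Lemma lo_inj : injective lo.
Proof. by move=> i j ij; apply: val_inj; exact: (congr1 val ij). Qed.

Lemma model_coef_sqr j i : model_coef j i * model_coef j i = (g i j.+1)%:R.
Proof.
by rewrite /model_coef -rmorphM /= -expr2 sqr_sqrtr ?ler0n // rmorph_nat.
Qed.

Lemma conj_model : conj_mx Z =
  \sum_(j < k) \sum_(i < N) model_coef j i *: (f (lo j) i *m e (up j) i).
Proof.
rewrite conj_mx_sum (reindex_inj rev_ord_inj); apply: eq_bigr => j _ /=.
rewrite conj_mx_sum; apply: eq_bigr => i _.
rewrite conj_mxZ_real ?conjc_real // conj_mxM conj_dual eJ rev_up rev_lo rev_ordK.
by rewrite /model_coef g_rev.
Qed.

(** Products of matrix units: only equal indices meet, and the rank hypothesis makes the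
    intermediate frame vector nonzero wherever the coefficient is. *)
Lemma mul_model (a b c d : 'I_k -> 'I_k.+1) : injective b -> c =1 b ->
  (forall i (j : 'I_k), g i j.+1 != 0%N -> (i < \rank (F (b j)))%N) ->
  (\sum_(j < k) \sum_(i < N) model_coef j i *: (f (a j) i *m e (b j) i)) *m
  (\sum_(j < k) \sum_(i < N) model_coef j i *: (f (c j) i *m e (d j) i)) =
  \sum_(j < k) \sum_(i < N) (g i j.+1)%:R *: (f (a j) i *m e (d j) i).
Proof.
move=> binj cb gb; rewrite mulmx_suml; apply: eq_bigr => j _.
rewrite mulmx_suml; apply: eq_bigr => i _.
rewrite mulmx_sumr (bigD1 j) //= [X in _ + X]big1 ?addr0 => [|j' jj']; last first.
  rewrite mulmx_sumr big1 // => i' _.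
  by rewrite -scalemxAl -scalemxAr mul_frame cb (inj_eq binj) eq_sym (negPf jj') scale0r !scaler0.
rewrite mulmx_sumr (bigD1 i) //= [X in _ + X]big1 ?addr0 => [|i' ii']; last first.
  rewrite -scalemxAl -scalemxAr mul_frame (_ : (i == i' :> nat) = false) ?andbF ?scale0r ?scaler0 //.
  by rewrite eq_sym; apply/negbTE; rewrite (inj_eq val_inj).
rewrite -scalemxAl -scalemxAr scalerA model_coef_sqr mul_frame cb !eqxx /=.
have [g0|g0] := eqVneq (g i j.+1) 0%N; first by rewrite g0 !scale0r.
by rewrite gb // scale1r.
Qed.

Lemma model_mul : Z *m conj_mx Z = \sum_(j < k) \sum_(i < N) (g i j.+1)%:R *: D (up j) i.
Proof. by rewrite conj_model; apply: mul_model => //; apply: lo_inj. Qed.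

Lemma model_mulC : conj_mx Z *m Z = \sum_(j < k) \sum_(i < N) (g i j.+1)%:R *: D (lo j) i.
Proof. by rewrite conj_model; apply: mul_model => //; apply: up_inj. Qed.

Lemma trace_frame p q i j : \tr (f p i *m e q j) = [&& q == p, j == i & (j < \rank (F q))%N]%:R.
Proof. by rewrite mxtrace_mulC frame_dual mxtrace_scalar mulr1n. Qed.

Lemma model_trace : \tr (Z *m conj_mx Z) = (\sum_(j < k) \sum_(i < N) g i j.+1)%N%:R.
Proof.
rewrite model_mul (raddf_sum (@mxtrace C n)) natr_sum; apply: eq_bigr => j _ /=.
rewrite (raddf_sum (@mxtrace C n)) natr_sum; apply: eq_bigr => i _ /=.
rewrite mxtraceZ trace_frame !eqxx /=.
have [->|g0] := eqVneq (g i j.+1) 0%N; first by rewrite mul0r.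
by rewrite g_up // mulr1.
Qed.

Lemma trace_mul_units (a b : 'I_k -> 'I_k.+1) :
  (forall i (j : 'I_k), g i j.+1 != 0%N -> (i < \rank (F (a j)))%N) ->
  \tr ((\sum_(j < k) \sum_(i < N) (g i j.+1)%:R *: D (a j) i) *m
       (\sum_(j < k) \sum_(i < N) (g i j.+1)%:R *: D (b j) i)) =
  (\sum_(i < N) \sum_(j < k) \sum_(j' < k) (a j == b j') * (g i j.+1 * g i j'.+1))%N%:R.
Proof.
move=> ga; rewrite [in RHS]exchange_big /= mulmx_suml (raddf_sum (@mxtrace C n)) natr_sum.
apply: eq_bigr => j _ /=.
rewrite mulmx_suml (raddf_sum (@mxtrace C n)) natr_sum; apply: eq_bigr => i _ /=.
rewrite mulmx_sumr (raddf_sum (@mxtrace C n)) natr_sum; apply: eq_bigr => j' _ /=.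
rewrite mulmx_sumr (raddf_sum (@mxtrace C n)) (bigD1 i) //= [X in _ + X]big1 ?addr0 => [|i' ii'].
  rewrite -scalemxAl -scalemxAr scalerA mul_frame eqxx /= scalerA mxtraceZ trace_frame eqxx /= !natrM.
  have [->|g0] := eqVneq (g i j.+1) 0%N; first by rewrite !(mul0r, mulr0).
  rewrite ga //; case: eqP => [ab|_]; last by rewrite mulr0 !mul0r.
  by rewrite -ab eqxx ga // !mulr1 !mul1r.
rewrite -scalemxAl -scalemxAr mul_frame (_ : (i == i' :> nat) = false).
  by rewrite andbF scale0r !scaler0 mxtrace0.
by rewrite eq_sym; apply/negbTE; rewrite (inj_eq val_inj).
Qed.

(** The squares of Z Zb and Zb Z each contribute the sum of g^2. In the mixed term the upper end of
    one gap meets the lower end of the next, which gives products of neighbours. *)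
Lemma model_comm_trace (W : nat) :
  (\sum_(i < N) \sum_(j < k) g i j.+1 ^ 2 =
    W + \sum_(i < N) \sum_(j < k) g i j.+1 * g i j.+2)%N ->
  \tr (lie_br Z (conj_mx Z) *m lie_br Z (conj_mx Z)) = 2 * W%:R.
Proof.
move=> gW; rewrite lie_brE model_mul model_mulC.
set A := \sum_(j < k) _; set B := \sum_(j < k) _.
rewrite mxtrace_sqrB.
have diag (c : 'I_k -> 'I_k.+1) : injective c ->
  (\sum_(i < N) \sum_(j < k) \sum_(j' < k) (c j == c j') * (g i j.+1 * g i j'.+1)
    = \sum_(i < N) \sum_(j < k) g i j.+1 ^ 2)%N.
  move=> cinj; apply: eq_bigr => i _; apply: eq_bigr => j _.
  rewrite (bigD1 j) //= eqxx mul1n mulnn big1 ?addn0 // => j' jj'.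
  by rewrite (inj_eq cinj) eq_sym (negPf jj').
rewrite /A /B !trace_mul_units // (diag up up_inj) gW.
have -> : (\sum_(i < N) \sum_(j < k) \sum_(j' < k) (up j == lo j') * (g i j.+1 * g i j'.+1)
    = \sum_(i < N) \sum_(j < k) g i j.+1 * g i j.+2)%N.
  apply: eq_bigr => i _; apply: eq_bigr => j _.
  have E j' : (up j == lo j') = (j' == j.+1 :> nat).
    by rewrite -(inj_eq val_inj) /= /bump /= add1n eq_sym.
  have [jk|kj] := ltnP j.+1 k.
    rewrite (bigD1 (Ordinal jk)) //= E eqxx mul1n big1 ?addn0 // => j' jj'.
    rewrite E; case: eqP => // jE; case/eqP: jj'; exact: val_inj.
  (* The last gap has no successor, which agrees with the value 0 of [g] at k + 1. *)
  have -> : j.+2 = k.+1 by have := ltn_ord j; lia.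
  rewrite g_max muln0 big1 // => j' _; rewrite E; case: eqP => // jE.
  by have := ltn_ord j'; rewrite jE ltnNge kj.
rewrite natrD; move: (\sum_(i < N) _)%N => w.
by move: (W%:R : C) (w%:R : C) => x y; ring.
Qed.

Lemma weil_coef_neq0 (p : 'I_k.+1) : weil_coef R p != 0.
Proof. by rewrite /weil_coef expfz_neq0 // neq0Ci. Qed.

Lemma frame_polC p i :
  e p i *m S = ((-1) ^+ p * (weil_coef R (ord0 : 'I_k.+1))^-1) *: (f (rev_ord p) i)^T.
Proof.
have -> : (f (rev_ord p) i)^T = weil_coef R p *: (e p i *m S).
  rewrite dual_frame_rev trmx_mul trmxK hodge_gram_tr.
  have := eF p i; rewrite FP => /submxP[a ->].
  by rewrite -(mulmxA a) proj_hodge_gram -scalemxAr mulmxA.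
rewrite scalerA (weil_coefE R p) mulrACA mulVf ?weil_coef_neq0 // mulr1.
by rewrite -expr2 sqrr_sign scale1r.
Qed.

Lemma polC_frame p i :
  S *m (e p i)^T = ((-1) ^+ (k + p) * (weil_coef R (ord0 : 'I_k.+1))^-1) *: f (rev_ord p) i.
Proof.
have -> : S *m (e p i)^T = (e p i *m S^T)^T by rewrite trmx_mul trmxK.
by rewrite (polC_tr R Qsym) -scalemxAr frame_polC scalerA linearZ /= trmxK mulrA -exprD.
Qed.

(** Term [j] of Z S cancels against term [rev_ord j] of S Z^T: the coefficients agree by the mirror
    symmetry of [g], and the signs are opposite because k + (k - 1 - j) and j differ in parity. *)
Lemma model_isom : inf_isom Q Z = 0.
Proof.
have trZ c (A : 'M[C]_n) : (c *: A)^T = c *: A^T by rewrite linearZ.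
rewrite /inf_isom mulmx_suml (linear_sum (@trmx C n n)) mulmx_sumr /=.
rewrite [X in _ + X](reindex_inj rev_ord_inj) -big_split big1 // => j _ /=.
rewrite mulmx_suml (linear_sum (@trmx C n n)) mulmx_sumr /= -big_split big1 // => i _ /=.
rewrite -scalemxAl -mulmxA frame_polC rev_lo trZ -!scalemxAr.
rewrite [(_ *m e _ _)^T]trmx_mul [S *m (_ *m _)]mulmxA polC_frame.
rewrite rev_lo rev_ordK /model_coef g_rev -scalemxAl -scalerDr -scalerDl.
have -> : (-1) ^+ (k + lo (rev_ord j)) = - (-1) ^+ lo j :> C.
  have -> : (k + lo (rev_ord j) = (k - j.+1).*2.+1 + j)%N by have := ltn_ord j; rewrite /=; lia.
  by rewrite exprD -signr_odd /= odd_double /= expr1 mulN1r.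
by rewrite mulNr addrN scale0r scaler0.
Qed.

Lemma model_tr0 : \tr Z = 0.
Proof.
rewrite (raddf_sum (@mxtrace C n)) big1 // => j _ /=.
rewrite (raddf_sum (@mxtrace C n)) big1 // => i _ /=.
rewrite mxtraceZ trace_frame (_ : (lo j == up j) = false) ?mulr0 //.
by apply/negbTE/eqP => /(congr1 val); rewrite /= /bump /= add1n; lia.
Qed.

Lemma model_lower (r : 'I_k.+1) : (F r *m Z <= hodge_ext F (r%:Z - 1))%MS.
Proof.
rewrite mulmx_sumr; apply: summx_sub => j _; rewrite mulmx_sumr; apply: summx_sub => i _.
rewrite -scalemxAr mulmxA; apply: scalemx_sub.
have [rj|rj] := eqVneq r (up j).
  apply: submx_trans (submxMl _ _) _; apply: submx_trans (eF _ _) _.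
  rewrite /hodge_ext; apply: (sumsmx_sup (lo j)) => //.
  by rewrite rj /= /bump /= add1n; apply/eqP; lia.
have -> : F r *m f (up j) i = 0.
  apply/row_matrixP => l; rewrite row_mul row0 mulmxA.
  exact: hodge_gram_orth (row_sub _ _) (eF _ _) rj.
by rewrite mul0mx sub0mx.
Qed.

Lemma model_mem : Z \in lie_graded Q F (-1).
Proof. by apply/mem_lie_graded; split; [exact: model_isom|exact: model_tr0|exact: model_lower]. Qed.

End Model.

End HodgeFrames.

Section Sharpness.
Variables (R : realType) (n k : nat) (Q : 'M[int]_n) (h : 'I_k.+1 -> nat).
Local Notation C := R[i].
Hypothesis k_ge1 : (1 <= k)%N.
Hypothesis Qsym : Q^T = (-1) ^+ k *: Q.
Hypothesis h_gt0 : forall p, (0 < h p)%N.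
Variable F : 'I_k.+1 -> 'M[C]_n.
Hypothesis Fdom : period_domain Q h F.
Local Notation hn := [seq h (rev_ord j) | j <- enum 'I_k.+1].
Let size_hn := size_hodge_numbers h.
Let hnE z : (z < k.+1)%N -> nth 0%N hn z = h (inord z).
Proof. exact: (nth_hodge_numbers Fdom). Qed.

(** Frame vectors are numbered from 0 and the sets T_i from 1. *)
Let g i p := cross_count k.+1 (level hn i.+1) p.

Lemma level_hodge_out i z : (k.+1 <= z)%N -> ~~ level hn i.+1 z.
Proof. by move=> kz; rewrite /level nth_default ?size_hn. Qed.

Lemma level_hodge_rev i z : (z < k.+1)%N -> level hn i.+1 (k.+1 - z.+1)%N = level hn i.+1 z.
Proof.
move=> zk; rewrite /level !hnE //; last by rewrite subSS ltnS leq_subr.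
rewrite -(hodge_number_sym Fdom); congr (_ < h _)%N.
by apply: val_inj; rewrite /= !inordK //; lia.
Qed.

Lemma model_count_neq0 i (j : 'I_k) : g i j.+1 != 0%N ->
  (i < h (lift ord0 j))%N /\ (i < h (widen_ord (leqnSn k) j))%N.
Proof.
have jk : (j.+1 < k.+1)%N by rewrite ltnS.
move=> /cross_count_neq0[].
rewrite /level /= !hnE //; last exact: ltnW.
have -> : inord j.+1 = lift ord0 j :> 'I_k.+1.
  by apply: val_inj; rewrite /= inordK // /bump add1n.
have -> : inord j = widen_ord (leqnSn k) j :> 'I_k.+1.
  by apply: val_inj; rewrite /= inordK // ltnW.
by [].
Qed.

Lemma sum_model_count : (\sum_(i < sumn hn) \sum_(j < k) g i j.+1 = seg_weight hn)%N.
Proof.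
rewrite /seg_weight size_hn (iotaDl 1 0) big_map -[X in iota 0 X]subn0.
rewrite (big_mkord xpredT); apply: eq_bigr => i _.
rewrite -(sum_cross_count) big_ord_recl cross_count0 add0n.
by apply: eq_bigr => j _; rewrite lift0.
Qed.

Lemma sum_model_count_sqr :
  (\sum_(i < sumn hn) \sum_(j < k) g i j.+1 ^ 2
    = seg_weight hn + \sum_(i < sumn hn) \sum_(j < k) g i j.+1 * g i j.+2)%N.
Proof.
rewrite -sum_model_count -big_split; apply: eq_bigr => i _ /=.
have := sum_cross_count_sqr (@level_hodge_out i).
rewrite !big_ord_recl cross_count0 mul0n !add0n => E.
by apply: etrans E _; congr (_ + _)%N; apply: eq_bigr => j _; rewrite lift0.
Qed.

(** All Hodge numbers being positive, T_1 contains the segment [0, k], of weight k >= 1. The model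
    direction is thereby nonzero. *)
Lemma seg_weight_hodge_gt0 : (0 < seg_weight hn)%N.
Proof.
have hn_gt0 z : (z < k.+1)%N -> (0 < nth 0%N hn z)%N by move=> zk; rewrite hnE.
have s0 : (0 < sumn hn)%N.
  have := nth_leq_sumn hn 0; apply: leq_trans; exact: hn_gt0.
rewrite /seg_weight -[sumn hn]prednK // big_cons size_hn addn_gt0; apply/orP; left.
rewrite (bigD1 ord0) //= addn_gt0; apply/orP; left.
rewrite (bigD1 ord_max) //= addn_gt0; apply/orP; left.
rewrite subn0; have -> : seg (level hn 1) 0 k.
  by apply/segP => z /andP[_ zk]; apply: hn_gt0.
exact: k_ge1.
Qed.

(** The extremal direction is built at an arbitrary point of the domain, in accordance with
    homogeneity. *)
Lemma horizontal_sharp : exists X : 'M[C]_n,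
  [/\ X \in lie_graded Q F (-1), X != 0
    & hodge_curv Q F X = (- partition_const R (conj_partition hn))%:C].
Proof.
have [Fdec Frk Fpol] := Fdom.
have [e [eF eG eJ]] := hodge_frames Qsym Fdec Fpol.
have gu i (j : 'I_k) : g i j.+1 != 0%N -> (i < \rank (F (lift ord0 j)))%N.
  by rewrite Frk => /model_count_neq0[].
have gl i (j : 'I_k) : g i j.+1 != 0%N -> (i < \rank (F (widen_ord (leqnSn k) j)))%N.
  by rewrite Frk => /model_count_neq0[].
(* The mirror image of gap j + 1 is gap (k + 1) - (j + 1), that is, k - j. *)
have gr i (j : 'I_k) : g i (rev_ord j).+1 = g i j.+1.
  have jk : (j.+1 <= k.+1)%N by rewrite ltnW // ltnS.
  apply: etrans (cross_count_rev (@level_hodge_rev i) jk); rewrite /g.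
  by congr cross_count; rewrite /=; have := ltn_ord j; lia.
have gm i : g i k.+1 = 0%N by apply: cross_count_big.
pose X := model_mx Q F e (sumn hn) g.
have XF : X \in lie_graded Q F (-1) by apply: model_mem.
have t1 : \tr (X *m conj_mx X) = (seg_weight hn)%:R.
  by rewrite model_trace // exchange_big /= sum_model_count.
have t2 : \tr (lie_br X (conj_mx X) *m lie_br X (conj_mx X)) = 2 * (seg_weight hn)%:R.
  by apply: model_comm_trace => //; apply: sum_model_count_sqr.
have X0 : X != 0.
  apply: contraTneq seg_weight_hodge_gt0 => X0.
  move: t1; rewrite X0 mul0mx mxtrace0 => /esym/eqP; rewrite pnatr_eq0 => /eqP ->.
  by rewrite ltnn.
exists X; split => //; apply: horizontal_curv_eq => //.
by rewrite t1 t2 expr2 mulrA.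
Qed.

End Sharpness.

Theorem theorem1p6 (R : realType) (n k : nat) (Q : 'M[int]_n)
    (h : 'I_k.+1 -> nat)
    (k_ge1 : (1 <= k)%N)
    (Q_nondegenerate : \det Q != 0)
    (Q_symmetry : Q^T = (-1) ^+ k *: Q)
    (h_gt0 : forall p, (0 < h p)%N)
    (D_nonempty : exists F : 'I_k.+1 -> 'M[R[i]]_n, period_domain Q h F) :
  let hodge_numbers := [seq h (rev_ord j) | j <- enum 'I_k.+1] in
  let c := partition_const R (conj_partition hodge_numbers) in
  (forall (F : 'I_k.+1 -> 'M[R[i]]_n) (X : 'M[R[i]]_n),
     period_domain Q h F -> X \in lie_graded Q F (-1) -> X != 0 ->
     hodge_curv Q F X <= (- c)%:C) /\
  (exists (F : 'I_k.+1 -> 'M[R[i]]_n) (X : 'M[R[i]]_n),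
     [/\ period_domain Q h F, X \in lie_graded Q F (-1), X != 0
       & hodge_curv Q F X = (- c)%:C]).
Proof.
split=> [F X FD XF X0|]; first exact: (horizontal_curv_le k_ge1 Q_symmetry h_gt0 FD XF X0).
have [F FD] := D_nonempty.
have [X [XF X0 eqX]] := horizontal_sharp k_ge1 Q_symmetry h_gt0 FD.
by exists F, X.
Qed.
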